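(* Let $\sigma>0$ and let $\Upsilon$ be an open set with compact closure contained in $\Omega_\sigma$. Then there exist $N\in\mathbb N$ and $\lambda\in\mathbb R$ such that, with $\mathcal K u(x):=-N(N+1)u(x)+\lambda\sum_{i=0}^{N-1}\frac{(x-1)^i}{i!}u^{(i+1)}(1)$, for every $s\in\Upsilon$ and every $f\in Y^\sigma$ there exists a unique $u\in X^\sigma$ with $\frac{d}{dx}\big(x^2\frac{du}{dx}\big)+s\frac{du}{dx}+\mathcal Ku=f$ (and $u(1)=0$). Writing $u=R(s)f$, the map $s\mapsto R(s):Y^\sigma\to X^\sigma$ is a holomorphic family of bounded operators on $\Upsilon$.
   Context: Let $I=(0,1)$. For $\sigma>0$, $u\in C^\infty(\overline I)$, integers $0\le N\le M$, $k\in\{0,1,2\}$, $l\in\{0,1\}$, set $|u|^{N,M}_{\sigma,k,l}=\big(\sum_{n=N}^M\frac{\sigma^{2n}}{n!^2(n+1)!^2}n^{k+l}\int_0^1(x/\sigma)^k|\partial_x^nu|^2dx\big)^{1/2}$ (with $0^0:=1$), $|u|^N_{\sigma,k,l}$ the same with $M=\infty$; $\|u\|_{\sigma,0,0}=|u|^0_{\sigma,0,0}$. Boundary seminorms: $[u]^{N,M}_\sigma=(\sum_{n=N}^M\frac{\sigma^{2n+1}}{n!^2(n+1)!^2}|u^{(n)}(0)|^2)^{1/2}$, $[u]^N_\sigma$ the same with $M=\infty$. $X^\sigma=\{u\in C^\infty(\overline I):u(1)=0,\ \|\partial_xu\|_{\sigma,0,0}+|\partial_xu|^0_{\sigma,1,0}+|\partial_xu|^0_{\sigma,2,0}+[\partial_xu]^0_\sigma<\infty\}$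 and $Y^\sigma=\{u\in C^\infty(\overline I):\|u\|_{\sigma,0,0}+|u|^0_{\sigma,1,0}+[u]^0_\sigma<\infty\}$, Hilbert spaces with norms $\|u\|_{X^\sigma}=(\|\partial_xu\|_{\sigma,0,0}^2+(|\partial_xu|^0_{\sigma,1,0})^2+(|\partial_xu|^0_{\sigma,2,0})^2+([\partial_xu]^0_\sigma)^2)^{1/2}$, $\|u\|_{Y^\sigma}=(\|u\|_{\sigma,0,0}^2+(|u|^0_{\sigma,1,0})^2+([u]^0_\sigma)^2)^{1/2}$. For $\sigma>0$: $\Omega^1_\sigma=\{s:\Re s\le0,\ \sigma<|\Im s|\}\cup\{s:\Re s>0,\ \sigma<|s|\}$; $\Omega^2_\sigma=\{s:\ \sigma<|s|+\Re s,\ \sigma>\frac{-\Re(s)|s|}{2(|s|+\Re s)}\}$; $\Omega^3_\sigma=\{s\neq0:\ \sigma(|s|-\sigma+\Re s)-(\sigma(1+\frac{\Re s}{|s|})+\frac12\Re s)^2>0\}$; $\Omega_\sigma=\Omega^1_\sigma\cap(\Omega^2_\sigma\cup\Omega^3_\sigma)$. *)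

(* Defs.v *)
From Stdlib Require Import Arith Reals Lra List ClassicalEpsilon.
Open Scope R_scope.

Definition cplx : Type := (R * R)%type.
Definition Re (z : cplx) : R := fst z.
Definition Im (z : cplx) : R := snd z.
Definition c0 : cplx := (0, 0).
Definition cadd (z w : cplx) : cplx := (fst z + fst w, snd z + snd w).
Definition copp (z : cplx) : cplx := (- fst z, - snd z).
Definition csub (z w : cplx) : cplx := cadd z (copp w).
Definition cmul (z w : cplx) : cplx :=
  (fst z * fst w - snd z * snd w, fst z * snd w + snd z * fst w).
Definition cscal (r : R) (z : cplx) : cplx := (r * fst z, r * snd z).
Definition cnorm2 (z : cplx) : R := fst z ^ 2 + snd z ^ 2.
Definition cnorm (z : cplx) : R := sqrt (cnorm2 z).
Definition cinv (z : cplx) : cplx := (fst z / cnorm2 z, - snd z / cnorm2 z).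

Definition openC (S : cplx -> Prop) : Prop :=
  forall z, S z -> exists r, r > 0 /\ forall w, cnorm (csub w z) < r -> S w.
Definition closureC (S : cplx -> Prop) (z : cplx) : Prop :=
  forall r, r > 0 -> exists w, S w /\ cnorm (csub w z) < r.
Definition compactC (K : cplx -> Prop) : Prop :=
  forall (I : Type) (U : I -> cplx -> Prop),
    (forall i, openC (U i)) ->
    (forall z, K z -> exists i, U i z) ->
    exists l : list I, forall z, K z -> exists i, In i l /\ U i z.

Definition Omega1 (sigma : R) (s : cplx) : Prop :=
  (Re s <= 0 /\ sigma < Rabs (Im s)) \/ (Re s > 0 /\ sigma < cnorm s).
Definition Omega2 (sigma : R) (s : cplx) : Prop :=
  sigma < cnorm s + Re s /\
  sigma > - Re s * cnorm s / (2 * (cnorm s + Re s)).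
Definition Omega3 (sigma : R) (s : cplx) : Prop :=
  s <> c0 /\
  sigma * (cnorm s - sigma + Re s)
    - (sigma * (1 + Re s / cnorm s) + / 2 * Re s) ^ 2 > 0.
Definition Omega (sigma : R) (s : cplx) : Prop :=
  Omega1 sigma s /\ (Omega2 sigma s \/ Omega3 sigma s).

Definition Icl (x : R) : Prop := 0 <= x <= 1.

Definition deriv_on_I (f g : R -> R) : Prop :=
  forall x, Icl x ->
    limit1_in (fun h => (f h - f x) / (h - x)) (fun h => Icl h /\ h <> x) (g x) x.

(* A "tower" U encodes a complex valued u in C^infinity([0,1]) together with
   all its derivatives: U n is the n-th derivative u^(n) on [0,1]. *)
Definition tower : Type := nat -> R -> cplx.
Definition is_tower (U : tower) : Prop :=
  forall n, deriv_on_I (fun x => fst (U n x)) (fun x => fst (U (S n) x)) /\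
            deriv_on_I (fun x => snd (U n x)) (fun x => snd (U (S n) x)).

Definition tsub (U V : tower) : tower := fun n x => csub (U n x) (V n x).
Definition tcmul (c : cplx) (U : tower) : tower := fun n x => cmul c (U n x).
Definition tshift (U : tower) : tower := fun n => U (S n).

Definition Int01 (f : R -> R) : R :=
  epsilon (inhabits 0) (fun I => exists pr : Riemann_integrable f 0 1, RiemannInt pr = I).
Definition converges (a : nat -> R) : Prop := exists l, infinite_sum a l.
Definition Series (a : nat -> R) : R := epsilon (inhabits 0) (fun l => infinite_sum a l).

Definition wcoef (sigma : R) (n : nat) : R :=
  sigma ^ (2 * n) / ((INR (fact n)) ^ 2 * (INR (fact (n + 1))) ^ 2).

(* n-th term of (|u|^0_{sigma,k,l})^2 ; note (INR 0)^0 = 1 *)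
Definition wterm (sigma : R) (k l : nat) (U : tower) (n : nat) : R :=
  wcoef sigma n * (INR n) ^ (k + l) *
  Int01 (fun x => (x / sigma) ^ k * cnorm2 (U n x)).

Definition bterm (sigma : R) (U : tower) (n : nat) : R :=
  sigma ^ (2 * n + 1) / ((INR (fact n)) ^ 2 * (INR (fact (n + 1))) ^ 2)
  * cnorm2 (U n 0).

Definition inY (sigma : R) (U : tower) : Prop :=
  is_tower U /\ converges (wterm sigma 0 0 U) /\ converges (wterm sigma 1 0 U)
  /\ converges (bterm sigma U).
Definition normY (sigma : R) (U : tower) : R :=
  sqrt (Series (wterm sigma 0 0 U) + Series (wterm sigma 1 0 U) + Series (bterm sigma U)).

Definition inX (sigma : R) (U : tower) : Prop :=
  is_tower U /\ U 0%nat 1 = c0 /\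
  converges (wterm sigma 0 0 (tshift U)) /\ converges (wterm sigma 1 0 (tshift U)) /\
  converges (wterm sigma 2 0 (tshift U)) /\ converges (bterm sigma (tshift U)).
Definition normX (sigma : R) (U : tower) : R :=
  sqrt (Series (wterm sigma 0 0 (tshift U)) + Series (wterm sigma 1 0 (tshift U))
        + Series (wterm sigma 2 0 (tshift U)) + Series (bterm sigma (tshift U))).

Fixpoint csum (m : nat) (g : nat -> cplx) : cplx :=
  match m with O => c0 | S m' => cadd (csum m' g) (g m') end.

Definition Kop (N : nat) (lam : R) (U : tower) (x : R) : cplx :=
  cadd (cscal (- (INR N * (INR N + 1))) (U 0%nat x))
       (cscal lam (csum N (fun i => cscal ((x - 1) ^ i / INR (fact i)) (U (S i) 1)))).

(* d/dx (x^2 u') + s u' + K u = f on [0,1]; d/dx(x^2 u') = x^2 u'' + 2 x u' *)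
Definition solves (N : nat) (lam : R) (s : cplx) (U F : tower) : Prop :=
  forall x, Icl x ->
    cadd (cadd (cadd (cscal (x ^ 2) (U 2%nat x)) (cscal (2 * x) (U 1%nat x)))
               (cmul s (U 1%nat x)))
         (Kop N lam U x) = F 0%nat x.

(* Main.v *)
From Stdlib Require Import Arith Reals Lra Lia List ClassicalEpsilon.
From Coquelicot Require Import Coquelicot.
Require Import Defs.
Open Scope R_scope.

(** With [v = u'], differentiating the equation [n >= N] times gives
      [x^2 v_(n+1) + (2(n+1)x + s) v_n + (n(n+1) - N(N+1)) v_(n-1) = f_n],
    in which neither [lam] nor lower derivatives than [v_N] occur, while the first [N] derivatives
    at [x = 1] form a finite linear system that is diagonally dominant for large [lam].
    With [b = Im s], [eps] the sign of [b] and [y = (n+1)x/sigma], pairing the differentiated equation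
    with [2 i eps v_n + y v_n + i eps x/(n+1) v_(n+1)] and integrating by parts yields, after
    summation against the Gevrey weights and up to errors [O(1/n)], the quadratic forms
    [sigma y^2 + |b| - sigma] and [sigma y^2 + Re s y + |b|].  Both are coercive on [Omega], since
    there [Re s <= 0] forces [|b| > sigma] and [(Re s)^2 < 4 sigma |b|]; a large [N] absorbs the errors.
    When [Re s > 0] the multiplier [(1 + y) v_n] suffices, the boundary terms at [x = 0] being
    controlled by [|s| > sigma].  This gives an a priori bound, uniform on compact sets, on a region
    stable under [s |-> s + tau], [tau >= 0].
    For large real [s] the first-order equation for [w = v_N] is solved by
      [w(x) = int_0^oo exp(-st) (1+xt)^(-2N-2) f_N(x/(1+xt)) dt],
    and the method of continuity in [s] carries solvability from there to all of [Ups].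
    Holomorphy follows from the resolvent identity. *)

(** * Calculus on the closed unit interval *)

(** The obstacle is that the first multiplier leaves, after telescoping in [n], a term at the last
    level that tends to zero only if [u] is already known to lie in X: it gives an estimate but no
    regularity. The multiplier [(1 + y) v_n] leaves a term of favourable sign instead, so for
    [Re s >= d] a merely smooth solution automatically belongs to X. Hence solvability starts at a
    real point far to the right, where an explicit integral gives a smooth solution without any
    Gevrey control, and is then carried leftwards. Each step of that continuation is a Neumann
    series: X controls one derivative more than Y, [d/dx] maps X into Y with norm at most 1, and so
    a change of [s] is a bounded perturbation. The shift [-N(N+1)] cancels the coefficient [n(n+1)]
    exactly at [n = N]; the levels [n >= N] then receive nothing from below, and level [N] is a
    first-order equation for [v_N] alone. [N] is fixed first, from the margin [d] on the compact set
    and the size of the path; [lam] is chosen afterwards in terms of [N]. *)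

Lemma div_le_1 (a b : R) : 0 < b -> a <= b -> a / b <= 1.
Proof. intros Hb H. now apply (proj1 (Rdiv_le_1 a b Hb)). Qed.

Lemma Rinv_01 (t : R) : 1 <= t -> 0 < / t <= 1.
Proof.
  intros H. split; [apply Rinv_0_lt_compat; lra|].
  rewrite <- Rinv_1. apply Rinv_le_contravar; lra.
Qed.

Definition clamp (x : R) : R := Rmax 0 (Rmin 1 x).

(** Continuity on the closed interval is encoded as global continuity after clamping, so that
    integrals and primitives over the whole line apply and no one-sided limits occur. *)
Definition contI (f : R -> R) : Prop :=
  forall x, continuous (fun y => f (clamp y)) x.

(** Two-sided derivatives inside and continuity up to the ends replace the one-sided derivatives of
    [deriv_on_I]; [dI_deriv_on_I] and [deriv_on_I_dI] translate between the two. *)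
Definition dI (f g : R -> R) : Prop :=
  contI f /\ contI g /\ forall x, 0 < x < 1 -> is_derive f x (g x).

Lemma clamp_Icl (x : R) : Icl (clamp x).
Proof.
  unfold clamp, Icl; split; [apply Rmax_l|].
  apply Rmax_lub; [lra|apply Rmin_l].
Qed.

Lemma clamp_id (x : R) : Icl x -> clamp x = x.
Proof.
  intros [H0 H1]; unfold clamp.
  rewrite Rmin_right, Rmax_right; lra.
Qed.

Lemma clamp_lipschitz (x y : R) : Rabs (clamp y - clamp x) <= Rabs (y - x).
Proof.
  unfold clamp, Rmax, Rmin.
  repeat destruct Rle_dec; unfold Rabs; repeat destruct Rcase_abs; lra.
Qed.

Lemma continuous_eps (f : R -> R) (x : R) :
  (forall eps, eps > 0 -> exists del, del > 0 /\
     forall y, Rabs (y - x) < del -> Rabs (f y - f x) < eps) ->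
  continuous f x.
Proof.
  intros H. apply filterlim_locally. intros eps.
  destruct (H eps (cond_pos eps)) as [d [Hd Hy]].
  exists (mkposreal d Hd). intros y By. apply Hy. exact By.
Qed.

Lemma continuous_clamp (x : R) : continuous clamp x.
Proof.
  apply continuous_eps. intros eps He. exists eps; split; [exact He|].
  intros y Hy. pose proof (clamp_lipschitz x y); lra.
Qed.

Lemma contI_const (c : R) : contI (fun _ => c).
Proof. intros x; apply continuous_const. Qed.

Lemma contI_id : contI (fun x => x).
Proof. intros x; apply continuous_clamp. Qed.

Lemma contI_plus (f g : R -> R) : contI f -> contI g -> contI (fun x => f x + g x).
Proof. intros Hf Hg x; exact (continuous_plus _ _ x (Hf x) (Hg x)). Qed.

Lemma contI_opp (f : R -> R) : contI f -> contI (fun x => - f x).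
Proof. intros Hf x; exact (continuous_opp _ x (Hf x)). Qed.

Lemma contI_minus (f g : R -> R) : contI f -> contI g -> contI (fun x => f x - g x).
Proof. intros Hf Hg x; exact (continuous_minus _ _ x (Hf x) (Hg x)). Qed.

Lemma contI_mult (f g : R -> R) : contI f -> contI g -> contI (fun x => f x * g x).
Proof. intros Hf Hg x; exact (continuous_mult _ _ x (Hf x) (Hg x)). Qed.

Lemma contI_div_const (f : R -> R) (c : R) : contI f -> contI (fun x => f x / c).
Proof. intros Hf; apply contI_mult; [exact Hf|apply contI_const]. Qed.

Lemma contI_pow (f : R -> R) (n : nat) : contI f -> contI (fun x => f x ^ n).
Proof.
  intros Hf; induction n as [|n IH]; simpl; [apply contI_const|].
  now apply contI_mult.
Qed.

Lemma contI_max (f g : R -> R) : contI f -> contI g -> contI (fun x => Rmax (f x) (g x)).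
Proof.
  intros Hf Hg x.
  apply (continuous_ext
    (fun y => (f (clamp y) + g (clamp y) + Rabs (f (clamp y) - g (clamp y))) / 2)).
  { intros y. unfold Rmax, Rabs; destruct Rcase_abs, Rle_dec; lra. }
  apply (continuous_mult (K := R_AbsRing)); [|apply continuous_const].
  apply (continuous_plus (V := R_NormedModule)).
  - exact (continuous_plus _ _ x (Hf x) (Hg x)).
  - apply (continuous_Rabs_comp (fun y => f (clamp y) - g (clamp y))). exact (continuous_minus _ _ x (Hf x) (Hg x)).
Qed.

Lemma contI_ext (f g : R -> R) : (forall x, Icl x -> f x = g x) -> contI f -> contI g.
Proof.
  intros E Hf x. apply (continuous_ext (fun y => f (clamp y))); [|apply Hf].
  intros y; apply E, clamp_Icl.
Qed.

Ltac contI_tac :=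
  repeat match goal with
  | H : contI ?f |- contI (fun x => ?f x) => exact H
  | H : contI ?f |- contI ?f => exact H
  | |- contI (fun _ => ?c) => apply contI_const
  | |- contI (Rmult ?c) => apply (contI_mult (fun _ => c) (fun x => x))
  | |- contI (Rplus ?c) => apply (contI_plus (fun _ => c) (fun x => x))
  | |- contI (fun x => x) => apply contI_id
  | |- contI (fun x => _ / _) => apply contI_div_const
  | |- contI (fun x => _ + _) => apply contI_plus
  | |- contI (fun x => _ - _) => apply contI_minus
  | |- contI (fun x => - _) => apply contI_opp
  | |- contI (fun x => _ * _) => apply contI_mult
  | |- contI (fun x => _ ^ _) => apply contI_pow
  | |- contI (fun x => Rmax _ _) => apply contI_max
  end.

Lemma contI_at (f : R -> R) (x : R) : contI f -> Icl x ->
  forall eps, eps > 0 -> exists del, del > 0 /\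
    forall y, Icl y -> Rabs (y - x) < del -> Rabs (f y - f x) < eps.
Proof.
  intros Hf Hx eps He.
  pose proof (proj1 (filterlim_locally _ _) (Hf x) (mkposreal eps He)) as [d Hd].
  exists d; split; [apply cond_pos|].
  intros y Hy Hyx. specialize (Hd y Hyx).
  rewrite (clamp_id y Hy), (clamp_id x Hx) in Hd. exact Hd.
Qed.

Lemma contI_bounded (f : R -> R) : contI f ->
  exists C, 0 <= C /\ forall x, Icl x -> Rabs (f x) <= C.
Proof.
  intros Hf.
  destruct (continuity_ab_maj (fun x => Rabs (f (clamp x))) 0 1) as [m [Hm _]]; [lra| |].
  { intros c _. apply continuity_pt_filterlim. apply (continuous_Rabs_comp (fun x => f (clamp x))), Hf. }
  exists (Rabs (f (clamp m))); split; [apply Rabs_pos|].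
  intros x Hx. specialize (Hm x Hx). rewrite (clamp_id x Hx) in Hm. exact Hm.
Qed.

Lemma deriv_on_I_eps (f g : R -> R) (x : R) : deriv_on_I f g -> Icl x ->
  forall eps, eps > 0 -> exists del, del > 0 /\ forall y, Icl y -> Rabs (y - x) < del ->
    Rabs (f y - f x - (y - x) * g x) <= eps * Rabs (y - x).
Proof.
  intros H Hx eps He. destruct (H x Hx eps He) as [d [Hd Hy]].
  exists d; split; [exact Hd|]. intros y Iy Dy.
  destruct (Req_dec y x) as [->|Hne].
  { rewrite !Rminus_diag, Rmult_0_l, Rminus_0_r, Rabs_R0; lra. }
  assert (Hq : Rabs ((f y - f x) / (y - x) - g x) < eps).
  { apply (Hy y). split; [split; assumption|exact Dy]. }
  replace (f y - f x - (y - x) * g x) with (((f y - f x) / (y - x) - g x) * (y - x))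
    by (field; lra).
  rewrite Rabs_mult. apply Rmult_le_compat_r; [apply Rabs_pos|lra].
Qed.

Lemma deriv_on_I_contI (f g : R -> R) : deriv_on_I f g -> contI f.
Proof.
  intros H x. apply continuous_eps. intros eps He.
  pose proof (clamp_Icl x) as Ic. set (c := clamp x) in *.
  destruct (deriv_on_I_eps f g c H Ic 1 ltac:(lra)) as [d [Hd Hy]].
  set (L := Rabs (g c) + 1). assert (HL : 0 < L) by (unfold L; pose proof (Rabs_pos (g c)); lra).
  exists (Rmin d (eps / L)); split.
  { apply Rmin_glb_lt; [lra|]. apply Rdiv_lt_0_compat; lra. }
  intros y Dy. pose proof (Rmin_l d (eps / L)); pose proof (Rmin_r d (eps / L)).
  pose proof (clamp_lipschitz x y) as Ll. fold c in Ll.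
  specialize (Hy (clamp y) (clamp_Icl y) ltac:(lra)).
  set (h := clamp y - c) in *.
  replace (f (clamp y) - f c) with ((f (clamp y) - f c - h * g c) + h * g c) by ring.
  apply Rle_lt_trans with (1 := Rabs_triang _ _). rewrite Rabs_mult.
  assert (Rabs h < eps / L) by lra.
  assert (L * Rabs h < eps).
  { apply Rlt_le_trans with (L * (eps / L)); [apply Rmult_lt_compat_l; lra|].
    right; field; lra. }
  unfold L in *; nra.
Qed.

Lemma deriv_on_I_interior (f g : R -> R) (x : R) :
  deriv_on_I f g -> 0 < x < 1 -> is_derive f x (g x).
Proof.
  intros H Hx. apply is_derive_Reals. intros eps He.
  destruct (H x ltac:(unfold Icl; lra) eps He) as [d [Hd Hy]].
  assert (Hm : 0 < Rmin d (Rmin x (1 - x))) by (repeat apply Rmin_glb_lt; lra).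
  exists (mkposreal _ Hm). simpl. intros h Hh0 Hh.
  pose proof (Rmin_l d (Rmin x (1 - x))); pose proof (Rmin_r d (Rmin x (1 - x))).
  pose proof (Rmin_l x (1 - x)); pose proof (Rmin_r x (1 - x)).
  apply Rabs_def2 in Hh as Hh'.
  specialize (Hy (x + h)). simpl in Hy. unfold Rdist in Hy.
  replace (x + h - x) with h in Hy by ring.
  apply Hy. repeat split; lra.
Qed.

Lemma clamp_locally (f : R -> R) (x : R) : 0 < x < 1 -> locally x (fun y => f y = f (clamp y)).
Proof.
  intros Hx. assert (Hm : 0 < Rmin x (1 - x)) by (apply Rmin_glb_lt; lra).
  exists (mkposreal _ Hm). intros y By.
  assert (By' : Rabs (y - x) < Rmin x (1 - x)) by exact By.
  pose proof (Rmin_l x (1 - x)); pose proof (Rmin_r x (1 - x)).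
  apply Rabs_def2 in By'. rewrite clamp_id; [reflexivity|unfold Icl; lra].
Qed.

Lemma mean_value_dI (f g : R -> R) (a b : R) : dI f g -> Icl a -> Icl b ->
  exists c, Rmin a b <= c <= Rmax a b /\ f b - f a = g c * (b - a).
Proof.
  intros [Cf [Cg D]] Ia Ib.
  destruct (MVT_gen (fun x => f (clamp x)) a b g) as [c [Hc E]].
  - intros x Hx. assert (Hx' : 0 < x < 1).
    { unfold Icl in *; unfold Rmin, Rmax in Hx; destruct Rle_dec; lra. }
    apply (is_derive_ext_loc f); [now apply clamp_locally|now apply D].
  - intros x _. apply continuity_pt_filterlim, Cf.
  - exists c; split; [exact Hc|].
    rewrite (clamp_id a Ia), (clamp_id b Ib) in E. exact E.
Qed.

Lemma Icl_between (a b c : R) : Icl a -> Icl b -> Rmin a b <= c <= Rmax a b -> Icl c.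
Proof. unfold Icl, Rmin, Rmax; destruct Rle_dec; lra. Qed.

(** The mean value theorem turns a difference quotient, even at an endpoint, into a value of [g] at
    a nearby point, and [g] is continuous. *)
Lemma dI_deriv_on_I (f g : R -> R) : dI f g -> deriv_on_I f g.
Proof.
  intros D x Ix eps He. pose proof D as [_ [Cg _]].
  destruct (contI_at g x Cg Ix eps He) as [d [Hd Hy]].
  exists d; split; [exact Hd|]. intros y [[Iy Hne] Dy].
  simpl in *. unfold Rdist in *.
  destruct (mean_value_dI f g x y D Ix Iy) as [c [Hc E]].
  rewrite E. replace (g c * (y - x) / (y - x)) with (g c) by (field; lra).
  apply Hy.
  - exact (Icl_between _ _ _ Ix Iy Hc).
  - revert Dy; unfold Rmin, Rmax in Hc; destruct Rle_dec;
      unfold Rabs; repeat destruct Rcase_abs; lra.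
Qed.

Lemma deriv_on_I_dI (f g h : R -> R) : deriv_on_I f g -> deriv_on_I g h -> dI f g.
Proof.
  intros H H'. split; [|split].
  - exact (deriv_on_I_contI _ _ H).
  - exact (deriv_on_I_contI _ _ H').
  - intros x Hx. now apply deriv_on_I_interior.
Qed.

Lemma Icl_nearby (x d : R) : Icl x -> 0 < d ->
  exists y, 0 < y < 1 /\ 0 < Rabs (y - x) < d.
Proof.
  intros Ix Hd. set (e := Rmin (1 / 4) (d / 2)).
  pose proof (Rmin_l (1 / 4) (d / 2)); pose proof (Rmin_r (1 / 4) (d / 2)).
  assert (0 < e) by (apply Rmin_glb_lt; lra). fold e in H, H0. unfold Icl in *.
  destruct (Rle_dec x (1 / 2)).
  - exists (x + e). replace (x + e - x) with e by ring. rewrite Rabs_pos_eq; lra.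
  - exists (x - e). replace (x - e - x) with (- e) by ring. rewrite Rabs_Ropp, Rabs_pos_eq; lra.
Qed.

Lemma deriv_on_I_unique (f g g' : R -> R) :
  deriv_on_I f g -> deriv_on_I f g' -> forall x, Icl x -> g x = g' x.
Proof.
  intros H H' x Ix. apply cond_eq. intros eps He.
  destruct (deriv_on_I_eps f g x H Ix (eps / 4) ltac:(lra)) as [d [Hd Hy]].
  destruct (deriv_on_I_eps f g' x H' Ix (eps / 4) ltac:(lra)) as [d' [Hd' Hy']].
  destruct (Icl_nearby x (Rmin d d') Ix) as [y [Iy0 [Y0 Y]]]; [now apply Rmin_glb_lt|].
  assert (Iy : Icl y) by (unfold Icl; lra).
  assert (Y1 : Rabs (y - x) < d) by (pose proof (Rmin_l d d'); lra).
  assert (Y2 : Rabs (y - x) < d') by (pose proof (Rmin_r d d'); lra).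
  specialize (Hy y Iy Y1). specialize (Hy' y Iy Y2).
  assert (Rabs ((y - x) * (g x - g' x)) <= eps / 2 * Rabs (y - x)).
  { replace ((y - x) * (g x - g' x)) with
      ((f y - f x - (y - x) * g' x) - (f y - f x - (y - x) * g x)) by ring.
    apply Rle_trans with (1 := Rabs_triang _ _). rewrite Rabs_Ropp. lra. }
  rewrite Rabs_mult in H0.
  assert (Rabs (g x - g' x) <= eps / 2) by (apply Rmult_le_reg_l with (Rabs (y - x)); lra).
  lra.
Qed.

Lemma deriv_on_I_ext (f f' g g' : R -> R) :
  (forall x, Icl x -> f x = f' x) -> (forall x, Icl x -> g x = g' x) ->
  deriv_on_I f g -> deriv_on_I f' g'.
Proof.
  intros Ef Eg H x Ix eps He. destruct (H x Ix eps He) as [d [Hd Hy]].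
  exists d; split; [exact Hd|]. intros y [[Iy Hne] Dy].
  rewrite <- (Ef y Iy), <- (Ef x Ix), <- (Eg x Ix). apply Hy. split; [split|]; assumption.
Qed.

(* Quadratic remainder bounds survive pointwise limits and integration in a parameter. *)
Lemma quadratic_remainder_deriv (f g : R -> R) (C : R) :
  (forall x y, Icl x -> Icl y -> Rabs (f y - f x - (y - x) * g x) <= C * (y - x) ^ 2) ->
  deriv_on_I f g.
Proof.
  intros H x Ix eps He.
  assert (HC : 0 <= Rabs C) by apply Rabs_pos.
  exists (eps / (Rabs C + 1)); split; [apply Rdiv_lt_0_compat; lra|].
  intros y [[Iy Hne] Dy]. simpl in *. unfold Rdist in *.
  assert (Hp : 0 < Rabs (y - x)) by (apply Rabs_pos_lt; lra).
  specialize (H x y Ix Iy).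
  assert (E : (f y - f x) / (y - x) - g x = (f y - f x - (y - x) * g x) / (y - x))
    by (field; lra).
  rewrite E. unfold Rdiv at 1. rewrite Rabs_mult, Rabs_inv.
  apply Rmult_lt_reg_r with (Rabs (y - x)); [exact Hp|].
  rewrite Rmult_assoc, Rinv_l, Rmult_1_r by lra.
  apply Rle_lt_trans with (1 := H).
  apply Rle_lt_trans with (Rabs C * (Rabs (y - x) * Rabs (y - x))).
  { rewrite <- Rabs_mult. replace ((y - x) * (y - x)) with ((y - x) ^ 2) by ring.
    rewrite (Rabs_pos_eq ((y - x) ^ 2)) by apply pow2_ge_0.
    apply Rmult_le_compat_r; [apply pow2_ge_0|apply Rle_abs]. }
  assert (Rabs (y - x) * (Rabs C + 1) < eps).
  { apply Rlt_le_trans with (eps / (Rabs C + 1) * (Rabs C + 1)); [apply Rmult_lt_compat_r; lra|].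
    right; field; lra. }
  nra.
Qed.

(** The mean value theorem is applied twice; the first intermediate point is no farther from [x]
    than [y] is, which gives the second factor [y - x]. *)
Lemma taylor_remainder (f g h : R -> R) (C : R) : dI f g -> dI g h ->
  (forall x, Icl x -> Rabs (h x) <= C) ->
  forall x y, Icl x -> Icl y -> Rabs (f y - f x - (y - x) * g x) <= C * (y - x) ^ 2.
Proof.
  intros D D' B x y Ix Iy.
  destruct (mean_value_dI f g x y D Ix Iy) as [c [Hc E]].
  pose proof (Icl_between _ _ _ Ix Iy Hc) as Ic.
  destruct (mean_value_dI g h x c D' Ix Ic) as [c' [Hc' E']].
  pose proof (Icl_between _ _ _ Ix Ic Hc') as Ic'.
  replace (f y - f x - (y - x) * g x) with ((h c' * (c - x)) * (y - x))
    by (rewrite E, <- E'; ring).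
  rewrite !Rabs_mult.
  assert (Rabs (c - x) <= Rabs (y - x)).
  { unfold Rmin, Rmax in Hc; destruct Rle_dec; unfold Rabs; repeat destruct Rcase_abs; lra. }
  replace ((y - x) ^ 2) with (Rabs (y - x) * Rabs (y - x))
    by (rewrite <- (pow2_abs (y - x)); ring).
  specialize (B c' Ic'). pose proof (Rabs_pos (h c')). pose proof (Rabs_pos (c - x)).
  rewrite <- Rmult_assoc. apply Rmult_le_compat_r; [apply Rabs_pos|].
  now apply Rmult_le_compat.
Qed.

(** * Integrals over the unit interval and a one-dimensional Sobolev inequality *)

Lemma ex_RInt_contI (f : R -> R) (a b : R) : Icl a -> Icl b -> contI f -> ex_RInt f a b.
Proof.
  intros Ia Ib Cf. apply (ex_RInt_ext (fun x => f (clamp x))).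
  - intros x Hx. rewrite clamp_id; [reflexivity|].
    unfold Icl in *; unfold Rmin, Rmax in Hx; destruct Rle_dec; lra.
  - apply (ex_RInt_continuous (V := R_CompleteNormedModule)). intros z _; apply Cf.
Qed.

Lemma Icl_0 : Icl 0. Proof. unfold Icl; lra. Qed.
Lemma Icl_1 : Icl 1. Proof. unfold Icl; lra. Qed.

Lemma RInt_Chasles_R (f : R -> R) (a b c : R) : ex_RInt f a b -> ex_RInt f b c ->
  RInt f a b + RInt f b c = RInt f a c.
Proof. exact (RInt_Chasles (V := R_CompleteNormedModule) f a b c). Qed.

Lemma is_derive_RInt_clamp (g : R -> R) (x : R) : contI g ->
  is_derive (fun y => RInt (fun z => g (clamp z)) 0 y) x (g (clamp x)).
Proof.
  intros Cg.
  apply (is_derive_RInt (V := R_NormedModule) (fun z => g (clamp z))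
    (fun y => RInt (fun z => g (clamp z)) 0 y) 0 x); [|apply Cg].
  exists (mkposreal 1 Rlt_0_1). intros y _.
  apply (RInt_correct (V := R_CompleteNormedModule)).
  apply (ex_RInt_continuous (V := R_CompleteNormedModule)). intros z _; apply Cg.
Qed.

Lemma dI_RInt (g : R -> R) : contI g -> dI (fun y => RInt (fun z => g (clamp z)) 0 y) g.
Proof.
  intros Cg. split; [|split; [exact Cg|]].
  - intros x. apply (continuous_comp clamp (fun y => RInt (fun z => g (clamp z)) 0 y)).
    + apply continuous_clamp.
    + apply (ex_derive_continuous (V := R_NormedModule)).
      eexists. now apply is_derive_RInt_clamp.
  - intros x Hx. rewrite <- (clamp_id x) at 2 by (unfold Icl; lra).
    now apply is_derive_RInt_clamp.
Qed.

Lemma dI_minus (f g f' g' : R -> R) : dI f f' -> dI g g' ->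
  dI (fun x => f x - g x) (fun x => f' x - g' x).
Proof.
  intros [A [B C]] [A' [B' C']]. split; [|split]; [contI_tac..|].
  intros x Hx. apply (is_derive_minus (V := R_NormedModule)); auto.
Qed.

Lemma dI_plus (f g f' g' : R -> R) : dI f f' -> dI g g' ->
  dI (fun x => f x + g x) (fun x => f' x + g' x).
Proof.
  intros [A [B C]] [A' [B' C']]. split; [|split]; [contI_tac..|].
  intros x Hx. apply (is_derive_plus (V := R_NormedModule)); auto.
Qed.

Lemma dI_mult (f g f' g' : R -> R) : dI f f' -> dI g g' ->
  dI (fun x => f x * g x) (fun x => f' x * g x + f x * g' x).
Proof.
  intros [A [B C]] [A' [B' C']]. split; [|split]; [contI_tac..|].
  intros x Hx. exact (is_derive_mult f g x _ _ (C x Hx) (C' x Hx) Rmult_comm).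
Qed.

Lemma dI_const (c : R) : dI (fun _ => c) (fun _ => 0).
Proof.
  split; [|split]; [contI_tac..|]. intros x _. exact (is_derive_const (V := R_NormedModule) c x).
Qed.

Lemma dI_id : dI (fun x => x) (fun _ => 1).
Proof.
  split; [|split]; [contI_tac..|]. intros x _. exact (is_derive_id (K := R_AbsRing) x).
Qed.

Lemma dI_scal (c : R) (f g : R -> R) : dI f g -> dI (fun x => c * f x) (fun x => c * g x).
Proof.
  intros [A [B C]]. split; [|split]; [contI_tac..|].
  intros x Hx. apply (is_derive_scal f x c); auto.
Qed.

Lemma dI_ext (f f' g g' : R -> R) : (forall x, f x = f' x) -> (forall x, g x = g' x) ->
  dI f g -> dI f' g'.
Proof.
  intros Ef Eg [A [B C]]. split; [|split].
  - apply (contI_ext f); auto.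
  - apply (contI_ext g); auto.
  - intros x Hx. rewrite <- Eg. apply (is_derive_ext f); auto.
Qed.

Arguments dI_minus {f g f' g'}.
Arguments dI_plus {f g f' g'}.
Arguments dI_mult {f g f' g'}.
Arguments dI_scal c {f g}.
Arguments dI_ext {f f' g g'}.

Lemma dI_zero_const (f : R -> R) (a b : R) : dI f (fun _ => 0) -> Icl a -> Icl b -> f a = f b.
Proof.
  intros D Ia Ib. destruct (mean_value_dI f _ a b D Ia Ib) as [c [_ E]]. lra.
Qed.

(** [f] may fail to be differentiable from both sides at the ends, so it is compared with the
    primitive of the clamped [g]: the difference has zero derivative inside and is continuous, hence
    constant. *)
Lemma FTC_dI (f g : R -> R) (a b : R) : dI f g -> Icl a -> Icl b -> RInt g a b = f b - f a.
Proof.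
  intros D Ia Ib. pose proof D as [Cf [Cg _]].
  assert (E : RInt g a b = RInt (fun z => g (clamp z)) a b).
  { apply RInt_ext. intros x Hx. rewrite clamp_id; [reflexivity|].
    unfold Icl in *; unfold Rmin, Rmax in Hx; destruct Rle_dec; lra. }
  assert (Ex : forall u v, ex_RInt (fun z => g (clamp z)) u v).
  { intros u v. apply (ex_RInt_continuous (V := R_CompleteNormedModule)). intros z _; apply Cg. }
  set (G := fun y => RInt (fun z => g (clamp z)) 0 y).
  assert (HG : RInt (fun z => g (clamp z)) a b = G b - G a).
  { pose proof (RInt_Chasles_R (fun z => g (clamp z)) 0 a b (Ex _ _) (Ex _ _)) as K.
    unfold G; lra. }
  pose proof (dI_minus D (dI_RInt g Cg)) as DD. fold G in DD.
  assert (DD' : dI (fun x => f x - G x) (fun _ => 0)).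
  { destruct DD as [A [B C]]. split; [exact A|split; [apply contI_const|]].
    intros x Hx. specialize (C x Hx). rewrite Rminus_diag in C. exact C. }
  pose proof (dI_zero_const _ a b DD' Ia Ib) as K. simpl in K.
  rewrite E, HG. lra.
Qed.

Lemma Int01_RInt (f : R -> R) : contI f -> Int01 f = RInt f 0 1.
Proof.
  intros Cf. pose proof (ex_RInt_contI f 0 1 Icl_0 Icl_1 Cf) as Ex.
  pose proof (ex_RInt_Reals_0 f 0 1 Ex) as pr.
  assert (H : exists I, exists pr : Riemann_integrable f 0 1, RiemannInt pr = I)
    by (exists (RiemannInt pr), pr; reflexivity).
  destruct (epsilon_spec (inhabits 0) _ H) as [pr' E].
  unfold Int01. rewrite <- E. symmetry. apply RInt_Reals.
Qed.

Lemma RInt_le_contI (f g : R -> R) : contI f -> contI g ->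
  (forall x, Icl x -> f x <= g x) -> RInt f 0 1 <= RInt g 0 1.
Proof.
  intros Cf Cg H. apply RInt_le; [lra| | |].
  - now apply ex_RInt_contI; [apply Icl_0|apply Icl_1|].
  - now apply ex_RInt_contI; [apply Icl_0|apply Icl_1|].
  - intros x Hx; apply H; unfold Icl; lra.
Qed.

Lemma RInt_const_01 (c : R) : RInt (fun _ => c) 0 1 = c.
Proof. rewrite RInt_const. unfold scal; simpl; unfold mult; simpl; ring. Qed.

Lemma RInt_nonneg_contI (f : R -> R) : contI f ->
  (forall x, Icl x -> 0 <= f x) -> 0 <= RInt f 0 1.
Proof.
  intros Cf H. rewrite <- (RInt_const_01 0) at 1. apply RInt_le_contI; [apply contI_const|exact Cf|exact H].
Qed.

Lemma RInt_plus_contI (f g : R -> R) : contI f -> contI g ->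
  RInt (fun x => f x + g x) 0 1 = RInt f 0 1 + RInt g 0 1.
Proof.
  intros Cf Cg. apply (RInt_plus (V := R_CompleteNormedModule));
    apply ex_RInt_contI; auto using Icl_0, Icl_1.
Qed.

Lemma RInt_minus_contI (f g : R -> R) : contI f -> contI g ->
  RInt (fun x => f x - g x) 0 1 = RInt f 0 1 - RInt g 0 1.
Proof.
  intros Cf Cg. apply (RInt_minus (V := R_CompleteNormedModule));
    apply ex_RInt_contI; auto using Icl_0, Icl_1.
Qed.

Lemma RInt_scal_contI (f : R -> R) (c : R) : contI f ->
  RInt (fun x => c * f x) 0 1 = c * RInt f 0 1.
Proof.
  intros Cf. apply (RInt_scal (V := R_CompleteNormedModule)).
  apply ex_RInt_contI; auto using Icl_0, Icl_1.
Qed.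

(** Integrating [(y f^2)'] over the interval bounds [f 1 ^ 2]; integrating [(f^2)'] from [x] to 1,
    with [|2 f g| <= f^2 + g^2], carries the bound to [x]. The constants are 2 + 1 and 1 + 1. *)
Lemma sobolev_sup (f g : R -> R) : dI f g -> forall x, Icl x ->
  f x ^ 2 <= 3 * RInt (fun y => f y ^ 2) 0 1 + 2 * RInt (fun y => g y ^ 2) 0 1.
Proof.
  intros D x Ix. pose proof D as [Cf [Cg Df]].
  assert (D2 : dI (fun y => f y ^ 2) (fun y => 2 * f y * g y)).
  { refine (dI_ext _ _ (dI_mult D D)); intros z; cbv beta; ring. }
  assert (D3 : dI (fun y => y * f y ^ 2) (fun y => f y ^ 2 + y * (2 * f y * g y))).
  { refine (dI_ext _ _ (dI_mult dI_id D2)); intros z; cbv beta; ring. }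
  set (P := RInt (fun y => f y ^ 2 + g y ^ 2) 0 1).
  assert (HP : P = RInt (fun y => f y ^ 2) 0 1 + RInt (fun y => g y ^ 2) 0 1)
    by (apply RInt_plus_contI; contI_tac).
  assert (H1 : f 1 ^ 2 <= 2 * RInt (fun y => f y ^ 2) 0 1 + RInt (fun y => g y ^ 2) 0 1).
  { replace (f 1 ^ 2) with (1 * f 1 ^ 2 - 0 * f 0 ^ 2) by ring.
    rewrite <- (FTC_dI _ _ 0 1 D3 Icl_0 Icl_1).
    assert (E : RInt (fun y => f y ^ 2 + (f y ^ 2 + g y ^ 2)) 0 1
      = RInt (fun y => f y ^ 2) 0 1 + P) by (apply RInt_plus_contI; contI_tac).
    apply Rle_trans with (RInt (fun y => f y ^ 2 + (f y ^ 2 + g y ^ 2)) 0 1); [|lra].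
    apply RInt_le_contI; [contI_tac..|]. intros y [Y0 Y1].
    clear - Y0 Y1.
    assert (0 <= (1 - y) * (f y ^ 2 + g y ^ 2)) by (apply Rmult_le_pos; nra).
    assert (0 <= y * (f y - g y) ^ 2) by (apply Rmult_le_pos; [lra|apply pow2_ge_0]). nra. }
  assert (CP : contI (fun y => f y ^ 2 + g y ^ 2)) by contI_tac.
  assert (CQ : contI (fun y => 2 * f y * g y)) by contI_tac.
  pose proof (ex_RInt_contI _ 0 x Icl_0 Ix CP) as E0.
  pose proof (ex_RInt_contI _ x 1 Ix Icl_1 CP) as E1.
  assert (H2 : - P <= RInt (fun y => 2 * f y * g y) x 1).
  { pose proof (RInt_Chasles_R _ 0 x 1 E0 E1) as K. fold P in K.
    assert (0 <= RInt (fun y => f y ^ 2 + g y ^ 2) 0 x).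
    { apply RInt_ge_0; [apply Ix|exact E0|]. intros y _. clear. nra. }
    apply Rle_trans with (- RInt (fun y => f y ^ 2 + g y ^ 2) x 1); [lra|].
    change (opp (RInt (fun y => f y ^ 2 + g y ^ 2) x 1) <= RInt (fun y => 2 * f y * g y) x 1).
    rewrite <- (RInt_opp (V := R_CompleteNormedModule) _ _ _ E1).
    apply RInt_le; [apply Ix|exact (ex_RInt_opp (V := R_NormedModule) _ _ _ E1)|
      exact (ex_RInt_contI _ x 1 Ix Icl_1 CQ)|].
    intros y _. unfold opp; simpl. clear. pose proof (pow2_ge_0 (f y + g y)). nra. }
  rewrite (FTC_dI _ _ x 1 D2 Ix Icl_1) in H2. lra.
Qed.

(** * The two energy multipliers *)

(** [dotc] and [crsc] are the real and the imaginary part of [a] times the conjugate of [b]. *)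
Definition dotc (a b : cplx) : R := fst a * fst b + snd a * snd b.
Definition crsc (a b : cplx) : R := snd a * fst b - fst a * snd b.

Lemma cnorm2_nonneg (z : cplx) : 0 <= cnorm2 z.
Proof. unfold cnorm2; pose proof (pow2_ge_0 (fst z)); pose proof (pow2_ge_0 (snd z)); lra. Qed.

Lemma dotc_young (a b : cplx) (l : R) : 0 < l ->
  dotc a b <= / l * cnorm2 a + l / 4 * cnorm2 b.
Proof.
  intros Hl. unfold dotc, cnorm2. destruct a as [a1 a2], b as [b1 b2]; simpl.
  assert (E : / l * (a1 * (a1 * 1) + a2 * (a2 * 1)) + l / 4 * (b1 * (b1 * 1) + b2 * (b2 * 1))
    - (a1 * b1 + a2 * b2) = / l * ((a1 - l / 2 * b1) ^ 2 + (a2 - l / 2 * b2) ^ 2)) by (field; lra).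
  assert (0 <= / l * ((a1 - l / 2 * b1) ^ 2 + (a2 - l / 2 * b2) ^ 2)).
  { apply Rmult_le_pos; [left; now apply Rinv_0_lt_compat|].
    pose proof (pow2_ge_0 (a1 - l / 2 * b1)); pose proof (pow2_ge_0 (a2 - l / 2 * b2)); lra. }
  lra.
Qed.

(** Later [al = t(t+1)/sigma] is the ratio by which the Gevrey weights of consecutive levels differ,
    so that dividing [cnorm2 a] by [al ^ 2] gives the higher derivative the weight of its own
    level. *)
Lemma crsc_young (a b : cplx) (c al g : R) : 0 < al -> Rabs (c * al) <= g ->
  c * crsc a b <= / 2 * g * (cnorm2 b + cnorm2 a / al ^ 2).
Proof.
  intros Hl Hg. unfold crsc, cnorm2. destruct a as [a1 a2], b as [b1 b2]; cbn [fst snd].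
  set (u := a2 / al * b1 - a1 / al * b2).
  replace (c * (a2 * b1 - a1 * b2)) with ((c * al) * u) by (unfold u; field; lra).
  replace ((a1 ^ 2 + a2 ^ 2) / al ^ 2) with ((a1 / al) ^ 2 + (a2 / al) ^ 2) by (field; lra).
  set (y1 := a1 / al) in *; set (y2 := a2 / al) in *.
  assert (Hu : Rabs u <= / 2 * (b1 ^ 2 + b2 ^ 2 + (y1 ^ 2 + y2 ^ 2))).
  { pose proof (pow2_ge_0 (b1 - y2)); pose proof (pow2_ge_0 (b1 + y2)).
    pose proof (pow2_ge_0 (b2 - y1)); pose proof (pow2_ge_0 (b2 + y1)).
    unfold u; apply Rabs_le; split; nra. }
  apply Rle_trans with (1 := Rle_abs _). rewrite Rabs_mult.
  replace (/ 2 * g * (b1 ^ 2 + b2 ^ 2 + (y1 ^ 2 + y2 ^ 2)))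
    with (g * (/ 2 * (b1 ^ 2 + b2 ^ 2 + (y1 ^ 2 + y2 ^ 2)))) by ring.
  apply Rmult_le_compat; auto using Rabs_pos.
Qed.

(** The largest value of [|sr * y + k|] for [k] between 0 and [2 * sigma]. Such a number multiplies
    the cross term of two consecutive derivatives, with [k] near 0 at level [N] and near [2 * sigma]
    at high levels. *)
Definition gA (sigma sr y : R) : R := Rmax (sr * y + 2 * sigma) (- sr * y).

Lemma gA_bound (sigma sr y k : R) : 0 <= k <= 2 * sigma -> Rabs (sr * y + k) <= gA sigma sr y.
Proof.
  intros Hk. unfold gA. apply Rabs_le.
  pose proof (Rmax_l (sr * y + 2 * sigma) (- sr * y)).
  pose proof (Rmax_r (sr * y + 2 * sigma) (- sr * y)). split; lra.
Qed.

Lemma gA_shift (sigma sr y h M1 : R) : 0 <= h -> 0 <= y -> Rabs sr <= M1 ->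
  gA sigma sr (y * (1 + h)) <= gA sigma sr y + h * M1 * y.
Proof.
  intros Hh Hy HM. unfold gA.
  assert (Rabs (sr * (h * y)) <= M1 * (h * y)).
  { rewrite Rabs_mult, (Rabs_pos_eq (h * y)) by nra. apply Rmult_le_compat_r; nra. }
  apply Rabs_le_between in H.
  pose proof (Rmax_l (sr * y + 2 * sigma) (- sr * y)).
  pose proof (Rmax_r (sr * y + 2 * sigma) (- sr * y)).
  apply Rmax_lub; lra.
Qed.

(** Here [h = 1/t]. Without the terms in [h] the right-hand side is at least [2 d (1 + xi^2)]; half
    of this pays for those terms, which is why [N] must be large against [(2 sigma + M1) / d]. *)
Lemma coefA_bound (sigma d M1 sr be h xi : R) :
  0 < sigma -> 0 < d <= sigma -> 0 < h <= 1 -> 0 <= xi ->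
  Rabs sr <= M1 -> be <= M1 -> sigma + d <= be ->
  d * (1 + xi ^ 2) <= sigma * xi ^ 2 + sr * xi + be ->
  h * (2 * sigma + M1) <= d ->
  d * (1 + xi ^ 2) <= (2 - h / 2) * be + sigma * xi ^ 2 * (2 - 3 / 2 * h) + sr * xi
     - sigma * h / 2 - / 2 * gA sigma sr (xi * (1 + h)) - / 2 * gA sigma sr xi.
Proof.
  intros Hs Hd Hh Hxi HM Hb Hbs HA HN.
  pose proof (gA_shift sigma sr xi h M1 ltac:(lra) Hxi HM) as Hg.
  (* The two branches of the maximum leave twice [sigma xi^2 + be - sigma] and twice
     [sigma xi^2 + sr xi + be], the two coercive forms. *)
  assert (HG : 2 * be + 2 * sigma * xi ^ 2 + sr * xi - gA sigma sr xi >= 2 * d * (1 + xi ^ 2)).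
  { unfold gA, Rmax. destruct Rle_dec; nra. }
  assert (HM0 : 0 <= M1) by lra.
  assert (He : h * (be / 2 + 3 / 2 * sigma * xi ^ 2 + sigma / 2 + / 2 * M1 * xi) <= d * (1 + xi ^ 2)).
  { apply Rle_trans with (h * ((2 * sigma + M1) * (1 + xi ^ 2))).
    - apply Rmult_le_compat_l; [lra|].
      pose proof (pow2_ge_0 (xi - 1)).
      assert (0 <= M1 * (1 + xi ^ 2 - 2 * xi)) by (apply Rmult_le_pos; nra).
      assert (0 <= sigma * xi ^ 2) by (apply Rmult_le_pos; nra).
      assert (0 <= M1 * xi ^ 2) by (apply Rmult_le_pos; nra). nra.
    - rewrite <- Rmult_assoc. apply Rmult_le_compat_r; nra. }
  lra.
Qed.

(** Here and below [p], [q], [r] stand for [u^(n)], [u^(n+1)], [u^(n+2)], with [t = n + 1],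
    [k = kn N n] and [w] the weight of level [n]. [TA] is what neighbouring levels exchange: the
    halves of the cross and Young terms charged to [q] from below, minus the terms in [k] that
    involve [p]. It enters the estimate only through its increments in [n]. *)
Definition TA (sigma d sr e t w k x : R) (p q : cplx) : R :=
  / 2 * gA sigma sr (t * x / sigma) * (w * cnorm2 q)
  + d / 4 * ((t * x / sigma) ^ 2 * (w * cnorm2 q))
  - w * k * (/ 2 * (t / sigma) * cnorm2 p + (2 - / t) * (e * crsc q p)).

(** The part of the multiplier identity that is an exact derivative: this is [d/dx] of [BA] along
    [p' = q], [q' = r]. *)
Definition BA' (sigma b e t k x : R) (p q r : cplx) : R :=
  / 2 * (t / sigma) * (3 * x ^ 2 * cnorm2 q + 2 * x ^ 3 * dotc q r)
  + / 2 * (t / sigma) * k * (cnorm2 p + 2 * x * dotc p q)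
  + e * b / (2 * t) * (cnorm2 q + 2 * x * dotc q r)
  + k / t * e * (crsc p q + x * crsc p r).

Definition BA (sigma b e t k x : R) (p q : cplx) : R :=
  / 2 * (t / sigma) * x ^ 3 * cnorm2 q + / 2 * (t / sigma) * k * x * cnorm2 p
  + e * b / (2 * t) * x * cnorm2 q + k / t * e * x * crsc p q.

(** This is [2 i e q + xi q + i e (x/t) r] in real coordinates. The coefficients 2 and [x/t] are
    tuned: [x^2 r] against [2 i e q] cancels [2 t x q] against [i e (x/t) r], while [x^2 r] against
    a multiple of [i r] vanishes. Up to exact derivatives, [r] then survives only in a cross term
    with factor [Re s]. *)
Definition multA (sigma e t x : R) (q r : cplx) : cplx :=
  (- 2 * e * snd q + t * x / sigma * fst q - e * (x / t) * snd r,
   2 * e * fst q + t * x / sigma * snd q + e * (x / t) * fst r).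

Definition eqn (s : cplx) (t k x : R) (p q r : cplx) : cplx :=
  (x ^ 2 * fst r + 2 * t * x * fst q + (Re s * fst q - Im s * snd q) + k * fst p,
   x ^ 2 * snd r + 2 * t * x * snd q + (Re s * snd q + Im s * fst q) + k * snd p).

Lemma multA_identity (sigma e t k x : R) (s p q r : cplx) :
  0 < sigma -> 0 < t -> (e = 1 \/ e = -1) ->
  dotc (eqn s t k x p q r) (multA sigma e t x q r) =
  BA' sigma (Im s) e t k x p q r
  + (2 - / (2 * t)) * (e * Im s) * cnorm2 q
  + (t / sigma) * ((2 * t - 3 / 2) * x ^ 2 + Re s * x) * cnorm2 q
  - / 2 * (t / sigma) * k * cnorm2 p
  - Re s * (x / t) * (e * crsc r q)
  - k * (2 - / t) * (e * crsc q p).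
Proof.
  intros Hs Ht He.
  destruct s as [s1 s2], p as [p1 p2], q as [q1 q2], r as [r1 r2].
  unfold dotc, crsc, cnorm2, eqn, multA, BA', Re, Im; cbn [fst snd].
  destruct He as [-> | ->]; unfold dotc, crsc, cnorm2; cbn [fst snd]; field; lra.
Qed.

(** Young's inequality for each summand of the multiplier, whence [6/d = 4/d + 1/d + 1/d]. The term
    in [r] is written with the abscissa and the weight of level [n + 1], ready to be absorbed by
    [TA] there. *)
Lemma multA_young (sigma d e t x : R) (F q r : cplx) :
  0 < sigma -> 0 < d -> 0 < t -> (e = 1 \/ e = -1) ->
  dotc F (multA sigma e t x q r) <=
  6 / d * cnorm2 F + d / 4 * (1 + (t * x / sigma) ^ 2) * cnorm2 q
  + d / 4 * (((t + 1) * x / sigma) ^ 2 * (cnorm2 r / (t * (t + 1) / sigma) ^ 2)).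
Proof.
  intros Hs Hd Ht He.
  set (xi := t * x / sigma).
  pose proof (dotc_young (2 * fst F, 2 * snd F) (- e * snd q, e * fst q) d Hd) as H1.
  pose proof (dotc_young F (xi * fst q, xi * snd q) d Hd) as H2.
  pose proof (dotc_young F (- e * (x / t) * snd r, e * (x / t) * fst r) d Hd) as H3.
  assert (E1 : cnorm2 (- e * snd q, e * fst q) = cnorm2 q)
    by (unfold cnorm2; cbn [fst snd]; destruct He as [-> | ->]; ring).
  assert (E2 : cnorm2 (xi * fst q, xi * snd q) = xi ^ 2 * cnorm2 q)
    by (unfold cnorm2; cbn [fst snd]; ring).
  assert (E3 : cnorm2 (- e * (x / t) * snd r, e * (x / t) * fst r) =
    ((t + 1) * x / sigma) ^ 2 * (cnorm2 r / (t * (t + 1) / sigma) ^ 2))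
    by (unfold cnorm2; cbn [fst snd]; destruct He as [-> | ->]; field; lra).
  assert (E4 : cnorm2 (2 * fst F, 2 * snd F) = 4 * cnorm2 F)
    by (unfold cnorm2; cbn [fst snd]; ring).
  assert (E5 : dotc F (multA sigma e t x q r) =
    dotc (2 * fst F, 2 * snd F) (- e * snd q, e * fst q) + dotc F (xi * fst q, xi * snd q)
    + dotc F (- e * (x / t) * snd r, e * (x / t) * fst r))
    by (unfold dotc, multA, xi; cbn [fst snd]; ring).
  rewrite E1, E4 in H1. rewrite E2 in H2. rewrite E3 in H3. rewrite E5.
  unfold Rdiv at 1. lra.
Qed.

(** The term [k crsc q p] of the multiplier identity pairs the same two derivatives as the [Re s]
    cross term one level below, so it is handed down through [TA]. After this regrouping, Young's
    inequality splits the joint cross term evenly between the two levels, and [coefA_bound] leaves a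
    positive remainder. *)
Lemma energyA (sigma d M1 t k k1 x w e : R) (s p q r F : cplx) :
  0 < sigma -> 0 < d <= sigma -> 1 <= t -> 0 <= k -> 0 <= k1 <= t * (t + 1) -> 0 <= x -> 0 <= w ->
  (e = 1 \/ e = -1) -> sigma + d <= e * Im s ->
  (forall xi, 0 <= xi -> d * (1 + xi ^ 2) <= sigma * xi ^ 2 + Re s * xi + e * Im s) ->
  Rabs (Re s) <= M1 -> e * Im s <= M1 -> 2 * sigma + M1 <= d * t ->
  F = eqn s t k x p q r ->
  w * BA' sigma (Im s) e t k x p q r + d / 2 * (1 + (t * x / sigma) ^ 2) * (w * cnorm2 q)
  <= 6 / d * (w * cnorm2 F)
     + (TA sigma d (Re s) e (t + 1) (w * (sigma / (t * (t + 1))) ^ 2) k1 x q r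
        - TA sigma d (Re s) e t w k x p q).
Proof.
  intros Hs Hd Ht Hk Hk1 Hx Hw He Hb HA HM1 HM2 HN HF.
  set (xi := t * x / sigma). set (h := / t).
  pose proof (Rinv_01 t Ht) as Hh. fold h in Hh.
  assert (Hth : t * h = 1) by (unfold h; field; lra).
  assert (Hxi : 0 <= xi).
  { unfold xi. apply Rmult_le_pos; [nra|left; apply Rinv_0_lt_compat; lra]. }
  set (al := t * (t + 1) / sigma).
  assert (Hal : 0 < al) by (unfold al; apply Rdiv_lt_0_compat; nra).
  assert (Exi' : (t + 1) * x / sigma = xi * (1 + h)) by (unfold xi, h; field; lra).
  pose proof (coefA_bound sigma d M1 (Re s) (e * Im s) h xi Hs Hd Hh Hxi HM1 HM2 Hb (HA xi Hxi)) as HC.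
  assert (HhN : h * (2 * sigma + M1) <= d).
  { apply Rle_trans with (h * (d * t)); [apply Rmult_le_compat_l; lra|].
    rewrite <- Rmult_assoc, (Rmult_comm h d), Rmult_assoc, (Rmult_comm h t), Hth; lra. }
  specialize (HC HhN).
  pose proof (multA_identity sigma e t k x s p q r Hs ltac:(lra) He) as HI. rewrite <- HF in HI.
  pose proof (multA_young sigma d e t x F q r Hs ltac:(lra) ltac:(lra) He) as HY.
  fold xi al in HY. rewrite Exi' in HY.
  set (ka := k1 / (t * (t + 1))).
  assert (Hka : 0 <= ka <= 1).
  { assert (0 < t * (t + 1)) by nra. unfold ka; split.
    - apply Rdiv_le_0_compat; lra.
    - apply div_le_1; lra. }
  set (th := / (t + 1)).
  pose proof (Rinv_01 (t + 1) ltac:(lra)) as Hth1. fold th in Hth1.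
  (* The [Re s] cross term of this level joined with the term in [k1] from the next one. Multiplied
     by [al] it is [Re s] times the next abscissa plus a number in [[0, 2 sigma]], hence bounded by
     [gA]. *)
  set (c := Re s * (x / t) + ka * sigma / al * (2 - th)).
  assert (Hc : Rabs (e * c * al) <= gA sigma (Re s) (xi * (1 + h))).
  { replace (e * c * al) with (e * (Re s * (xi * (1 + h)) + ka * sigma * (2 - th)))
      by (unfold c, al, xi, h; field; lra).
    rewrite Rabs_mult. replace (Rabs e) with 1
      by (destruct He as [-> | ->]; unfold Rabs; destruct Rcase_abs; lra).
    rewrite Rmult_1_l. apply gA_bound. split.
    - apply Rmult_le_pos; nra.
    - assert (ka * sigma <= sigma) by nra. nra. }
  pose proof (crsc_young r q (e * c) al _ Hal Hc) as HJ.
  set (g1 := gA sigma (Re s) (xi * (1 + h))) in *. set (g0 := gA sigma (Re s) xi) in *.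
  set (Q := cnorm2 q) in *. set (Rr := cnorm2 r) in *. set (P := cnorm2 p) in *.
  pose proof (cnorm2_nonneg q) as HQ. fold Q in HQ.
  assert (HA1 : / al ^ 2 * k1 * (/ 2 * ((t + 1) / sigma) * Q) <= sigma * h / 2 * Q).
  { replace (/ al ^ 2 * k1 * (/ 2 * ((t + 1) / sigma) * Q)) with (ka * (sigma * h / 2 * Q))
      by (unfold al, ka, h; field; nra).
    rewrite <- (Rmult_1_l (sigma * h / 2 * Q)) at 2. apply Rmult_le_compat_r; [|lra].
    apply Rmult_le_pos; [nra|exact HQ]. }
  assert (Main : BA' sigma (Im s) e t k x p q r + d / 2 * (1 + xi ^ 2) * Q
    <= 6 / d * cnorm2 F
     + ((/ 2 * g1 * (/ al ^ 2 * Rr) + d / 4 * ((xi * (1 + h)) ^ 2 * (/ al ^ 2 * Rr))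
        - / al ^ 2 * k1 * (/ 2 * ((t + 1) / sigma) * Q + (2 - th) * (e * crsc r q)))
      - (/ 2 * g0 * Q + d / 4 * (xi ^ 2 * Q)
        - k * (/ 2 * (t / sigma) * P + (2 - / t) * (e * crsc q p))))).
  { assert (Ec : e * c * crsc r q = Re s * (x / t) * (e * crsc r q)
        + / al ^ 2 * k1 * ((2 - th) * (e * crsc r q))).
    { unfold c, al, ka. field. lra. }
    assert (E2 : t / sigma * ((2 * t - 3 / 2) * x ^ 2 + Re s * x)
       = sigma * xi ^ 2 * (2 - 3 / 2 * h) + Re s * xi) by (unfold xi, h; field; lra).
    rewrite E2 in HI.
    apply Rmult_le_compat_r with (r := Q) in HC; [|exact HQ].
    replace (/ (2 * t)) with (h / 2) in HI by (unfold h; field; lra).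
    replace (Rr / al ^ 2) with (/ al ^ 2 * Rr) in * by (unfold Rdiv; ring).
    rewrite Rmult_plus_distr_l. rewrite Ec in HJ.
    assert (0 <= d / 4 * Q) by nra.
    lra. }
  apply Rmult_le_compat_l with (r := w) in Main; [|exact Hw].
  unfold TA. fold xi. rewrite Exi'. fold g1 g0 th. fold Q Rr P.
  replace (w * (sigma / (t * (t + 1))) ^ 2) with (w * / al ^ 2) by (unfold al; field; lra).
  lra.
Qed.

Definition TB (sigma t w k : R) (p : cplx) : R := - (w * k * (/ 2 * (t / sigma) * cnorm2 p)).

Definition BB' (sigma t k x : R) (p q r : cplx) : R :=
  x * cnorm2 q + x ^ 2 * dotc q r + k * dotc p q
  + / 2 * (t / sigma) * (3 * x ^ 2 * cnorm2 q + 2 * x ^ 3 * dotc q r)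
  + / 2 * (t / sigma) * k * (cnorm2 p + 2 * x * dotc p q).

Definition BB (sigma t k x : R) (p q : cplx) : R :=
  / 2 * x ^ 2 * cnorm2 q + / 2 * k * cnorm2 p
  + / 2 * (t / sigma) * x ^ 3 * cnorm2 q + / 2 * (t / sigma) * k * x * cnorm2 p.

(** The multiplier is [(1 + xi) q]. With [Re s >= d] the coefficient of [cnorm2 q] is coercive by
    itself, and no cross terms between levels have to be balanced. *)
Lemma energyB (sigma d t k k1 x w : R) (s p q r F : cplx) :
  0 < sigma -> 0 < d <= sigma -> 1 <= t -> 0 <= k -> 0 <= k1 <= t * (t + 1) -> 0 <= x -> 0 <= w ->
  d <= Re s -> 2 * sigma <= d * t ->
  F = eqn s t k x p q r ->
  w * BB' sigma t k x p q r + d / 2 * (1 + (t * x / sigma) ^ 2) * (w * cnorm2 q)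
  <= 6 / d * (w * cnorm2 F)
     + (TB sigma (t + 1) (w * (sigma / (t * (t + 1))) ^ 2) k1 q - TB sigma t w k p).
Proof.
  intros Hs Hd Ht Hk Hk1 Hx Hw Hsr HN HF.
  set (xi := t * x / sigma). set (h := / t).
  assert (Hh : 0 < h) by (unfold h; apply Rinv_0_lt_compat; lra).
  assert (Hth : t * h = 1) by (unfold h; field; lra).
  assert (Hsh : 2 * (sigma * h) <= d).
  { replace d with (d * t * h) by (rewrite Rmult_assoc, Hth; ring).
    replace (2 * (sigma * h)) with (2 * sigma * h) by ring.
    apply Rmult_le_compat_r; lra. }
  assert (Hxi : 0 <= xi).
  { unfold xi. apply Rmult_le_pos; [nra|left; apply Rinv_0_lt_compat; lra]. }
  assert (HI : dotc F ((1 + xi) * fst q, (1 + xi) * snd q) = BB' sigma t k x p q r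
    + ((2 * t - 1) * x + Re s) * cnorm2 q + (sigma * xi ^ 2 * (2 - 3 / 2 * h) + Re s * xi) * cnorm2 q
    - / 2 * (t / sigma) * k * cnorm2 p).
  { rewrite HF. unfold xi, h, dotc, eqn, BB', cnorm2, dotc; cbn [fst snd]. field; lra. }
  pose proof (dotc_young F q d ltac:(lra)) as H1.
  pose proof (dotc_young F (xi * fst q, xi * snd q) d ltac:(lra)) as H2.
  assert (E2 : cnorm2 (xi * fst q, xi * snd q) = xi ^ 2 * cnorm2 q)
    by (unfold cnorm2; cbn [fst snd]; ring).
  assert (E5 : dotc F ((1 + xi) * fst q, (1 + xi) * snd q) =
    dotc F q + dotc F (xi * fst q, xi * snd q)) by (unfold dotc; cbn [fst snd]; ring).
  rewrite E2 in H2. rewrite E5 in HI.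
  set (Q := cnorm2 q) in *. pose proof (cnorm2_nonneg q) as HQ. fold Q in HQ.
  set (ka := k1 / (t * (t + 1))).
  assert (Hka : 0 <= ka <= 1).
  { assert (0 < t * (t + 1)) by nra. unfold ka; split.
    - apply Rdiv_le_0_compat; lra.
    - apply div_le_1; lra. }
  assert (HA1 : (sigma / (t * (t + 1))) ^ 2 * k1 * (/ 2 * ((t + 1) / sigma) * Q) <= sigma * h / 2 * Q).
  { replace ((sigma / (t * (t + 1))) ^ 2 * k1 * (/ 2 * ((t + 1) / sigma) * Q))
      with (ka * (sigma * h / 2 * Q)) by (unfold ka, h; field; nra).
    rewrite <- (Rmult_1_l (sigma * h / 2 * Q)) at 2. apply Rmult_le_compat_r; [|lra].
    apply Rmult_le_pos; [nra|exact HQ]. }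
  (* Of these three quarters, Young's inequality for the pairing with [F] spends one, leaving
     [d / 2]. *)
  assert (HC : (3 / 4 * d) * (1 + xi ^ 2) <=
    ((2 * t - 1) * x + Re s) + (sigma * xi ^ 2 * (2 - 3 / 2 * h) + Re s * xi) - sigma * h / 2).
  { assert (0 <= (2 * t - 1) * x) by (apply Rmult_le_pos; lra).
    assert (0 <= Re s * xi) by (apply Rmult_le_pos; lra).
    assert (d * xi ^ 2 <= sigma * xi ^ 2) by (apply Rmult_le_compat_r; [apply pow2_ge_0|lra]).
    assert (2 * (sigma * h) * xi ^ 2 <= d * xi ^ 2) by (apply Rmult_le_compat_r; [apply pow2_ge_0|lra]).
    assert (0 <= d * xi ^ 2) by (apply Rmult_le_pos; [lra|apply pow2_ge_0]).
    lra. }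
  apply Rmult_le_compat_r with (r := Q) in HC; [|exact HQ].
  pose proof (cnorm2_nonneg F) as HFn.
  assert (0 <= / d * cnorm2 F) by (apply Rmult_le_pos; [left; apply Rinv_0_lt_compat; lra|exact HFn]).
  assert (Main : BB' sigma t k x p q r + d / 2 * (1 + xi ^ 2) * Q <= 6 / d * cnorm2 F
     + (- ((sigma / (t * (t + 1))) ^ 2 * k1 * (/ 2 * ((t + 1) / sigma) * Q))
        + k * (/ 2 * (t / sigma) * cnorm2 p))).
  { unfold Rdiv at 3. lra. }
  apply Rmult_le_compat_l with (r := w) in Main; [|exact Hw].
  unfold TB. fold Q. lra.
Qed.

(** * Towers and the Gevrey norms *)

Lemma Series_spec (a : nat -> R) : converges a -> infinite_sum a (Defs.Series a).
Proof. intros H. exact (epsilon_spec (inhabits 0) _ H). Qed.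

Lemma Series_unique (a : nat -> R) (l : R) : infinite_sum a l -> Defs.Series a = l.
Proof.
  intros H. apply (uniqueness_sum a); [|exact H]. apply Series_spec. now exists l.
Qed.

Lemma sum_growing (a : nat -> R) : (forall n, 0 <= a n) -> Un_growing (sum_f_R0 a).
Proof. intros H n. simpl. specialize (H (S n)). lra. Qed.

Lemma sum_le_Series (a : nat -> R) (M : nat) :
  (forall n, 0 <= a n) -> converges a -> sum_f_R0 a M <= Defs.Series a.
Proof.
  intros H Hc. apply (growing_ineq (sum_f_R0 a)); [now apply sum_growing|now apply Series_spec].
Qed.

Lemma sum_nonneg (a : nat -> R) (M : nat) : (forall n, 0 <= a n) -> 0 <= sum_f_R0 a M.
Proof.
  intros H; induction M as [|M IH]; simpl; [apply H|specialize (H (S M)); lra].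
Qed.

Lemma term_le_sum (a : nat -> R) (n M : nat) :
  (forall n, 0 <= a n) -> (n <= M)%nat -> a n <= sum_f_R0 a M.
Proof.
  intros H Hn. induction Hn as [|M Hn IH].
  - destruct n; simpl; [lra|]. pose proof (sum_nonneg a n H). lra.
  - simpl. specialize (H (S M)). lra.
Qed.

Lemma term_le_Series (a : nat -> R) (n : nat) :
  (forall n, 0 <= a n) -> converges a -> a n <= Defs.Series a.
Proof.
  intros H Hc. apply Rle_trans with (sum_f_R0 a n); [now apply term_le_sum|now apply sum_le_Series].
Qed.

Lemma Series_nonneg (a : nat -> R) : (forall n, 0 <= a n) -> converges a -> 0 <= Defs.Series a.
Proof. intros H Hc. apply Rle_trans with (a 0%nat); [apply H|now apply term_le_Series]. Qed.

Lemma converges_bounded (a : nat -> R) (B : R) :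
  (forall n, 0 <= a n) -> (forall M, sum_f_R0 a M <= B) -> converges a /\ Defs.Series a <= B.
Proof.
  intros H HB.
  destruct (growing_cv (sum_f_R0 a)) as [l Hl].
  - now apply sum_growing.
  - exists B. intros y [M ->]. apply HB.
  - split; [now exists l|]. rewrite (Series_unique a l Hl).
    apply (@Rle_cv_lim (sum_f_R0 a) (fun _ => B) l B); [exact HB|exact Hl|].
    intros eps He. exists 0%nat. intros n _. unfold Rdist. rewrite Rminus_diag, Rabs_R0. lra.
Qed.

Lemma Series_le (a b : nat -> R) : (forall n, 0 <= a n <= b n) -> converges b ->
  converges a /\ Defs.Series a <= Defs.Series b.
Proof.
  intros H Hb. apply converges_bounded; [intros n; apply H|].
  intros M. apply Rle_trans with (sum_f_R0 b M).
  - apply sum_Rle. intros n _; apply H.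
  - apply sum_le_Series; [intros n; specialize (H n); lra|exact Hb].
Qed.

Lemma converges_plus (a b : nat -> R) : converges a -> converges b ->
  converges (fun n => a n + b n) /\
  Defs.Series (fun n => a n + b n) = Defs.Series a + Defs.Series b.
Proof.
  intros Ha Hb. apply Series_spec in Ha, Hb.
  assert (H : infinite_sum (fun n => a n + b n) (Defs.Series a + Defs.Series b)).
  { intros eps He. destruct (CV_plus _ _ _ _ Ha Hb eps He) as [N HN].
    exists N. intros n Hn. rewrite sum_plus. now apply HN. }
  split; [eexists; exact H|now apply Series_unique].
Qed.

Lemma converges_scal (a : nat -> R) (c : R) : converges a ->
  converges (fun n => c * a n) /\ Defs.Series (fun n => c * a n) = c * Defs.Series a.
Proof.
  intros Ha. apply Series_spec in Ha.
  assert (H : infinite_sum (fun n => c * a n) (c * Defs.Series a)).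
  { intros eps He. pose proof (Rabs_pos c) as Hc.
    destruct (Ha (eps / (Rabs c + 1)) ltac:(apply Rdiv_lt_0_compat; lra)) as [N HN].
    exists N. intros n Hn. specialize (HN n Hn). unfold Rdist in *.
    replace (sum_f_R0 (fun n => c * a n) n) with (c * sum_f_R0 a n)
      by (rewrite scal_sum; apply sum_eq; intros; ring).
    rewrite <- Rmult_minus_distr_l, Rabs_mult.
    apply Rle_lt_trans with (Rabs c * (eps / (Rabs c + 1))); [apply Rmult_le_compat_l; lra|].
    apply Rmult_lt_reg_r with (Rabs c + 1); [lra|].
    replace (Rabs c * (eps / (Rabs c + 1)) * (Rabs c + 1)) with (Rabs c * eps) by (field; lra).
    nra. }
  split; [eexists; exact H|now apply Series_unique].
Qed.

Lemma sum_shift_le_Series (f a : nat -> R) (N L : nat) :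
  (forall n, 0 <= a n) -> converges a -> (forall n, f n <= a n) ->
  sum_f_R0 (fun j => f (N + j)%nat) L <= Defs.Series a.
Proof.
  intros Ha Ca H. apply Rle_trans with (sum_f_R0 a (N + L)); [|now apply sum_le_Series].
  induction L as [|L IH]; simpl.
  - rewrite Nat.add_0_r. apply Rle_trans with (1 := H N). now apply term_le_sum.
  - rewrite <- plus_n_Sm. simpl. specialize (H (S (N + L))). lra.
Qed.

Lemma term_cv_0 (a : nat -> R) : converges a -> Un_cv a 0.
Proof.
  intros [l Hl] eps He.
  destruct (Hl (eps / 2) ltac:(lra)) as [N HN].
  exists (S N). intros n Hn. destruct n as [|n]; [lia|].
  pose proof (HN (S n) ltac:(lia)) as H1. pose proof (HN n ltac:(lia)) as H2.
  unfold Rdist in *. simpl in H1.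
  replace (a (S n) - 0) with ((sum_f_R0 a n + a (S n) - l) - (sum_f_R0 a n - l)) by ring.
  apply Rle_lt_trans with (1 := Rabs_triang _ _). rewrite Rabs_Ropp. lra.
Qed.

Lemma tower_dI (U : tower) (n : nat) : is_tower U ->
  dI (fun x => fst (U n x)) (fun x => fst (U (S n) x)) /\
  dI (fun x => snd (U n x)) (fun x => snd (U (S n) x)).
Proof.
  intros H. destruct (H n) as [A B], (H (S n)) as [A' B'].
  split; eapply deriv_on_I_dI; eassumption.
Qed.

Lemma tower_cont_fst (U : tower) (n : nat) : is_tower U -> contI (fun x => fst (U n x)).
Proof. intros H. apply (tower_dI U n H). Qed.

Lemma tower_cont_snd (U : tower) (n : nat) : is_tower U -> contI (fun x => snd (U n x)).
Proof. intros H. apply (tower_dI U n H). Qed.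

Lemma tower_cont_cnorm2 (U : tower) (n : nat) : is_tower U -> contI (fun x => cnorm2 (U n x)).
Proof.
  intros H. unfold cnorm2. pose proof (tower_cont_fst U n H); pose proof (tower_cont_snd U n H).
  contI_tac.
Qed.

Lemma tshift_tower (U : tower) : is_tower U -> is_tower (tshift U).
Proof. intros H n. apply (H (S n)). Qed.

Lemma tsub_tower (U V : tower) : is_tower U -> is_tower V -> is_tower (tsub U V).
Proof.
  intros HU HV n. destruct (tower_dI U n HU) as [A B], (tower_dI V n HV) as [A' B'].
  split; apply dI_deriv_on_I.
  - exact (dI_minus A A').
  - exact (dI_minus B B').
Qed.

Lemma tcmul_tower (c : cplx) (U : tower) : is_tower U -> is_tower (tcmul c U).
Proof.
  intros HU n. destruct (tower_dI U n HU) as [A B].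
  split; apply dI_deriv_on_I.
  - exact (dI_minus (dI_scal (fst c) A) (dI_scal (snd c) B)).
  - exact (dI_plus (dI_scal (fst c) B) (dI_scal (snd c) A)).
Qed.

Lemma wcoef_pos (sigma : R) (n : nat) : 0 < sigma -> 0 < wcoef sigma n.
Proof.
  intros Hs. unfold wcoef. pose proof (INR_fact_lt_0 n); pose proof (INR_fact_lt_0 (n + 1)).
  apply Rdiv_lt_0_compat; [now apply pow_lt|].
  apply Rmult_lt_0_compat; now apply pow_lt.
Qed.

Lemma wcoef_S (sigma : R) (n : nat) :
  wcoef sigma (S n) = wcoef sigma n * (sigma / (INR (S n) * (INR (S n) + 1))) ^ 2.
Proof.
  unfold wcoef.
  replace (2 * S n)%nat with (2 + 2 * n)%nat by lia.
  replace (S n + 1)%nat with (S (n + 1)) by lia. rewrite pow_add, !fact_simpl, !mult_INR.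
  replace (S (n + 1)) with (S (S n)) by lia. rewrite (S_INR (S n)).
  pose proof (INR_fact_lt_0 n); pose proof (INR_fact_lt_0 (n + 1)).
  pose proof (lt_0_INR (S n) ltac:(lia)).
  replace (n + 1)%nat with (S n) in * by lia.
  field. lra.
Qed.

(** One series in place of the four in [normX]: the factor [n^k (x/sigma)^k] is the [k]-th power of
    [n x / sigma]. [YT] does the same for [normY], with powers 0 and 1 only. *)
Definition XT (sigma : R) (U : tower) (n : nat) : R :=
  wcoef sigma n * RInt (fun x => (1 + INR n * x / sigma + (INR n * x / sigma) ^ 2)
                                 * cnorm2 (U (S n) x)) 0 1
  + sigma * wcoef sigma n * cnorm2 (U (S n) 0).

Definition YT (sigma : R) (U : tower) (n : nat) : R :=
  wcoef sigma n * RInt (fun x => (1 + INR n * x / sigma) * cnorm2 (U n x)) 0 1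
  + sigma * wcoef sigma n * cnorm2 (U n 0).

Notation XS sigma U := (Defs.Series (XT sigma U)).
Notation YS sigma F := (Defs.Series (YT sigma F)).

Section Norms.
Variable sigma : R.
Hypothesis Hs : 0 < sigma.

Lemma wterm_RInt (k : nat) (U : tower) (n : nat) : is_tower U ->
  wterm sigma k 0 U n
  = wcoef sigma n * RInt (fun x => (INR n * x / sigma) ^ k * cnorm2 (U n x)) 0 1.
Proof.
  intros HU. pose proof (tower_cont_cnorm2 U n HU) as HC.
  unfold wterm. rewrite Int01_RInt by contI_tac.
  rewrite Nat.add_0_r, Rmult_assoc, <- RInt_scal_contI by contI_tac.
  f_equal. apply RInt_ext. intros x _.
  replace (INR n * x / sigma) with (INR n * (x / sigma)) by (field; lra).
  rewrite Rpow_mult_distr. cbv beta; simpl. ring.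
Qed.

Lemma bterm_eq (U : tower) (n : nat) :
  bterm sigma U n = sigma * wcoef sigma n * cnorm2 (U n 0).
Proof.
  unfold bterm, wcoef. replace (2 * n + 1)%nat with (S (2 * n)) by lia.
  rewrite <- tech_pow_Rmult. unfold Rdiv. ring.
Qed.

Lemma xi_nonneg (n : nat) (x : R) : Icl x -> 0 <= INR n * x / sigma.
Proof.
  intros [H _]. apply Rmult_le_pos; [apply Rmult_le_pos; [apply pos_INR|exact H]|].
  left; now apply Rinv_0_lt_compat.
Qed.

Lemma wterm_nonneg (k : nat) (U : tower) (n : nat) : is_tower U -> 0 <= wterm sigma k 0 U n.
Proof.
  intros HU. pose proof (tower_cont_cnorm2 U n HU) as HC. rewrite wterm_RInt by exact HU.
  apply Rmult_le_pos; [left; now apply wcoef_pos|].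
  apply RInt_nonneg_contI; [contI_tac|]. intros x Ix.
  apply Rmult_le_pos; [apply pow_le, xi_nonneg, Ix|apply cnorm2_nonneg].
Qed.

Lemma bterm_nonneg (U : tower) (n : nat) : 0 <= bterm sigma U n.
Proof.
  rewrite bterm_eq. apply Rmult_le_pos; [|apply cnorm2_nonneg].
  left. apply Rmult_lt_0_compat; [exact Hs|now apply wcoef_pos].
Qed.

Lemma XT_split (U : tower) (n : nat) : is_tower U ->
  XT sigma U n = wterm sigma 0 0 (tshift U) n + wterm sigma 1 0 (tshift U) n
    + wterm sigma 2 0 (tshift U) n + bterm sigma (tshift U) n.
Proof.
  intros HU. pose proof (tower_cont_cnorm2 U (S n) HU) as HC.
  rewrite !wterm_RInt, bterm_eq by now apply tshift_tower.
  unfold XT, tshift. rewrite <- !Rmult_plus_distr_l, <- !RInt_plus_contI by contI_tac.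
  do 2 f_equal. apply RInt_ext. intros x _. simpl. ring.
Qed.

Lemma YT_split (U : tower) (n : nat) : is_tower U ->
  YT sigma U n = wterm sigma 0 0 U n + wterm sigma 1 0 U n + bterm sigma U n.
Proof.
  intros HU. pose proof (tower_cont_cnorm2 U n HU) as HC.
  rewrite !wterm_RInt, bterm_eq by exact HU.
  unfold YT. rewrite <- !Rmult_plus_distr_l, <- !RInt_plus_contI by contI_tac.
  do 2 f_equal. apply RInt_ext. intros x _. simpl. ring.
Qed.

Lemma XT_nonneg (U : tower) (n : nat) : is_tower U -> 0 <= XT sigma U n.
Proof.
  intros HU. rewrite XT_split by exact HU. pose proof (tshift_tower U HU) as HV.
  pose proof (wterm_nonneg 0 _ n HV); pose proof (wterm_nonneg 1 _ n HV).
  pose proof (wterm_nonneg 2 _ n HV); pose proof (bterm_nonneg (tshift U) n). lra.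
Qed.

Lemma YT_nonneg (U : tower) (n : nat) : is_tower U -> 0 <= YT sigma U n.
Proof.
  intros HV. rewrite YT_split by exact HV.
  pose proof (wterm_nonneg 0 _ n HV); pose proof (wterm_nonneg 1 _ n HV).
  pose proof (bterm_nonneg U n). lra.
Qed.

Lemma converges_ext (a b : nat -> R) : (forall n, a n = b n) -> converges a -> converges b.
Proof.
  intros E [l Hl]. exists l. intros eps He. destruct (Hl eps He) as [N HN].
  exists N. intros n Hn. rewrite <- (sum_eq a b) by (intros; apply E). now apply HN.
Qed.

Lemma Series_ext (a b : nat -> R) : (forall n, a n = b n) -> converges a ->
  Defs.Series a = Defs.Series b.
Proof.
  intros E Ha. symmetry. apply Series_unique. pose proof (Series_spec a Ha) as Hl.
  intros eps He. destruct (Hl eps He) as [N HN].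
  exists N. intros n Hn. rewrite <- (sum_eq a b) by (intros; apply E). now apply HN.
Qed.

Lemma inX_iff (U : tower) :
  inX sigma U <-> is_tower U /\ U 0%nat 1 = c0 /\ converges (XT sigma U).
Proof.
  split.
  - intros [HU [H1 [A [B [C D]]]]]. split; [exact HU|split; [exact H1|]].
    apply (converges_ext (fun n => wterm sigma 0 0 (tshift U) n + wterm sigma 1 0 (tshift U) n
      + wterm sigma 2 0 (tshift U) n + bterm sigma (tshift U) n)).
    { intros n; symmetry; now apply XT_split. }
    apply converges_plus; [apply converges_plus; [apply converges_plus|]|]; assumption.
  - intros [HU [H1 HX]]. pose proof (tshift_tower U HU) as HV.
    split; [exact HU|split; [exact H1|]].
    assert (K : forall n, 0 <= wterm sigma 0 0 (tshift U) n /\ 0 <= wterm sigma 1 0 (tshift U) n /\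
      0 <= wterm sigma 2 0 (tshift U) n /\ 0 <= bterm sigma (tshift U) n).
    { intros n. pose proof (bterm_nonneg (tshift U) n). auto using wterm_nonneg. }
    repeat split; refine (proj1 (Series_le _ (XT sigma U) _ HX)); intros n;
      rewrite XT_split by exact HU; specialize (K n); lra.
Qed.

Lemma normX_eq (U : tower) : inX sigma U -> normX sigma U = sqrt (XS sigma U).
Proof.
  intros HX. pose proof (proj1 (inX_iff U) HX) as [_ [_ HC]].
  destruct HX as [HU [H1 [A [B [C D]]]]]. unfold normX. f_equal.
  rewrite (Series_ext (XT sigma U) _ (fun n => XT_split U n HU) HC).
  destruct (converges_plus _ _ A B) as [AB E1]. destruct (converges_plus _ _ AB C) as [ABC E2].
  destruct (converges_plus _ _ ABC D) as [_ E3]. cbv beta in *.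
  rewrite E3, E2, E1. reflexivity.
Qed.

Lemma inY_iff (U : tower) : inY sigma U <-> is_tower U /\ converges (YT sigma U).
Proof.
  split.
  - intros [HU [A [B D]]]. split; [exact HU|].
    apply (converges_ext (fun n => wterm sigma 0 0 U n + wterm sigma 1 0 U n + bterm sigma U n)).
    { intros n; symmetry; now apply YT_split. }
    apply converges_plus; [apply converges_plus|]; assumption.
  - intros [HU HX]. split; [exact HU|].
    assert (K : forall n, 0 <= wterm sigma 0 0 U n /\ 0 <= wterm sigma 1 0 U n /\
      0 <= bterm sigma U n).
    { intros n. pose proof (bterm_nonneg U n). auto using wterm_nonneg. }
    repeat split; refine (proj1 (Series_le _ (YT sigma U) _ HX)); intros n;
      rewrite YT_split by exact HU; specialize (K n); lra.
Qed.

Lemma normY_eq (U : tower) : inY sigma U -> normY sigma U = sqrt (YS sigma U).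
Proof.
  intros HX. pose proof (proj1 (inY_iff U) HX) as [_ HC].
  destruct HX as [HU [A [B D]]]. unfold normY. f_equal.
  rewrite (Series_ext (YT sigma U) _ (fun n => YT_split U n HU) HC).
  destruct (converges_plus _ _ A B) as [AB E1].
  destruct (converges_plus _ _ AB D) as [_ E3]. cbv beta in *.
  rewrite E3, E1. reflexivity.
Qed.

Lemma XT_mono (c : R) (U V W : tower) (n : nat) : is_tower U -> is_tower V -> is_tower W ->
  (forall x, Icl x -> cnorm2 (W (S n) x) <= c * (cnorm2 (U (S n) x) + cnorm2 (V (S n) x))) ->
  XT sigma W n <= c * (XT sigma U n + XT sigma V n).
Proof.
  intros HU HV HW H. pose proof (tower_cont_cnorm2 U (S n) HU) as CU.
  pose proof (tower_cont_cnorm2 V (S n) HV) as CV. pose proof (tower_cont_cnorm2 W (S n) HW) as CW.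
  pose proof (wcoef_pos sigma n Hs) as Hw. unfold XT.
  set (wt := fun x => 1 + INR n * x / sigma + (INR n * x / sigma) ^ 2).
  assert (K : RInt (fun x => wt x * cnorm2 (W (S n) x)) 0 1 <=
    c * (RInt (fun x => wt x * cnorm2 (U (S n) x)) 0 1 + RInt (fun x => wt x * cnorm2 (V (S n) x)) 0 1)).
  { rewrite <- RInt_plus_contI, <- RInt_scal_contI by (unfold wt; contI_tac).
    apply RInt_le_contI; [unfold wt; contI_tac..|]. intros x Ix. specialize (H x Ix).
    assert (0 <= wt x) by (unfold wt; pose proof (xi_nonneg n x Ix); nra).
    replace (c * (wt x * cnorm2 (U (S n) x) + wt x * cnorm2 (V (S n) x)))
      with (wt x * (c * (cnorm2 (U (S n) x) + cnorm2 (V (S n) x)))) by ring.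
    now apply Rmult_le_compat_l. }
  specialize (H 0 Icl_0).
  apply Rmult_le_compat_l with (r := wcoef sigma n) in K; [|lra].
  apply Rmult_le_compat_l with (r := sigma * wcoef sigma n) in H; [|nra].
  unfold wt in K. cbv beta in K. lra.
Qed.

Lemma cnorm2_csub_le (a b : cplx) : cnorm2 (csub a b) <= 2 * (cnorm2 a + cnorm2 b).
Proof.
  unfold cnorm2, csub, cadd, copp; cbn [fst snd].
  pose proof (pow2_ge_0 (fst a + fst b)); pose proof (pow2_ge_0 (snd a + snd b)). nra.
Qed.

Lemma cnorm2_cmul (a b : cplx) : cnorm2 (cmul a b) = cnorm2 a * cnorm2 b.
Proof. unfold cnorm2, cmul; cbn [fst snd]; ring. Qed.

Lemma inX_tsub (U V : tower) : inX sigma U -> inX sigma V -> inX sigma (tsub U V).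
Proof.
  intros HU HV. apply inX_iff in HU, HV. destruct HU as [TU [U1 CU]], HV as [TV [V1 CV]].
  pose proof (tsub_tower U V TU TV) as TW.
  apply inX_iff; split; [exact TW|split].
  - unfold tsub. rewrite U1, V1. unfold csub, cadd, copp, c0; cbn [fst snd]. f_equal; ring.
  - apply (Series_le _ (fun n => 2 * (XT sigma U n + XT sigma V n))).
    + intros n; split; [now apply XT_nonneg|].
      apply XT_mono; auto. intros x _. apply cnorm2_csub_le.
    + apply (converges_scal (fun n => XT sigma U n + XT sigma V n) 2), converges_plus; assumption.
Qed.

Lemma XT_tcmul (c : cplx) (U : tower) (n : nat) : is_tower U ->
  XT sigma (tcmul c U) n = cnorm2 c * XT sigma U n.
Proof.
  intros HU. pose proof (tower_cont_cnorm2 U (S n) HU) as CU. unfold XT, tcmul.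
  rewrite cnorm2_cmul, Rmult_plus_distr_l. f_equal; [|ring].
  set (wt := fun x => 1 + INR n * x / sigma + (INR n * x / sigma) ^ 2).
  assert (E : RInt (fun x => wt x * cnorm2 (cmul c (U (S n) x))) 0 1
    = cnorm2 c * RInt (fun x => wt x * cnorm2 (U (S n) x)) 0 1).
  { rewrite <- RInt_scal_contI by (unfold wt; contI_tac).
    apply RInt_ext. intros x _. rewrite cnorm2_cmul. simpl. ring. }
  unfold wt in E. cbv beta in E. rewrite E. simpl. ring.
Qed.

Lemma inX_tcmul (c : cplx) (U : tower) : inX sigma U -> inX sigma (tcmul c U).
Proof.
  intros HU. apply inX_iff in HU. destruct HU as [TU [U1 CU]].
  apply inX_iff; split; [now apply tcmul_tower|split].
  - unfold tcmul. rewrite U1. unfold cmul, c0; cbn [fst snd]. f_equal; ring.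
  - apply (converges_ext (fun n => cnorm2 c * XT sigma U n)).
    + intros n; symmetry; now apply XT_tcmul.
    + now apply converges_scal.
Qed.

Lemma YT_mono (c1 c2 : R) (U V W : tower) (n : nat) : is_tower U -> is_tower V -> is_tower W ->
  (forall x, Icl x -> cnorm2 (W n x) <= c1 * cnorm2 (U n x) + c2 * cnorm2 (V n x)) ->
  YT sigma W n <= c1 * YT sigma U n + c2 * YT sigma V n.
Proof.
  intros HU HV HW H. pose proof (tower_cont_cnorm2 U n HU) as CU.
  pose proof (tower_cont_cnorm2 V n HV) as CV. pose proof (tower_cont_cnorm2 W n HW) as CW.
  pose proof (wcoef_pos sigma n Hs) as Hw. unfold YT.
  set (wt := fun x => 1 + INR n * x / sigma).
  assert (K : RInt (fun x => wt x * cnorm2 (W n x)) 0 1 <=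
    c1 * RInt (fun x => wt x * cnorm2 (U n x)) 0 1 + c2 * RInt (fun x => wt x * cnorm2 (V n x)) 0 1).
  { rewrite <- !RInt_scal_contI, <- RInt_plus_contI by (unfold wt; contI_tac).
    apply RInt_le_contI; [unfold wt; contI_tac..|]. intros x Ix. specialize (H x Ix).
    assert (0 <= wt x) by (unfold wt; pose proof (xi_nonneg n x Ix); lra).
    replace (c1 * (wt x * cnorm2 (U n x)) + c2 * (wt x * cnorm2 (V n x)))
      with (wt x * (c1 * cnorm2 (U n x) + c2 * cnorm2 (V n x))) by ring.
    now apply Rmult_le_compat_l. }
  specialize (H 0 Icl_0).
  apply Rmult_le_compat_l with (r := wcoef sigma n) in K; [|lra].
  apply Rmult_le_compat_l with (r := sigma * wcoef sigma n) in H; [|nra].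
  unfold wt in K. cbv beta in K. lra.
Qed.

(** The four seminorms of X are taken of [u'] and include the three of Y. This makes a change of the
    spectral parameter a bounded perturbation from X to Y. *)
Lemma inY_tshift (U : tower) : inX sigma U -> inY sigma (tshift U) /\
  YS sigma (tshift U) <= XS sigma U.
Proof.
  intros HU. apply inX_iff in HU. destruct HU as [TU [_ CU]].
  pose proof (tshift_tower U TU) as TV.
  rewrite inY_iff.
  assert (K : forall n, 0 <= YT sigma (tshift U) n <= XT sigma U n).
  { intros n. split; [now apply YT_nonneg|]. rewrite YT_split, XT_split by assumption.
    pose proof (wterm_nonneg 2 _ n TV). lra. }
  destruct (Series_le _ _ K CU) as [A B]. split; [split; assumption|exact B].
Qed.

Lemma inY_tsub_tcmul (c : cplx) (F V : tower) : inY sigma F -> inY sigma V ->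
  inY sigma (tsub F (tcmul c V)) /\
  YS sigma (tsub F (tcmul c V))
    <= 2 * YS sigma F + 2 * cnorm2 c * YS sigma V.
Proof.
  intros HF HV. apply inY_iff in HF, HV. destruct HF as [TF CF], HV as [TV CV].
  pose proof (tsub_tower _ _ TF (tcmul_tower c V TV)) as TW.
  destruct (converges_scal (YT sigma F) 2 CF) as [A1 E1].
  destruct (converges_scal (YT sigma V) (2 * cnorm2 c) CV) as [A2 E2].
  destruct (converges_plus _ _ A1 A2) as [A3 E3].
  assert (K : forall n, 0 <= YT sigma (tsub F (tcmul c V)) n
    <= 2 * YT sigma F n + 2 * cnorm2 c * YT sigma V n).
  { intros n. split; [now apply YT_nonneg|]. apply YT_mono; auto.
    intros x _. apply Rle_trans with (1 := cnorm2_csub_le _ _).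
    unfold tcmul. rewrite cnorm2_cmul. lra. }
  destruct (Series_le _ _ K A3) as [B E].
  split; [apply inY_iff; split; assumption|]. rewrite E3, E1, E2 in E. exact E.
Qed.

Lemma tower_sobolev (U : tower) (n : nat) (x : R) : is_tower U -> Icl x ->
  cnorm2 (U n x) <= 3 * RInt (fun y => cnorm2 (U n y)) 0 1
                  + 2 * RInt (fun y => cnorm2 (U (S n) y)) 0 1.
Proof.
  intros HU Ix. destruct (tower_dI U n HU) as [A B].
  pose proof (sobolev_sup _ _ A x Ix) as K1. pose proof (sobolev_sup _ _ B x Ix) as K2.
  destruct A as [A1 [A2 _]], B as [B1 [B2 _]].
  unfold cnorm2. rewrite !RInt_plus_contI by contI_tac. lra.
Qed.

Lemma RInt_le_XT (U : tower) (n : nat) : is_tower U ->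
  wcoef sigma n * RInt (fun y => cnorm2 (U (S n) y)) 0 1 <= XT sigma U n.
Proof.
  intros HU. pose proof (tshift_tower U HU) as HV.
  rewrite XT_split by exact HU.
  pose proof (wterm_nonneg 1 _ n HV); pose proof (wterm_nonneg 2 _ n HV).
  pose proof (bterm_nonneg (tshift U) n).
  rewrite (wterm_RInt 0) by exact HV. unfold tshift at 1.
  rewrite (RInt_ext (fun x => (INR n * x / sigma) ^ 0 * cnorm2 (U (S n) x)) (fun y => cnorm2 (U (S n) y))).
  - lra.
  - intros x _; simpl; ring.
Qed.

Lemma RInt_le_YT (U : tower) (n : nat) : is_tower U ->
  wcoef sigma n * RInt (fun y => cnorm2 (U n y)) 0 1 <= YT sigma U n.
Proof.
  intros HV. rewrite YT_split by exact HV.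
  pose proof (wterm_nonneg 1 _ n HV). pose proof (bterm_nonneg U n).
  rewrite (wterm_RInt 0) by exact HV.
  rewrite (RInt_ext (fun x => (INR n * x / sigma) ^ 0 * cnorm2 (U n x)) (fun y => cnorm2 (U n y))).
  - lra.
  - intros x _; simpl; ring.
Qed.

Lemma div_le_of_mul (w a b : R) : 0 < w -> w * a <= b -> a <= b / w.
Proof.
  intros Hw H. apply Rmult_le_reg_l with w; [exact Hw|]. unfold Rdiv.
  rewrite <- Rmult_assoc, (Rmult_comm w b), Rmult_assoc, Rinv_r; lra.
Qed.

(** The Sobolev inequality costs one derivative, hence two consecutive terms of the series. *)
Lemma sup_le_XT (U : tower) (n : nat) (B x : R) : is_tower U -> Icl x ->
  XT sigma U n <= B -> XT sigma U (S n) <= B ->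
  cnorm2 (U (S n) x) <= (3 / wcoef sigma n + 2 / wcoef sigma (S n)) * B.
Proof.
  intros HU Ix H1 H2.
  pose proof (tower_sobolev U (S n) x HU Ix).
  pose proof (div_le_of_mul _ _ _ (wcoef_pos sigma n Hs) (Rle_trans _ _ _ (RInt_le_XT U n HU) H1)).
  pose proof (div_le_of_mul _ _ _ (wcoef_pos sigma (S n) Hs) (Rle_trans _ _ _ (RInt_le_XT U (S n) HU) H2)).
  unfold Rdiv in *. lra.
Qed.

Lemma sup_le_normX (U : tower) (n : nat) (x : R) : inX sigma U -> Icl x ->
  cnorm2 (U (S n) x) <= (3 / wcoef sigma n + 2 / wcoef sigma (S n)) * XS sigma U.
Proof.
  intros HX Ix. apply inX_iff in HX as [HU [_ HC]].
  apply sup_le_XT; try assumption; apply term_le_Series; auto using XT_nonneg.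
Qed.

Lemma sup_le_normY (F : tower) (n : nat) (x : R) : inY sigma F -> Icl x ->
  cnorm2 (F n x) <= (3 / wcoef sigma n + 2 / wcoef sigma (S n)) * YS sigma F.
Proof.
  intros HX Ix. apply inY_iff in HX as [HU HC].
  assert (HB : forall n, YT sigma F n <= YS sigma F)
    by (intros m; apply term_le_Series; auto using YT_nonneg).
  pose proof (tower_sobolev F n x HU Ix).
  pose proof (div_le_of_mul _ _ _ (wcoef_pos sigma n Hs) (Rle_trans _ _ _ (RInt_le_YT F n HU) (HB n))).
  pose proof (div_le_of_mul _ _ _ (wcoef_pos sigma (S n) Hs) (Rle_trans _ _ _ (RInt_le_YT F (S n) HU) (HB (S n)))).
  unfold Rdiv in *. lra.
Qed.

End Norms.

(** The mean value theorem is applied to the real and the imaginary part separately, with different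
    intermediate points; each increment has square at most [B], and [(a+b)^2 <= 2a^2 + 2b^2] gives
    [2B + 2B]. *)
Lemma tower_sup_from_1 (U : tower) (n : nat) (B : R) : is_tower U -> 0 <= B ->
  (forall x, Icl x -> cnorm2 (U (S n) x) <= B) ->
  forall x, Icl x -> cnorm2 (U n x) <= 2 * cnorm2 (U n 1) + 4 * B.
Proof.
  intros HU HB H x Ix. destruct (tower_dI U n HU) as [A A'].
  destruct (mean_value_dI _ _ 1 x A Icl_1 Ix) as [c [Hc E]].
  destruct (mean_value_dI _ _ 1 x A' Icl_1 Ix) as [c' [Hc' E']].
  pose proof (Icl_between _ _ _ Icl_1 Ix Hc) as Ic.
  pose proof (Icl_between _ _ _ Icl_1 Ix Hc') as Ic'.
  pose proof (H c Ic) as K. pose proof (H c' Ic') as K'. unfold cnorm2 in *.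
  set (g := fst (U (S n) c)) in *. set (g' := snd (U (S n) c')) in *.
  assert (Hg : (g * (x - 1)) ^ 2 <= B).
  { pose proof (pow2_ge_0 (snd (U (S n) c))). unfold Icl in Ix.
    assert ((x - 1) ^ 2 <= 1) by nra. rewrite Rpow_mult_distr.
    pose proof (pow2_ge_0 g). pose proof (pow2_ge_0 (x - 1)). nra. }
  assert (Hg' : (g' * (x - 1)) ^ 2 <= B).
  { pose proof (pow2_ge_0 (fst (U (S n) c'))). unfold Icl in Ix.
    assert ((x - 1) ^ 2 <= 1) by nra. rewrite Rpow_mult_distr.
    pose proof (pow2_ge_0 g'). pose proof (pow2_ge_0 (x - 1)). nra. }
  replace (fst (U n x)) with (fst (U n 1) + g * (x - 1)) by lra.
  replace (snd (U n x)) with (snd (U n 1) + g' * (x - 1)) by lra.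
  set (y := g * (x - 1)) in *. set (y' := g' * (x - 1)) in *.
  pose proof (pow2_ge_0 (fst (U n 1) - y)); pose proof (pow2_ge_0 (snd (U n 1) - y')). nra.
Qed.

(** * The differentiated equations *)

Definition rtower (u : nat -> R -> R) : Prop := forall n, dI (u n) (u (S n)).

Lemma tower_rtower (U : tower) : is_tower U <->
  rtower (fun n x => fst (U n x)) /\ rtower (fun n x => snd (U n x)).
Proof.
  split.
  - intros H; split; intros n; apply (tower_dI U n H).
  - intros [A B] n; split; apply dI_deriv_on_I; [apply (A n)|apply (B n)].
Qed.

(** The Taylor polynomial at 1 with prescribed derivatives [a]. Differentiation shifts [a] and
    lowers the length, so after [N] differentiations the [lam] term of the equation is gone. *)
Fixpoint pol (m : nat) (a : nat -> R) (x : R) : R :=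
  match m with
  | O => 0
  | S m' => pol m' a x + (x - 1) ^ m' / INR (fact m') * a m'
  end.

Lemma pol_ext (m : nat) (a b : nat -> R) (x : R) : (forall i, a i = b i) -> pol m a x = pol m b x.
Proof. intros H; induction m as [|m IH]; simpl; [reflexivity|]. now rewrite IH, H. Qed.

Lemma pol_1 (m : nat) (a : nat -> R) : pol (S m) a 1 = a 0%nat.
Proof.
  induction m as [|m IH]; [simpl; field|].
  change (pol (S m) a 1 + (1 - 1) ^ S m / INR (fact (S m)) * a (S m) = a 0%nat).
  rewrite IH, Rminus_diag, pow_i by lia. unfold Rdiv; ring.
Qed.

Lemma dI_monomial (m : nat) :
  dI (fun x => (x - 1) ^ S m / INR (fact (S m))) (fun x => (x - 1) ^ m / INR (fact m)).
Proof.
  split; [|split]; [contI_tac..|]. intros x _. auto_derive; [exact I|].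
  change (fact m + m * fact m)%nat with (S m * fact m)%nat. rewrite mult_INR.
  pose proof (INR_fact_neq_0 m). pose proof (not_0_INR (S m) ltac:(lia)).
  change (match m with O => 1 | S _ => INR m + 1 end) with (INR (S m)).
  unfold Rdiv, Rminus. field. split; assumption.
Qed.

Lemma pol_dI (m : nat) (a : nat -> R) : dI (pol (S m) a) (pol m (fun i => a (S i))).
Proof.
  induction m as [|m IH].
  - refine (dI_ext _ _ (dI_const (a 0%nat))); intros x; simpl; [field|reflexivity].
  - refine (dI_ext _ _ (dI_plus IH (dI_scal (a (S m)) (dI_monomial m))));
      intros x; [change (pol (S (S m)) a x) with
        (pol (S m) a x + (x - 1) ^ S m / INR (fact (S m)) * a (S m))|simpl pol]; ring.
Qed.

(** The coefficient of [u^(n)] after [n] differentiations. It vanishes at [n = N], which cuts the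
    levels from [N] on off from the lower ones. *)
Definition kn (N n : nat) : R := INR n * (INR n + 1) - INR N * (INR N + 1).

(* [LH] is the n-th derivative of the left-hand side of the equation without the term [s u']. *)
Definition LH (N : nat) (lam : R) (u : nat -> R -> R) (n : nat) (x : R) : R :=
  x ^ 2 * u (S (S n)) x + 2 * (INR n + 1) * x * u (S n) x + kn N n * u n x
  + lam * pol (N - n) (fun i => u (S (n + i)) 1) x.

Lemma LH_dI (N : nat) (lam : R) (u : nat -> R -> R) (n : nat) : rtower u ->
  dI (LH N lam u n) (LH N lam u (S n)).
Proof.
  intros H.
  assert (HP : dI (pol (N - n) (fun i => u (S (n + i)) 1)) (pol (N - S n) (fun i => u (S (S n + i)) 1))).
  { destruct (N - n)%nat as [|m] eqn:E.
    - replace (N - S n)%nat with 0%nat by lia. apply dI_const.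
    - replace (N - S n)%nat with m by lia.
      refine (dI_ext _ _ (pol_dI m _)); intros x; [reflexivity|].
      apply pol_ext. intros i. do 2 f_equal. lia. }
  pose proof (dI_mult (dI_mult dI_id dI_id) (H (S (S n)))) as D1.
  pose proof (dI_mult (dI_scal (2 * (INR n + 1)) dI_id) (H (S n))) as D2.
  pose proof (dI_plus (dI_plus (dI_plus D1 D2) (dI_scal (kn N n) (H n)))
    (dI_scal lam HP)) as D.
  refine (dI_ext _ _ D); intros x; unfold LH, kn; [ring|]. rewrite S_INR. ring.
Qed.

Definition res1 (N : nat) (lam : R) (s : cplx) (U F : tower) (n : nat) (x : R) : R :=
  LH N lam (fun n x => fst (U n x)) n x
  + (Re s * fst (U (S n) x) - Im s * snd (U (S n) x)) - fst (F n x).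
Definition res2 (N : nat) (lam : R) (s : cplx) (U F : tower) (n : nat) (x : R) : R :=
  LH N lam (fun n x => snd (U n x)) n x
  + (Re s * snd (U (S n) x) + Im s * fst (U (S n) x)) - snd (F n x).

Lemma res_rtower (N : nat) (lam : R) (s : cplx) (U F : tower) : is_tower U -> is_tower F ->
  rtower (res1 N lam s U F) /\ rtower (res2 N lam s U F).
Proof.
  intros HU HF. apply tower_rtower in HU as [U1 U2]. apply tower_rtower in HF as [F1 F2].
  split; intros n.
  - exact (dI_minus (dI_plus (LH_dI N lam _ n U1)
      (dI_minus (dI_scal (Re s) (U1 (S n))) (dI_scal (Im s) (U2 (S n))))) (F1 n)).
  - exact (dI_minus (dI_plus (LH_dI N lam _ n U2)
      (dI_plus (dI_scal (Re s) (U2 (S n))) (dI_scal (Im s) (U1 (S n))))) (F2 n)).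
Qed.

Lemma csum_fst (m : nat) (V : nat -> cplx) (x : R) :
  fst (csum m (fun i => cscal ((x - 1) ^ i / INR (fact i)) (V i))) = pol m (fun i => fst (V i)) x.
Proof. induction m as [|m IH]; simpl; [reflexivity|now rewrite IH]. Qed.

Lemma csum_snd (m : nat) (V : nat -> cplx) (x : R) :
  snd (csum m (fun i => cscal ((x - 1) ^ i / INR (fact i)) (V i))) = pol m (fun i => snd (V i)) x.
Proof. induction m as [|m IH]; simpl; [reflexivity|now rewrite IH]. Qed.

Lemma solves_iff (N : nat) (lam : R) (s : cplx) (U F : tower) :
  solves N lam s U F <->
  forall x, Icl x -> res1 N lam s U F 0 x = 0 /\ res2 N lam s U F 0 x = 0.
Proof.
  unfold solves, res1, res2, LH, kn, Kop. rewrite Nat.sub_0_r.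
  split; intros H x Ix; specialize (H x Ix);
    pose proof (csum_fst N (fun i => U (S i) 1) x) as C1;
    pose proof (csum_snd N (fun i => U (S i) 1) x) as C2;
    set (c := csum N _) in *; cbn [Nat.add] in *; change (INR 0) with 0 in *.
  - rewrite <- C1, <- C2, <- H.
    unfold cadd, cscal, cmul, Re, Im; cbn [fst snd]. split; ring.
  - rewrite <- C1, <- C2 in H. destruct H as [H1 H2].
    rewrite (surjective_pairing (F 0%nat x)).
    unfold cadd, cscal, cmul, Re, Im in *; cbn [fst snd]. f_equal; lra.
Qed.

Lemma rtower_zero (r : nat -> R -> R) : rtower r ->
  (forall x, Icl x -> r 0%nat x = 0) -> forall n x, Icl x -> r n x = 0.
Proof.
  intros H H0 n. induction n as [|n IH]; [exact H0|].
  intros x Ix. apply (deriv_on_I_unique (fun _ => 0) (r (S n)) (fun _ => 0)); [| |exact Ix].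
  - apply (deriv_on_I_ext (r n) _ (r (S n)) _ IH); [reflexivity|]. apply dI_deriv_on_I, H.
  - apply dI_deriv_on_I, dI_const.
Qed.

(** Used on the residual of a constructed [u]: its [N]-th derivative vanishes by the first-order
    equation, its lower derivatives vanish at 1 by the linear system, and integrating down from 1
    kills the residual. *)
Lemma rtower_zero_down (r : nat -> R -> R) (N : nat) : rtower r ->
  (forall x, Icl x -> r N x = 0) -> (forall n, (n < N)%nat -> r n 1 = 0) ->
  forall x, Icl x -> r 0%nat x = 0.
Proof.
  intros H HN H1.
  assert (K : forall j, (j <= N)%nat -> forall x, Icl x -> r (N - j)%nat x = 0).
  { induction j as [|j IH]; intros Hj x Ix; [now rewrite Nat.sub_0_r; apply HN|].
    rewrite <- (H1 (N - S j)%nat) by lia.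
    destruct (mean_value_dI _ _ x 1 (H (N - S j)%nat) Ix Icl_1) as [c [Hc E]].
    replace (S (N - S j)) with (N - j)%nat in E by lia.
    rewrite IH in E; [lra|lia|]. unfold Icl in *. unfold Rmin, Rmax in Hc; destruct Rle_dec; lra. }
  intros x Ix. rewrite <- (Nat.sub_diag N). apply K; [lia|exact Ix].
Qed.

Lemma solves_high (N : nat) (lam : R) (s : cplx) (U F : tower) (n : nat) (x : R) :
  is_tower U -> is_tower F -> solves N lam s U F -> (N <= n)%nat -> Icl x ->
  F n x = eqn s (INR n + 1) (kn N n) x (U n x) (U (S n) x) (U (S (S n)) x).
Proof.
  intros HU HF H Hn Ix. destruct (res_rtower N lam s U F HU HF) as [R1 R2].
  rewrite solves_iff in H.
  pose proof (rtower_zero _ R1 (fun x Ix => proj1 (H x Ix)) n x Ix) as E1.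
  pose proof (rtower_zero _ R2 (fun x Ix => proj2 (H x Ix)) n x Ix) as E2.
  unfold res1, res2, LH in E1, E2. replace (N - n)%nat with 0%nat in E1, E2 by lia.
  simpl pol in E1, E2. rewrite (surjective_pairing (F n x)). unfold eqn. f_equal; lra.
Qed.

(** At [x = 1] only the constant coefficient of the polynomial survives, so [lam] appears as a
    diagonal entry multiplying [u^(n+1)(1)]. *)
Lemma solves_at_1 (N : nat) (lam : R) (s : cplx) (U F : tower) (n : nat) :
  is_tower U -> is_tower F -> solves N lam s U F -> (n < N)%nat ->
  F n 1 = cadd (eqn s (INR n + 1) (kn N n) 1 (U n 1) (U (S n) 1) (U (S (S n)) 1))
               (cscal lam (U (S n) 1)).
Proof.
  intros HU HF H Hn. destruct (res_rtower N lam s U F HU HF) as [R1 R2].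
  rewrite solves_iff in H.
  pose proof (rtower_zero _ R1 (fun x Ix => proj1 (H x Ix)) n 1 Icl_1) as E1.
  pose proof (rtower_zero _ R2 (fun x Ix => proj2 (H x Ix)) n 1 Icl_1) as E2.
  unfold res1, res2, LH in E1, E2. destruct (N - n)%nat as [|m] eqn:E; [lia|].
  rewrite pol_1 in E1, E2. rewrite Nat.add_0_r in E1, E2.
  rewrite (surjective_pairing (F n 1)). unfold eqn, cadd, cscal; cbn [fst snd]. f_equal; lra.
Qed.

Lemma solves_shift (N : nat) (lam : R) (s s0 : cplx) (U F : tower) :
  solves N lam s0 U (tsub F (tcmul (csub s s0) (tshift U))) -> solves N lam s U F.
Proof.
  rewrite !solves_iff. intros H x Ix. destruct (H x Ix) as [H1 H2].
  unfold res1, res2, tsub, tcmul, tshift, csub, cadd, copp, cmul, Re, Im in *; cbn [fst snd] in *.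
  split; lra.
Qed.

Lemma LH_lin (N : nat) (lam a b : R) (u v w : nat -> R -> R) (x : R) :
  (forall n y, w n y = a * u n y + b * v n y) ->
  LH N lam w 0 x = a * LH N lam u 0 x + b * LH N lam v 0 x.
Proof.
  intros E. unfold LH. rewrite !E.
  assert (P : forall m, pol m (fun i => w (S (0 + i)) 1) x
    = a * pol m (fun i => u (S (0 + i)) 1) x + b * pol m (fun i => v (S (0 + i)) 1) x).
  { induction m as [|m IH]; cbn [pol]; [ring|]. rewrite IH, E. ring. }
  rewrite P. ring.
Qed.

Lemma solves_tsub (N : nat) (lam : R) (s : cplx) (U V F G : tower) :
  solves N lam s U F -> solves N lam s V G -> solves N lam s (tsub U V) (tsub F G).
Proof.
  rewrite !solves_iff. intros HU HV x Ix. destruct (HU x Ix) as [U1 U2], (HV x Ix) as [V1 V2].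
  unfold res1, res2 in *.
  rewrite (LH_lin N lam 1 (-1) (fun n x => fst (U n x)) (fun n x => fst (V n x))
    (fun n x => fst (tsub U V n x)))
    by (intros; unfold tsub, csub, cadd, copp; cbn [fst snd]; ring).
  rewrite (LH_lin N lam 1 (-1) (fun n x => snd (U n x)) (fun n x => snd (V n x))
    (fun n x => snd (tsub U V n x)))
    by (intros; unfold tsub, csub, cadd, copp; cbn [fst snd]; ring).
  unfold tsub, csub, cadd, copp, Re, Im in *; cbn [fst snd] in *. split; lra.
Qed.

Lemma solves_tcmul (N : nat) (lam : R) (s c : cplx) (U F : tower) :
  solves N lam s U F -> solves N lam s (tcmul c U) (tcmul c F).
Proof.
  rewrite !solves_iff. intros HU x Ix. destruct (HU x Ix) as [U1 U2].
  unfold res1, res2 in *.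
  rewrite (LH_lin N lam (fst c) (- snd c) (fun n x => fst (U n x)) (fun n x => snd (U n x))
    (fun n x => fst (tcmul c U n x)))
    by (intros; unfold tcmul, cmul; cbn [fst snd]; ring).
  rewrite (LH_lin N lam (fst c) (snd c) (fun n x => snd (U n x)) (fun n x => fst (U n x))
    (fun n x => snd (tcmul c U n x)))
    by (intros; unfold tcmul, cmul; cbn [fst snd]; ring).
  unfold tcmul, cmul, Re, Im in *; cbn [fst snd] in *.
  apply (f_equal (Rmult (fst c))) in U1 as U1a. apply (f_equal (Rmult (snd c))) in U1 as U1b.
  apply (f_equal (Rmult (fst c))) in U2 as U2a. apply (f_equal (Rmult (snd c))) in U2 as U2b.
  split; lra.
Qed.

(** * A priori estimate *)

Ltac nonneg :=
  repeat first [apply cnorm2_nonneg | (left; apply wcoef_pos; assumption) | lra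
               | apply Rmult_le_pos | apply pow_le].

(** Each inequality is integrated over the interval and summed: [T] telescopes, its initial value at
    level [N] and the boundary terms at 1 have a good sign, and the last [T] and the boundary terms
    at 0 remain. *)
Lemma energy_sum (N : nat) (B B' T Q P : nat -> R -> R) :
  (forall n, (N <= n)%nat -> dI (B n) (B' n)) ->
  (forall n, (N <= n)%nat -> contI (T n)) -> (forall n, (N <= n)%nat -> contI (Q n)) ->
  (forall n, (N <= n)%nat -> contI (P n)) ->
  (forall n x, (N <= n)%nat -> Icl x -> B' n x + Q n x <= P n x + (T (S n) x - T n x)) ->
  (forall x, Icl x -> 0 <= T N x) ->
  (forall n, (N <= n)%nat -> 0 <= B n 1) ->
  forall L, sum_f_R0 (fun j => RInt (Q (N + j)%nat) 0 1) L <=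
    sum_f_R0 (fun j => RInt (P (N + j)%nat) 0 1) L + RInt (T (N + S L)%nat) 0 1
    + sum_f_R0 (fun j => B (N + j)%nat 0) L.
Proof.
  intros DB CT CQ CP H HT HB.
  assert (K : forall n, (N <= n)%nat ->
    RInt (Q n) 0 1 <= RInt (P n) 0 1 + (RInt (T (S n)) 0 1 - RInt (T n) 0 1) + B n 0).
  { intros n Hn. pose proof (FTC_dI _ _ 0 1 (DB n Hn) Icl_0 Icl_1) as E.
    assert (CB' : contI (B' n)) by apply (DB n Hn).
    specialize (HB n Hn).
    assert (LE : RInt (fun x => B' n x + Q n x) 0 1 <= RInt (fun x => P n x + (T (S n) x - T n x)) 0 1).
    { pose proof (CT n Hn); pose proof (CT (S n) ltac:(lia)); pose proof (CQ n Hn); pose proof (CP n Hn).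
      apply RInt_le_contI; [contI_tac..|]. intros x Ix. now apply H. }
    pose proof (CT n Hn) as C1; pose proof (CT (S n) ltac:(lia)) as C2.
    pose proof (CQ n Hn) as C3; pose proof (CP n Hn) as C4.
    rewrite !RInt_plus_contI, RInt_minus_contI in LE by contI_tac. lra. }
  assert (HTN : 0 <= RInt (T N) 0 1) by (apply RInt_nonneg_contI; auto).
  intros L.
  assert (G : sum_f_R0 (fun j => RInt (Q (N + j)%nat) 0 1) L <=
    sum_f_R0 (fun j => RInt (P (N + j)%nat) 0 1) L + (RInt (T (N + S L)%nat) 0 1 - RInt (T N) 0 1)
    + sum_f_R0 (fun j => B (N + j)%nat 0) L).
  { induction L as [|L IH]; simpl sum_f_R0.
    - pose proof (K (N + 0)%nat ltac:(lia)) as K0. rewrite Nat.add_0_r in *.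
      replace (N + 1)%nat with (S N) by lia. lra.
    - pose proof (K (N + S L)%nat ltac:(lia)) as K0.
      replace (S (N + S L)) with (N + S (S L))%nat in K0 by lia. lra. }
  lra.
Qed.

Lemma kn_nonneg (N n : nat) : (N <= n)%nat -> 0 <= kn N n.
Proof.
  intros H. apply le_INR in H. pose proof (pos_INR N). unfold kn. nra.
Qed.

Lemma kn_le (N n : nat) : kn N (S n) <= (INR n + 1) * (INR n + 1 + 1).
Proof. unfold kn. rewrite S_INR. pose proof (pos_INR N). nra. Qed.

Lemma kn_diag (N : nat) : kn N N = 0.
Proof. unfold kn; ring. Qed.

(** The two coercivity conditions of the first multiplier with a quantitative margin. The bound on
    [|Im s|] alone gives the form [sigma xi^2 + |Im s| - sigma], as well as the sign at [x = 1]. *)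
Definition condA (sigma d : R) (s : cplx) : Prop :=
  sigma + d <= Rabs (Im s) /\
  forall xi, 0 <= xi -> d * (1 + xi ^ 2) <= sigma * xi ^ 2 + Re s * xi + Rabs (Im s).

(** The uniform version of the spectral region; the lower bound on [|s|] serves the boundary terms
    at 0. *)
Definition good (sigma d M1 : R) (s : cplx) : Prop :=
  Rabs (Re s) <= M1 /\ Rabs (Im s) <= M1 /\ (sigma + d) ^ 2 <= cnorm2 s /\
  (d <= Re s \/ condA sigma d s).

Section Apriori.
Variables (sigma d M1 : R) (N : nat).
Hypothesis Hs : 0 < sigma.
Hypothesis Hd : 0 < d <= sigma.
Hypothesis HM1 : 0 <= M1.
Hypothesis HN : 2 * sigma + M1 <= d * (INR N + 1).

Definition HQ (U : tower) (n : nat) (x : R) : R :=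
  (1 + ((INR n + 1) * x / sigma) ^ 2) * (wcoef sigma n * cnorm2 (U (S n) x)).

Definition high_eqs (s : cplx) (U F : tower) : Prop :=
  forall n x, (N <= n)%nat -> Icl x ->
  F n x = eqn s (INR n + 1) (kn N n) x (U n x) (U (S n) x) (U (S (S n)) x).

Lemma wcoef_S' (n : nat) :
  wcoef sigma (S n) = wcoef sigma n * (sigma / ((INR n + 1) * (INR n + 1 + 1))) ^ 2.
Proof. rewrite wcoef_S, S_INR. reflexivity. Qed.

Lemma HQ_cont (U : tower) (n : nat) : is_tower U -> contI (HQ U n).
Proof. intros HU. pose proof (tower_cont_cnorm2 U (S n) HU). unfold HQ. contI_tac. Qed.

Lemma RInt_wF (F : tower) (L : nat) : inY sigma F ->
  sum_f_R0 (fun j => RInt (fun x => 6 / d * (wcoef sigma (N + j) * cnorm2 (F (N + j)%nat x))) 0 1) L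
  <= 6 / d * YS sigma F.
Proof.
  intros HF. apply (inY_iff sigma Hs) in HF as [TF CF].
  assert (Hd6 : 0 <= 6 / d) by (apply Rdiv_le_0_compat; lra).
  apply Rle_trans with (6 / d * sum_f_R0 (fun j => YT sigma F (N + j)) L).
  - rewrite scal_sum. apply sum_Rle. intros j _.
    pose proof (tower_cont_cnorm2 F (N + j) TF) as C.
    rewrite !RInt_scal_contI, Rmult_comm by contI_tac.
    apply Rmult_le_compat_r; [exact Hd6|]. now apply RInt_le_YT.
  - apply Rmult_le_compat_l; [exact Hd6|].
    apply (sum_shift_le_Series (YT sigma F)); [intros; now apply YT_nonneg|exact CF|intros; lra].
Qed.

(** At [x = 0] the equation is the recursion [s u^(n+1)(0) + kn u^(n)(0) = f^(n)(0)], started at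
    [n = N] with [kn = 0]. In the Gevrey weights the factor [kn] costs at most [sigma], so
    [|s| >= sigma + d] makes it a contraction. *)
Lemma boundary_bound (s : cplx) (U F : tower) : (sigma + d) ^ 2 <= cnorm2 s ->
  inY sigma F -> high_eqs s U F ->
  forall L, sum_f_R0 (fun j => sigma * wcoef sigma (N + j) * cnorm2 (U (S (N + j)) 0)) L
    <= / d ^ 2 * YS sigma F.
Proof.
  intros Hc HF HE L. apply (inY_iff sigma Hs) in HF as [TF CF].
  set (a := fun j => wcoef sigma (N + j) * cnorm2 (U (S (N + j)) 0)).
  set (f := fun j => wcoef sigma (N + j) * cnorm2 (F (N + j)%nat 0)).
  assert (Step : forall n, (N <= n)%nat -> (sigma + d) ^ 2 * cnorm2 (U (S n) 0) <=
    (1 + sigma / d) * cnorm2 (F n 0) + (1 + d / sigma) * (kn N n ^ 2 * cnorm2 (U n 0))).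
  { intros n Hn. rewrite (HE n 0 Hn Icl_0).
    set (q := U (S n) 0). set (p := U n 0). set (k := kn N n).
    apply Rle_trans with (cnorm2 s * cnorm2 q).
    { apply Rmult_le_compat_r; [apply cnorm2_nonneg|exact Hc]. }
    set (z := cmul s q). assert (Ez : cnorm2 s * cnorm2 q = cnorm2 z) by (unfold z; now rewrite cnorm2_cmul).
    rewrite Ez.
    assert (EF : eqn s (INR n + 1) k 0 p q (U (S (S n)) 0) = (fst z + k * fst p, snd z + k * snd p)).
    { unfold eqn, z, cmul, Re, Im; cbn [fst snd]. f_equal; ring. }
    rewrite EF. unfold cnorm2; cbn [fst snd].
    set (z1 := fst z); set (z2 := snd z); set (p1 := k * fst p); set (p2 := k * snd p).
    replace (k ^ 2 * (fst p ^ 2 + snd p ^ 2)) with (p1 ^ 2 + p2 ^ 2) by (unfold p1, p2; ring).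
    (* The parameter is chosen so that the recursion contributes [(1 + d/sigma) sigma^2 = sigma
       (sigma + d)], which is less than [(sigma + d)^2] by [d (sigma + d)]. *)
    assert (Y : forall u v, u ^ 2 <= (1 + sigma / d) * (u + v) ^ 2 + (1 + d / sigma) * v ^ 2).
    { intros u v. assert (E : (1 + sigma / d) * (u + v) ^ 2 + (1 + d / sigma) * v ^ 2 - u ^ 2
        = / (sigma * d) * (sigma * (u + v) + d * v) ^ 2) by (field; lra).
      assert (0 <= / (sigma * d) * (sigma * (u + v) + d * v) ^ 2).
      { apply Rmult_le_pos; [left; apply Rinv_0_lt_compat; nra|apply pow2_ge_0]. }
      lra. }
    pose proof (Y z1 p1); pose proof (Y z2 p2). lra. }
  assert (Hinv : 0 < / d) by (apply Rinv_0_lt_compat; lra).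
  assert (Ha : forall j, 0 <= a j).
  { intros j; apply Rmult_le_pos; [left; now apply wcoef_pos|apply cnorm2_nonneg]. }
  assert (G : forall L, (sigma + d) ^ 2 * sum_f_R0 a L <=
    (1 + sigma / d) * sum_f_R0 f L + sigma * (sigma + d) * (sum_f_R0 a L - a L)).
  { induction L0 as [|L0 IH]; simpl sum_f_R0.
    - pose proof (Step (N + 0)%nat ltac:(lia)) as S0. unfold a, f.
      rewrite Nat.add_0_r in *. rewrite kn_diag in S0.
      apply Rmult_le_compat_l with (r := wcoef sigma N) in S0; [lra|left; now apply wcoef_pos].
    - pose proof (Step (N + S L0)%nat ltac:(lia)) as S0.
      apply Rmult_le_compat_l with (r := wcoef sigma (N + S L0)) in S0; [|left; now apply wcoef_pos].
      assert (KK : wcoef sigma (N + S L0) * ((1 + d / sigma) * (kn N (N + S L0) ^ 2 * cnorm2 (U (N + S L0)%nat 0)))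
        <= sigma * (sigma + d) * a L0).
      { unfold a. replace (N + S L0)%nat with (S (N + L0)) by lia. set (m := (N + L0)%nat).
        rewrite wcoef_S'. pose proof (kn_nonneg N (S m) ltac:(lia)) as K0. pose proof (kn_le N m) as K1.
        pose proof (pos_INR m) as Im0. set (tt := (INR m + 1) * (INR m + 1 + 1)) in *.
        assert (Htt : 0 < tt) by (unfold tt; nra).
        replace (wcoef sigma m * (sigma / tt) ^ 2 * ((1 + d / sigma) * (kn N (S m) ^ 2 * cnorm2 (U (S m) 0))))
          with ((kn N (S m) / tt) ^ 2 * (sigma * (sigma + d) * (wcoef sigma m * cnorm2 (U (S m) 0)))) by (field; lra).
        rewrite <- (Rmult_1_l (sigma * (sigma + d) * _)) at 2.
        apply Rmult_le_compat_r.
        - nonneg.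
        - assert (0 <= kn N (S m) / tt <= 1).
          { split; [apply Rdiv_le_0_compat; lra|].
            apply div_le_1; lra. }
          nra. }
      change (a (S L0)) with (wcoef sigma (N + S L0) * cnorm2 (U (S (N + S L0)) 0)).
      change (f (S L0)) with (wcoef sigma (N + S L0) * cnorm2 (F (N + S L0)%nat 0)).
      assert (0 <= a L0) by apply Ha.
      lra. }
  specialize (G L). pose proof (Ha L) as HaL. pose proof (sum_nonneg a L Ha) as HS.
  assert (HL : d * (sigma + d) * sum_f_R0 a L <= (1 + sigma / d) * sum_f_R0 f L).
  { assert (0 <= sigma * (sigma + d) * a L) by nonneg. lra. }
  assert (HF : sigma * sum_f_R0 f L <= YS sigma F).
  { rewrite scal_sum.
    apply (sum_shift_le_Series (fun n => wcoef sigma n * cnorm2 (F n 0) * sigma) (YT sigma F));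
      [intros; now apply YT_nonneg|exact CF|].
    intros n. rewrite YT_split, (bterm_eq sigma) by assumption.
    pose proof (wterm_nonneg sigma Hs 0 F n TF); pose proof (wterm_nonneg sigma Hs 1 F n TF). lra. }
  assert (E : sum_f_R0 (fun j => sigma * wcoef sigma (N + j) * cnorm2 (U (S (N + j)) 0)) L = sigma * sum_f_R0 a L).
  { rewrite scal_sum. apply sum_eq. intros; unfold a; ring. }
  rewrite E.
  replace (1 + sigma / d) with (/ d * (sigma + d)) in HL by (field; lra).
  assert (HL2 : d ^ 2 * sum_f_R0 a L <= sum_f_R0 f L).
  { apply Rmult_le_reg_l with (/ d * (sigma + d)); [apply Rmult_lt_0_compat; lra|].
    replace (/ d * (sigma + d) * (d ^ 2 * sum_f_R0 a L)) with (d * (sigma + d) * sum_f_R0 a L) by (field; lra).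
    exact HL. }
  apply Rmult_le_reg_l with (d ^ 2); [nra|].
  replace (d ^ 2 * (/ d ^ 2 * YS sigma F)) with (YS sigma F) by (field; lra).
  apply Rle_trans with (2 := HF).
  apply Rle_trans with (sigma * (d ^ 2 * sum_f_R0 a L)); [lra|apply Rmult_le_compat_l; lra].
Qed.

Lemma highB (s : cplx) (U F : tower) : (sigma + d) ^ 2 <= cnorm2 s -> d <= Re s ->
  is_tower U -> inY sigma F -> high_eqs s U F ->
  forall L, d / 2 * sum_f_R0 (fun j => RInt (HQ U (N + j)) 0 1) L
    <= (6 / d + sigma / d ^ 2) * YS sigma F.
Proof.
  intros Hc Hr HU HF HE L. pose proof HF as HF'. apply (inY_iff sigma Hs) in HF' as [TF CF].
  set (B := fun n x => wcoef sigma n * BB sigma (INR n + 1) (kn N n) x (U n x) (U (S n) x)).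
  set (T := fun n x => TB sigma (INR n + 1) (wcoef sigma n) (kn N n) (U n x)).
  set (Q := fun n x => d / 2 * HQ U n x).
  set (P := fun n x => 6 / d * (wcoef sigma n * cnorm2 (F n x))).
  assert (Sum : sum_f_R0 (fun j => RInt (Q (N + j)%nat) 0 1) L <=
    sum_f_R0 (fun j => RInt (P (N + j)%nat) 0 1) L + RInt (T (N + S L)%nat) 0 1
    + sum_f_R0 (fun j => B (N + j)%nat 0) L).
  { apply (energy_sum N B (fun n x => wcoef sigma n
      * BB' sigma (INR n + 1) (kn N n) x (U n x) (U (S n) x) (U (S (S n)) x)));
      unfold B, T, Q, P.
    - intros n _. destruct (tower_dI U n HU) as [p1 p2], (tower_dI U (S n) HU) as [q1 q2].
      pose proof (dI_plus (dI_mult p1 p1) (dI_mult p2 p2)) as DP.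
      pose proof (dI_plus (dI_mult q1 q1) (dI_mult q2 q2)) as DQ.
      pose proof (dI_mult dI_id dI_id) as X2.
      pose proof (dI_mult dI_id X2) as X3.
      pose proof (dI_plus (dI_plus (dI_scal (/ 2) (dI_mult X2 DQ))
        (dI_scal (/ 2 * kn N n) DP))
        (dI_plus (dI_scal (/ 2 * ((INR n + 1) / sigma)) (dI_mult X3 DQ))
          (dI_scal (/ 2 * ((INR n + 1) / sigma) * kn N n) (dI_mult dI_id DP)))) as D.
      refine (dI_ext _ _ (dI_scal (wcoef sigma n) D)); intros x;
        unfold BB, BB', dotc, cnorm2; cbv beta; field; lra.
    - intros n _. pose proof (tower_cont_cnorm2 U n HU). unfold TB. contI_tac.
    - intros n _. pose proof (HQ_cont U n HU). contI_tac.
    - intros n _. pose proof (tower_cont_cnorm2 F n TF). contI_tac.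
    - intros n x Hn Ix. pose proof (le_INR _ _ Hn). pose proof (pos_INR N).
      pose proof (energyB sigma d (INR n + 1) (kn N n) (kn N (S n)) x (wcoef sigma n) s
        (U n x) (U (S n) x) (U (S (S n)) x) (F n x) Hs Hd ltac:(lra) (kn_nonneg N n Hn)
        (conj (kn_nonneg N (S n) ltac:(lia)) (kn_le N n)) (proj1 Ix)
        (Rlt_le _ _ (wcoef_pos sigma n Hs)) Hr ltac:(nra) (HE n x Hn Ix)) as K.
      rewrite wcoef_S', S_INR. unfold HQ. lra.
    - intros x _. unfold TB. rewrite kn_diag. right; ring.
    - intros n Hn. apply Rmult_le_pos; [left; now apply wcoef_pos|]. unfold BB.
      pose proof (kn_nonneg N n Hn). pose proof (pos_INR n).
      assert (0 <= (INR n + 1) / sigma) by (apply Rdiv_le_0_compat; lra).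
      pose proof (cnorm2_nonneg (U n 1)); pose proof (cnorm2_nonneg (U (S n) 1)).
      repeat apply Rplus_le_le_0_compat; nonneg. }
  assert (E1 : sum_f_R0 (fun j => RInt (Q (N + j)%nat) 0 1) L
    = d / 2 * sum_f_R0 (fun j => RInt (HQ U (N + j)) 0 1) L).
  { rewrite scal_sum. apply sum_eq. intros j _. unfold Q.
    rewrite RInt_scal_contI by now apply HQ_cont. ring. }
  assert (E2 : RInt (T (N + S L)%nat) 0 1 <= 0).
  { rewrite <- (RInt_const_01 0) at 2. pose proof (tower_cont_cnorm2 U (N + S L) HU).
    apply RInt_le_contI; [unfold T, TB; contI_tac|contI_tac|]. intros x _. unfold T, TB.
    pose proof (kn_nonneg N (N + S L) ltac:(lia)). pose proof (pos_INR (N + S L)).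
    assert (0 <= (INR (N + S L) + 1) / sigma) by (apply Rdiv_le_0_compat; lra).
    pose proof (wcoef_pos sigma (N + S L) Hs).
    match goal with |- - ?z <= 0 => assert (0 <= z) end; [|lra].
    nonneg. }
  pose proof (RInt_wF F L HF : sum_f_R0 (fun j => RInt (P (N + j)%nat) 0 1) L <= _) as E3.
  (* At 0 only [k |u^(n)(0)|^2 / 2] survives in [BB]. It vanishes at level [N], and above it the
     weight ratio outweighs [k], so each term is at most [sigma] times the term of [boundary_bound]
     one level lower. *)
  assert (E4 : sum_f_R0 (fun j => B (N + j)%nat 0) L
    <= sigma / d ^ 2 * YS sigma F).
  { pose proof (boundary_bound s U F Hc HF HE L) as Bd.
    apply Rle_trans with (sigma * sum_f_R0 (fun j => sigma * wcoef sigma (N + j) * cnorm2 (U (S (N + j)) 0)) L).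
    2:{ unfold Rdiv. rewrite Rmult_assoc. apply Rmult_le_compat_l; lra. }
    rewrite scal_sum. clear - Hs Hd HN.
    set (y := fun j => sigma * wcoef sigma (N + j) * cnorm2 (U (S (N + j)) 0)).
    assert (Hy : forall j, 0 <= y j).
    { intros j. unfold y. nonneg. }
    set (g := fun j => B (N + j)%nat 0).
    change (sum_f_R0 g L <= sum_f_R0 (fun i => y i * sigma) L).
    assert (G : sum_f_R0 g L <= sum_f_R0 (fun i => y i * sigma) L - y L * sigma).
    { induction L as [|L IH]; simpl.
      - unfold g, B, BB. rewrite Nat.add_0_r, kn_diag. right; field; lra.
      - assert (g (S L) <= y L * sigma); [|specialize (Hy (S L)); lra].
        unfold g, y, B, BB. replace (N + S L)%nat with (S (N + L)) by lia. set (m := (N + L)%nat).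
        rewrite wcoef_S'. pose proof (kn_nonneg N (S m) ltac:(lia)) as K0. pose proof (kn_le N m) as K1.
        pose proof (pos_INR m) as Im0. set (tt := (INR m + 1) * (INR m + 1 + 1)) in *.
        assert (Htt : 2 <= tt) by (unfold tt; nra).
        set (c := cnorm2 (U (S m) 0)).
        match goal with |- ?a <= _ => replace a with
          (/ 2 * (kn N (S m) / tt * / tt) * (sigma ^ 2 * wcoef sigma m * c)) by (field; lra) end.
        replace (sigma * wcoef sigma m * c * sigma) with (1 * (sigma ^ 2 * wcoef sigma m * c)) by ring.
        pose proof (wcoef_pos sigma m Hs). pose proof (cnorm2_nonneg (U (S m) 0)) as Hc. fold c in Hc.
        apply Rmult_le_compat_r; [nonneg|].
        assert (0 <= kn N (S m) / tt <= 1).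
        { split; [apply Rdiv_le_0_compat; lra|].
          apply div_le_1; lra. }
        pose proof (Rinv_01 tt ltac:(lra)).
        nra. }
    specialize (Hy L). nra. }
  rewrite E1 in Sum. lra.
Qed.

(** A crude bound of the last telescoping term by two consecutive terms of the X norm, which tend to
    zero along the series. *)
Lemma TA_bound (s : cplx) (e t w k1 x : R) (q r : cplx) :
  (e = 1 \/ e = -1) -> 1 <= t -> 0 <= w -> 0 <= k1 <= t * (t + 1) -> 0 <= x -> Rabs (Re s) <= M1 ->
  TA sigma d (Re s) e (t + 1) (w * (sigma / (t * (t + 1))) ^ 2) k1 x q r <=
  (M1 + 2 * sigma + d) * ((1 + ((t + 1) * x / sigma) ^ 2) * (w * (sigma / (t * (t + 1))) ^ 2 * cnorm2 r))
  + sigma * (w * cnorm2 q).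
Proof.
  intros He Ht Hw Hk Hx Hr. set (xi := (t + 1) * x / sigma).
  assert (Hxi : 0 <= xi) by (unfold xi; apply Rmult_le_pos; [nra|left; now apply Rinv_0_lt_compat]).
  set (al := t * (t + 1) / sigma).
  assert (Hal : 0 < al) by (unfold al; apply Rdiv_lt_0_compat; nra).
  assert (Ew : w * (sigma / (t * (t + 1))) ^ 2 = w / al ^ 2) by (unfold al; field; lra).
  unfold TA. fold xi. rewrite Ew. set (w' := w / al ^ 2).
  assert (Hw' : 0 <= w') by (apply Rmult_le_pos; [lra|left; apply Rinv_0_lt_compat, pow_lt, Hal]).
  pose proof (cnorm2_nonneg r) as HR. pose proof (cnorm2_nonneg q) as HQq.
  pose proof (Rinv_01 (t + 1) ltac:(lra)) as Hth.
  assert (Hc : Rabs (- e * (k1 / al ^ 2 * (2 - / (t + 1))) * al) <= 2 * sigma).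
  { replace (- e * (k1 / al ^ 2 * (2 - / (t + 1))) * al)
      with (- e * (k1 / (t * (t + 1)) * (sigma * (2 - / (t + 1))))) by (unfold al; field; lra).
    rewrite Rabs_mult, Rabs_Ropp. replace (Rabs e) with 1
      by (destruct He as [-> | ->]; unfold Rabs; destruct Rcase_abs; lra).
    rewrite Rmult_1_l.
    assert (Ht2 : 0 < t * (t + 1)) by nra.
    assert (Hka : 0 <= k1 / (t * (t + 1)) <= 1).
    { split; [apply Rdiv_le_0_compat; lra|].
      apply div_le_1; lra. }
    rewrite Rabs_pos_eq by (apply Rmult_le_pos; [apply Hka|apply Rmult_le_pos; lra]).
    apply Rle_trans with (1 * (sigma * (2 - / (t + 1))));
      [apply Rmult_le_compat_r; [apply Rmult_le_pos; lra|apply Hka]|nra]. }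
  pose proof (crsc_young r q _ al _ Hal Hc) as HJ.
  apply Rmult_le_compat_l with (r := w) in HJ; [|exact Hw].
  assert (HG : gA sigma (Re s) xi <= M1 * (1 + xi ^ 2) + 2 * sigma).
  { apply Rabs_le_between in Hr.
    assert (xi <= 1 + xi ^ 2) by nra.
    assert (M1 * xi <= M1 * (1 + xi ^ 2)) by (apply Rmult_le_compat_l; lra).
    assert (Re s * xi <= M1 * xi) by (apply Rmult_le_compat_r; lra).
    assert (- Re s * xi <= M1 * xi) by (apply Rmult_le_compat_r; lra).
    unfold gA. apply Rmax_lub; lra. }
  assert (K1 : / 2 * gA sigma (Re s) xi * (w' * cnorm2 r) <= (M1 * (1 + xi ^ 2) + 2 * sigma) * / 2 * (w' * cnorm2 r)).
  { apply Rmult_le_compat_r; [nra|lra]. }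
  assert (K2 : 0 <= w' * k1 * (/ 2 * ((t + 1) / sigma) * cnorm2 q)).
  { assert (0 <= (t + 1) / sigma) by (apply Rdiv_le_0_compat; lra). nonneg. }
  replace (w * (- e * (k1 / al ^ 2 * (2 - / (t + 1))) * crsc r q))
    with (- (w' * k1 * ((2 - / (t + 1)) * (e * crsc r q)))) in HJ by (unfold w', Rdiv; ring).
  replace (w * (/ 2 * (2 * sigma) * (cnorm2 q + cnorm2 r / al ^ 2)))
    with (sigma * (w * cnorm2 q) + sigma * (w' * cnorm2 r)) in HJ by (unfold w'; field; lra).
  assert (HWR : 0 <= w' * cnorm2 r) by nonneg.
  set (z := w' * cnorm2 r) in *.
  assert (K3 : 0 <= xi ^ 2 * z) by (apply Rmult_le_pos; [apply pow2_ge_0|exact HWR]).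
  assert (0 <= M1 * z) by nonneg. assert (0 <= M1 * (xi ^ 2 * z)) by nonneg.
  assert (0 <= sigma * z) by nonneg. assert (0 <= sigma * (xi ^ 2 * z)) by nonneg.
  assert (0 <= d * z) by nonneg. assert (0 <= d * (xi ^ 2 * z)) by nonneg.
  lra.
Qed.

(** The cross term is absorbed by the squares of [p] and [q]. The weight [sigma / t^2] makes the
    square of [p] match exactly; the square of [q] then fits because [k <= t^2] and
    [e * b >= sigma]. *)
Lemma BA_1_nonneg (b e t k : R) (p q : cplx) :
  (e = 1 \/ e = -1) -> 0 < t -> 0 <= k <= t ^ 2 -> sigma <= e * b -> 0 <= BA sigma b e t k 1 p q.
Proof.
  intros He Ht Hk Hb. unfold BA.
  assert (Hal : 0 < sigma / t ^ 2) by (apply Rdiv_lt_0_compat; [lra|now apply pow_lt]).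
  assert (Hc : Rabs (- e * (sigma / t ^ 2)) <= sigma / t ^ 2).
  { rewrite Rabs_mult, Rabs_Ropp, (Rabs_pos_eq (sigma / t ^ 2)) by lra.
    replace (Rabs e) with 1 by (destruct He as [-> | ->]; unfold Rabs; destruct Rcase_abs; lra). lra. }
  pose proof (crsc_young p q (- e) _ _ Hal Hc) as HJ.
  apply Rmult_le_compat_l with (r := k / t) in HJ;
    [|apply Rdiv_le_0_compat; lra].
  replace (k / t * (/ 2 * (sigma / t ^ 2) * (cnorm2 q + cnorm2 p / (sigma / t ^ 2) ^ 2)))
    with (/ (2 * t) * (k / t ^ 2) * (sigma * cnorm2 q) + / 2 * (t / sigma) * k * cnorm2 p)
    in HJ by (field; lra).
  pose proof (cnorm2_nonneg q) as HQq.
  assert (K : / (2 * t) * (k / t ^ 2) * (sigma * cnorm2 q) <= e * b / (2 * t) * cnorm2 q).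
  { replace (e * b / (2 * t) * cnorm2 q) with (/ (2 * t) * (e * b * cnorm2 q)) by (field; lra).
    rewrite Rmult_assoc. apply Rmult_le_compat_l; [left; apply Rinv_0_lt_compat; lra|].
    assert (k / t ^ 2 <= 1).
    { assert (0 < t ^ 2) by now apply pow_lt.
      apply div_le_1; lra. }
    apply Rle_trans with (1 * (sigma * cnorm2 q)); [apply Rmult_le_compat_r; [nonneg|lra]|].
    rewrite Rmult_1_l. apply Rmult_le_compat_r; lra. }
  assert (0 <= / 2 * (t / sigma) * 1 ^ 3 * cnorm2 q).
  { assert (0 <= t / sigma) by (left; now apply Rdiv_lt_0_compat). nonneg. }
  lra.
Qed.

Lemma HQ_le_XT (U : tower) (n : nat) : is_tower U -> RInt (HQ U (S n)) 0 1 <= 4 * XT sigma U (S n).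
Proof.
  intros HU. pose proof (tower_cont_cnorm2 U (S (S n)) HU) as C.
  pose proof (wcoef_pos sigma (S n) Hs) as Hw.
  apply Rle_trans with (4 * (wcoef sigma (S n) * RInt (fun x =>
    (1 + INR (S n) * x / sigma + (INR (S n) * x / sigma) ^ 2) * cnorm2 (U (S (S n)) x)) 0 1)).
  - rewrite <- !RInt_scal_contI by contI_tac.
    apply RInt_le_contI; [now apply HQ_cont|contI_tac|]. intros x Ix. unfold HQ.
    pose proof (xi_nonneg sigma Hs (S n) x Ix) as Y. rewrite S_INR in *.
    set (y := (INR n + 1) * x / sigma) in *.
    set (z := (INR n + 1 + 1) * x / sigma).
    assert (0 <= z <= 2 * y).
    { assert (Hx : 0 <= x / sigma) by (apply Rmult_le_pos; [apply Ix|left; now apply Rinv_0_lt_compat]).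
      replace y with ((INR n + 1) * (x / sigma)) by (unfold y, Rdiv; ring).
      replace z with ((INR n + 1 + 1) * (x / sigma)) by (unfold z, Rdiv; ring).
      pose proof (pos_INR n). split; nra. }
    assert (1 + z ^ 2 <= 4 * (1 + y + y ^ 2)) by nra.
    pose proof (cnorm2_nonneg (U (S (S n)) x)).
    replace (4 * (wcoef sigma (S n) * ((1 + y + y ^ 2) * cnorm2 (U (S (S n)) x))))
      with (4 * (1 + y + y ^ 2) * (wcoef sigma (S n) * cnorm2 (U (S (S n)) x))) by ring.
    apply Rmult_le_compat_r; [nonneg|assumption].
  - unfold XT. assert (0 <= sigma * wcoef sigma (S n) * cnorm2 (U (S (S n)) 0)) by nonneg. lra.
Qed.

Lemma HQ_nonneg (U : tower) (n : nat) : is_tower U -> 0 <= RInt (HQ U n) 0 1.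
Proof.
  intros HU. apply RInt_nonneg_contI; [now apply HQ_cont|]. intros x _. unfold HQ.
  apply Rmult_le_pos; [pose proof (pow2_ge_0 ((INR n + 1) * x / sigma)); lra|nonneg].
Qed.

Lemma highA (s : cplx) (U F : tower) : condA sigma d s -> Rabs (Re s) <= M1 -> Rabs (Im s) <= M1 ->
  inX sigma U -> inY sigma F -> high_eqs s U F ->
  forall L, d / 2 * sum_f_R0 (fun j => RInt (HQ U (N + j)) 0 1) L <= 6 / d * YS sigma F.
Proof.
  intros [Hb HA] Hr Him HX HF HE. pose proof HF as HF'. apply (inY_iff sigma Hs) in HF' as [TF CF].
  apply (inX_iff sigma Hs) in HX as [HU [_ CX]].
  assert (exists e, (e = 1 \/ e = -1) /\ e * Im s = Rabs (Im s)) as [e [He Ee]].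
  { unfold Rabs. destruct Rcase_abs; [exists (-1)|exists 1]; split; auto; lra. }
  rewrite <- Ee in *.
  set (B := fun n x => wcoef sigma n * BA sigma (Im s) e (INR n + 1) (kn N n) x (U n x) (U (S n) x)).
  set (T := fun n x =>
    TA sigma d (Re s) e (INR n + 1) (wcoef sigma n) (kn N n) x (U n x) (U (S n) x)).
  set (Q := fun n x => d / 2 * HQ U n x).
  set (P := fun n x => 6 / d * (wcoef sigma n * cnorm2 (F n x))).
  assert (CTA : forall n, contI (T n)).
  { intros n. pose proof (tower_cont_cnorm2 U n HU); pose proof (tower_cont_cnorm2 U (S n) HU).
    pose proof (tower_cont_fst U n HU); pose proof (tower_cont_fst U (S n) HU).
    pose proof (tower_cont_snd U n HU); pose proof (tower_cont_snd U (S n) HU).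
    unfold T, TA, gA, crsc. contI_tac. }
  assert (Sum : forall L, sum_f_R0 (fun j => RInt (Q (N + j)%nat) 0 1) L <=
    sum_f_R0 (fun j => RInt (P (N + j)%nat) 0 1) L + RInt (T (N + S L)%nat) 0 1
    + sum_f_R0 (fun j => B (N + j)%nat 0) L).
  { apply (energy_sum N B (fun n x => wcoef sigma n
      * BA' sigma (Im s) e (INR n + 1) (kn N n) x (U n x) (U (S n) x) (U (S (S n)) x)));
      [unfold B| |unfold Q|unfold P|unfold T, Q, P|unfold T|unfold B].
    - intros n _. pose proof (pos_INR n) as In.
      destruct (tower_dI U n HU) as [p1 p2], (tower_dI U (S n) HU) as [q1 q2].
      pose proof (dI_plus (dI_mult p1 p1) (dI_mult p2 p2)) as DP.
      pose proof (dI_plus (dI_mult q1 q1) (dI_mult q2 q2)) as DQ.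
      pose proof (dI_minus (dI_mult p2 q1) (dI_mult p1 q2)) as DJ.
      pose proof (dI_mult dI_id (dI_mult dI_id dI_id)) as X3.
      pose proof (dI_plus (dI_plus
          (dI_scal (/ 2 * ((INR n + 1) / sigma)) (dI_mult X3 DQ))
          (dI_scal (/ 2 * ((INR n + 1) / sigma) * kn N n) (dI_mult dI_id DP)))
        (dI_plus (dI_scal (e * Im s / (2 * (INR n + 1))) (dI_mult dI_id DQ))
          (dI_scal (kn N n / (INR n + 1) * e) (dI_mult dI_id DJ)))) as D.
      refine (dI_ext _ _ (dI_scal (wcoef sigma n) D)); intros x;
        unfold BA, BA', dotc, crsc, cnorm2; cbv beta; field; lra.
    - intros n _. apply CTA.
    - intros n _. pose proof (HQ_cont U n HU). contI_tac.
    - intros n _. pose proof (tower_cont_cnorm2 F n TF). contI_tac.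
    - intros n x Hn Ix. pose proof (le_INR _ _ Hn). pose proof (pos_INR N).
      pose proof (energyA sigma d M1 (INR n + 1) (kn N n) (kn N (S n)) x (wcoef sigma n) e s
        (U n x) (U (S n) x) (U (S (S n)) x) (F n x) Hs Hd ltac:(lra) (kn_nonneg N n Hn)
        (conj (kn_nonneg N (S n) ltac:(lia)) (kn_le N n)) (proj1 Ix)
        (Rlt_le _ _ (wcoef_pos sigma n Hs)) He Hb HA Hr Him ltac:(nra) (HE n x Hn Ix)) as K.
      rewrite wcoef_S', S_INR. unfold HQ. lra.
    - intros x Ix. unfold TA. rewrite kn_diag.
      assert (Hxi : 0 <= (INR N + 1) * x / sigma).
      { pose proof (xi_nonneg sigma Hs (S N) x Ix) as Y. rewrite S_INR in Y. exact Y. }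
      set (xi := (INR N + 1) * x / sigma) in *.
      assert (0 <= gA sigma (Re s) xi).
      { apply Rle_trans with (2 := gA_bound sigma (Re s) xi 0 ltac:(lra)). apply Rabs_pos. }
      rewrite Rmult_0_r, Rmult_0_l, Rminus_0_r. apply Rplus_le_le_0_compat; nonneg.
    - intros n Hn. apply Rmult_le_pos; [left; now apply wcoef_pos|].
      pose proof (pos_INR n). apply BA_1_nonneg; [exact He|lra| |lra].
      split; [now apply kn_nonneg|]. unfold kn. pose proof (pos_INR N). nra. }
  (* Every term of [BA] carries a factor [x], so this multiplier has no boundary contribution at
     0. *)
  assert (E3 : forall L, sum_f_R0 (fun j => B (N + j)%nat 0) L = 0).
  { intros L. apply sum_eq_R0. intros j _. unfold B, BA.
    pose proof (pos_INR (N + j)). field. lra. }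
  set (C := 4 * (M1 + 2 * sigma + d) + sigma).
  assert (ET : forall L, RInt (T (N + S L)%nat) 0 1
    <= C * (XT sigma U (N + S L) + XT sigma U (N + L))).
  { intros L. replace (N + S L)%nat with (S (N + L)) by lia. set (m := (N + L)%nat).
    pose proof (HQ_le_XT U m HU) as K1. pose proof (RInt_le_XT sigma Hs U m HU) as K2.
    pose proof (XT_nonneg sigma Hs U m HU) as K3. pose proof (XT_nonneg sigma Hs U (S m) HU) as K4.
    pose proof (tower_cont_cnorm2 U (S m) HU) as C1. pose proof (HQ_cont U (S m) HU) as C2.
    apply Rle_trans with ((M1 + 2 * sigma + d) * RInt (HQ U (S m)) 0 1
      + sigma * (wcoef sigma m * RInt (fun x => cnorm2 (U (S m) x)) 0 1)).
    - rewrite <- !RInt_scal_contI, <- RInt_plus_contI by contI_tac.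
      apply RInt_le_contI; [apply CTA|contI_tac|]. intros x Ix. unfold T, HQ.
      rewrite wcoef_S', !S_INR. pose proof (pos_INR m).
      apply TA_bound; [exact He|lra|left; now apply wcoef_pos| |apply Ix|exact Hr].
      split; [apply kn_nonneg; lia|apply kn_le].
    - unfold C.
      assert ((M1 + 2 * sigma + d) * RInt (HQ U (S m)) 0 1 <= (M1 + 2 * sigma + d) * (4 * XT sigma U (S m)))
        by (apply Rmult_le_compat_l; lra).
      assert (sigma * (wcoef sigma m * RInt (fun x => cnorm2 (U (S m) x)) 0 1) <= sigma * XT sigma U m)
        by (apply Rmult_le_compat_l; lra).
      assert (0 <= (M1 + 2 * sigma + d) * XT sigma U m) by nonneg.
      assert (0 <= sigma * XT sigma U (S m)) by nonneg. lra. }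
  (* Membership in X enters here: the sum is extended from [L] to an [L'] so large that the last
     telescoping term is below [eps]. *)
  intros L. apply le_epsilon. intros eps Heps.
  assert (HC : 0 < C) by (unfold C; lra).
  destruct (term_cv_0 _ CX (eps / (2 * C)) ltac:(apply Rdiv_lt_0_compat; lra)) as [N0 HN0].
  set (L' := (L + N0)%nat).
  specialize (Sum L'). specialize (ET L'). rewrite E3 in Sum.
  pose proof (RInt_wF F L' HF : sum_f_R0 (fun j => RInt (P (N + j)%nat) 0 1) L' <= _) as EF.
  assert (Sm : forall n, (n >= N0)%nat -> XT sigma U n < eps / (2 * C)).
  { intros n Hn. specialize (HN0 n Hn). unfold Rdist in HN0. rewrite Rminus_0_r in HN0.
    apply Rabs_def2 in HN0. lra. }
  pose proof (Sm (N + S L')%nat ltac:(unfold L'; lia)) as S1.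
  pose proof (Sm (N + L')%nat ltac:(unfold L'; lia)) as S2.
  assert (C * (XT sigma U (N + S L') + XT sigma U (N + L')) <= eps).
  { apply Rle_trans with (C * (eps / (2 * C) + eps / (2 * C))); [apply Rmult_le_compat_l; lra|].
    right; field; lra. }
  assert (E1 : sum_f_R0 (fun j => RInt (Q (N + j)%nat) 0 1) L'
    = d / 2 * sum_f_R0 (fun j => RInt (HQ U (N + j)) 0 1) L').
  { rewrite scal_sum. apply sum_eq. intros j _. unfold Q.
    rewrite RInt_scal_contI by now apply HQ_cont. ring. }
  assert (E4 : sum_f_R0 (fun j => RInt (HQ U (N + j)) 0 1) L <= sum_f_R0 (fun j => RInt (HQ U (N + j)) 0 1) L').
  { unfold L'. clear - HU Hs. induction N0 as [|k IH]; [rewrite Nat.add_0_r; lra|].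
    replace (L + S k)%nat with (S (L + k)) by lia. simpl. pose proof (HQ_nonneg U (N + S (L + k)) HU). lra. }
  apply Rmult_le_compat_l with (r := d / 2) in E4; [|lra].
  rewrite E1 in Sum. lra.
Qed.

(** The alternative in the hypothesis on [U] mirrors the two multipliers: prior membership in X is
    demanded only where the first one must be used. *)
Lemma high_bound (s : cplx) (U F : tower) : good sigma d M1 s ->
  is_tower U -> (inX sigma U \/ d <= Re s) -> inY sigma F -> high_eqs s U F ->
  forall L, sum_f_R0 (fun j => XT sigma U (N + j)) L
    <= (4 / d * (6 / d + sigma / d ^ 2) + / d ^ 2) * YS sigma F.
Proof.
  intros [G1 [G2 [G3 G4]]] HU HX HF HE L.
  assert (HY : 0 <= YS sigma F).
  { apply (inY_iff sigma Hs) in HF as [TF CF]. apply Series_nonneg; [intros; now apply YT_nonneg|exact CF]. }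
  assert (Hsd : 0 <= sigma / d ^ 2 * YS sigma F).
  { apply Rmult_le_pos; [left; apply Rdiv_lt_0_compat; [lra|apply pow_lt; lra]|exact HY]. }
  assert (H : d / 2 * sum_f_R0 (fun j => RInt (HQ U (N + j)) 0 1) L
    <= (6 / d + sigma / d ^ 2) * YS sigma F).
  { destruct (Rle_dec d (Re s)) as [Hr|Hr]; [now apply (highB s)|].
    destruct G4 as [G4|G4]; [contradiction|]. destruct HX as [HX|HX]; [|contradiction].
    pose proof (highA s U F G4 G1 G2 HX HF HE L). lra. }
  pose proof (boundary_bound s U F G3 HF HE L) as HB.
  apply Rle_trans with (2 * sum_f_R0 (fun j => RInt (HQ U (N + j)) 0 1) L
    + sum_f_R0 (fun j => sigma * wcoef sigma (N + j) * cnorm2 (U (S (N + j)) 0)) L).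
  - rewrite scal_sum, <- sum_plus. apply sum_Rle. intros j _. unfold XT.
    set (m := (N + j)%nat). apply Rplus_le_compat_r.
    pose proof (tower_cont_cnorm2 U (S m) HU) as C1. pose proof (HQ_cont U m HU) as C2.
    rewrite (Rmult_comm _ 2), <- !RInt_scal_contI by contI_tac.
    apply RInt_le_contI; [contI_tac..|]. intros x Ix. unfold HQ.
    pose proof (xi_nonneg sigma Hs m x Ix) as Y.
    assert (Y1 : INR m * x / sigma <= (INR m + 1) * x / sigma).
    { apply Rmult_le_compat_r; [left; now apply Rinv_0_lt_compat|]. destruct Ix; lra. }
    set (y := INR m * x / sigma) in *. set (z := (INR m + 1) * x / sigma) in *.
    assert (y ^ 2 <= z ^ 2) by (apply pow_incr; lra).
    assert (1 + y + y ^ 2 <= 2 * (1 + z ^ 2)) by (pose proof (pow2_ge_0 (y - 1)); lra).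
    replace (wcoef sigma m * ((1 + y + y ^ 2) * cnorm2 (U (S m) x)))
      with ((1 + y + y ^ 2) * (wcoef sigma m * cnorm2 (U (S m) x))) by ring.
    replace (2 * ((1 + z ^ 2) * (wcoef sigma m * cnorm2 (U (S m) x))))
      with (2 * (1 + z ^ 2) * (wcoef sigma m * cnorm2 (U (S m) x))) by ring.
    apply Rmult_le_compat_r; [nonneg|assumption].
  - apply Rmult_le_compat_l with (r := 4 / d) in H; [|left; apply Rdiv_lt_0_compat; lra].
    replace (4 / d * (d / 2 * sum_f_R0 (fun j => RInt (HQ U (N + j)) 0 1) L))
      with (2 * sum_f_R0 (fun j => RInt (HQ U (N + j)) 0 1) L) in H by (field; lra).
    lra.
Qed.

End Apriori.

(** * The derivatives of order below N and the full a priori estimate *)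

Fixpoint rsum (m : nat) (a : nat -> R) : R :=
  match m with O => 0 | S m' => rsum m' a + a m' end.

Lemma rsum_nonneg (m : nat) (a : nat -> R) : (forall n, 0 <= a n) -> 0 <= rsum m a.
Proof. intros H; induction m as [|m IH]; simpl; [lra|specialize (H m); lra]. Qed.

Lemma rsum_le (m : nat) (a b : nat -> R) : (forall n, (n < m)%nat -> a n <= b n) -> rsum m a <= rsum m b.
Proof.
  intros H; induction m as [|m IH]; simpl; [lra|].
  pose proof (H m ltac:(lia)). specialize (IH (fun n Hn => H n ltac:(lia))). lra.
Qed.

Lemma rsum_scal (m : nat) (a : nat -> R) (c : R) : rsum m (fun n => a n * c) = rsum m a * c.
Proof. induction m as [|m IH]; simpl; [ring|rewrite IH; ring]. Qed.

Lemma rsum_term (m n : nat) (a : nat -> R) : (forall n, 0 <= a n) -> (n < m)%nat -> a n <= rsum m a.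
Proof.
  intros H Hn. induction Hn as [|m Hn IH]; simpl; [pose proof (rsum_nonneg n a H); lra|].
  specialize (H m). lra.
Qed.

Lemma sum_split_le (a : nat -> R) (N M : nat) : (forall n, 0 <= a n) ->
  sum_f_R0 a M <= rsum N a + sum_f_R0 (fun j => a (N + j)%nat) M.
Proof.
  intros H. apply Rle_trans with (sum_f_R0 a (N + M)).
  - induction N as [|N IH]; simpl; [lra|]. specialize (H (S (N + M))). lra.
  - assert (E : sum_f_R0 a (N + 0) = rsum N a + a (N + 0)%nat).
    { rewrite Nat.add_0_r. induction N as [|N IH]; simpl; [ring|rewrite IH; ring]. }
    induction M as [|M IH]; [simpl; lra|].
    replace (N + S M)%nat with (S (N + M)) by lia. simpl sum_f_R0.
    replace (N + S M)%nat with (S (N + M)) by lia. lra.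
Qed.

(** Summing the rows, the off-diagonal terms give at most [(3 + 3c)] times the sum plus the end
    value [A (S N)]; the assumption [4 + 3c <= D] leaves one copy of the sum on the left. *)
Lemma diagonal_dominance (A f : nat -> R) (D c : R) (N : nat) :
  (forall n, 0 <= A n) -> A 0%nat = 0 -> 4 + 3 * c <= D -> 0 <= c ->
  (forall n, (n < N)%nat -> D * A (S n) <= 3 * f n + 3 * A (S (S n)) + 3 * c * A n) ->
  rsum N (fun n => A (S n)) <= 3 * rsum N f + 3 * A (S N).
Proof.
  intros HA A0 HD Hc H.
  assert (K : forall m, (m <= N)%nat ->
    D * rsum m (fun n => A (S n)) <= 3 * rsum m f
      + 3 * (rsum m (fun n => A (S n)) + A (S m) - A 1%nat)
      + 3 * c * (rsum m (fun n => A (S n)) - A m)).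
  { induction m as [|m IH]; intros Hm; simpl; [rewrite A0; lra|].
    specialize (IH ltac:(lia)). specialize (H m ltac:(lia)). lra. }
  specialize (K N ltac:(lia)).
  pose proof (HA 1%nat). pose proof (rsum_nonneg N (fun n => A (S n)) (fun n => HA (S n))) as HS.
  assert (0 <= 3 * c * A N) by (apply Rmult_le_pos; [lra|apply HA]).
  assert ((4 + 3 * c) * rsum N (fun n => A (S n)) <= D * rsum N (fun n => A (S n)))
    by (apply Rmult_le_compat_r; lra).
  lra.
Qed.

(** The diagonal entry is [lam + 2t + s], of modulus at least [lam - M1] because [Re s >= -M1]; the
    other terms are moved to the right. *)
Lemma row_bound (s a0 a1 a2 F : cplx) (lam t k M1 c : R) :
  Rabs (Re s) <= M1 -> 0 < t -> M1 <= lam -> k ^ 2 <= c ->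
  F = cadd (eqn s t k 1 a0 a1 a2) (cscal lam a1) ->
  (lam - M1) ^ 2 * cnorm2 a1 <= 3 * cnorm2 F + 3 * cnorm2 a2 + 3 * c * cnorm2 a0.
Proof.
  intros Hr Ht Hl Hk EF.
  assert (E : cmul (lam + 2 * t + Re s, Im s) a1
    = (fst F - fst a2 - k * fst a0, snd F - snd a2 - k * snd a0)).
  { rewrite EF. unfold cmul, cadd, eqn, cscal, Re, Im; cbn [fst snd]. f_equal; ring. }
  apply (f_equal cnorm2) in E. rewrite cnorm2_cmul in E.
  assert (K1 : (lam - M1) ^ 2 * cnorm2 a1 <= cnorm2 (lam + 2 * t + Re s, Im s) * cnorm2 a1).
  { apply Rmult_le_compat_r; [apply cnorm2_nonneg|]. unfold cnorm2; cbn [fst snd].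
    apply Rabs_le_between in Hr. pose proof (pow2_ge_0 (Im s)).
    assert ((lam - M1) ^ 2 <= (lam + 2 * t + Re s) ^ 2) by (apply pow_incr; lra). lra. }
  assert (K2 : k ^ 2 * cnorm2 a0 <= c * cnorm2 a0) by (apply Rmult_le_compat_r; [apply cnorm2_nonneg|exact Hk]).
  rewrite E in K1. apply Rle_trans with (1 := K1).
  apply Rle_trans with (3 * cnorm2 F + 3 * cnorm2 a2 + 3 * (k ^ 2 * cnorm2 a0)); [|lra].
  assert (Y : forall x y z, (x - y - z) ^ 2 <= 3 * x ^ 2 + 3 * y ^ 2 + 3 * z ^ 2).
  { intros x y z. pose proof (pow2_ge_0 (x + y)); pose proof (pow2_ge_0 (x + z)).
    pose proof (pow2_ge_0 (y - z)). lra. }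
  unfold cnorm2; cbn [fst snd].
  pose proof (Y (fst F) (fst a2) (k * fst a0)); pose proof (Y (snd F) (snd a2) (k * snd a0)). lra.
Qed.

Lemma kn_sq_le (N n : nat) : (n < N)%nat -> kn N n ^ 2 <= (INR N * (INR N + 1)) ^ 2.
Proof.
  intros H. apply lt_INR in H. pose proof (pos_INR n). unfold kn.
  assert (0 <= INR n * (INR n + 1) <= INR N * (INR N + 1)) by (split; nra). nra.
Qed.

Lemma XT_le_sup (sigma : R) (U : tower) (n : nat) (B : R) : 0 < sigma -> is_tower U ->
  (forall x, Icl x -> cnorm2 (U (S n) x) <= B) ->
  XT sigma U n <= (wcoef sigma n * (1 + INR n / sigma + (INR n / sigma) ^ 2) + sigma * wcoef sigma n) * B.
Proof.
  intros Hs HU Sn. unfold XT. pose proof (tower_cont_cnorm2 U (S n) HU). pose proof (wcoef_pos sigma n Hs) as Hw.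
  pose proof (pos_INR n) as In.
  assert (In' : 0 <= INR n / sigma) by (apply Rdiv_le_0_compat; lra).
  assert (RI : RInt (fun x => (1 + INR n * x / sigma + (INR n * x / sigma) ^ 2) * cnorm2 (U (S n) x)) 0 1
    <= (1 + INR n / sigma + (INR n / sigma) ^ 2) * B).
  { rewrite <- (RInt_const_01 ((1 + INR n / sigma + (INR n / sigma) ^ 2) * B)).
    apply RInt_le_contI; [contI_tac..|]. intros x Ix.
    pose proof (xi_nonneg sigma Hs n x Ix) as Y.
    assert (Y1 : INR n * x / sigma <= INR n / sigma).
    { replace (INR n * x / sigma) with (INR n / sigma * x) by (unfold Rdiv; ring).
      rewrite <- (Rmult_1_r (INR n / sigma)) at 2. apply Rmult_le_compat_l; [lra|apply Ix]. }
    assert ((INR n * x / sigma) ^ 2 <= (INR n / sigma) ^ 2) by (apply pow_incr; lra).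
    apply Rmult_le_compat; [pose proof (pow2_ge_0 (INR n * x / sigma)); lra|apply cnorm2_nonneg|lra|now apply Sn]. }
  apply Rmult_le_compat_l with (r := wcoef sigma n) in RI; [|lra].
  pose proof (Sn 0 Icl_0) as S0.
  apply Rmult_le_compat_l with (r := sigma * wcoef sigma n) in S0; [|nonneg]. lra.
Qed.

(** Membership in X is also a conclusion: for [d <= Re s] it follows from smoothness alone, which is
    what turns the explicit base solution into an element of X. *)
Lemma apriori (sigma d M1 lam : R) (N : nat) :
  0 < sigma -> 0 < d <= sigma -> 0 <= M1 -> 2 * sigma + M1 <= d * (INR N + 1) ->
  M1 <= lam -> 4 + 3 * (INR N * (INR N + 1)) ^ 2 <= (lam - M1) ^ 2 ->
  exists C, 0 <= C /\ forall s U F, good sigma d M1 s -> is_tower U -> U 0%nat 1 = c0 ->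
    (inX sigma U \/ d <= Re s) -> inY sigma F -> solves N lam s U F ->
    inX sigma U /\ XS sigma U <= C * YS sigma F.
Proof.
  intros Hs Hd HM1 HN Hl HL.
  set (Ch := 4 / d * (6 / d + sigma / d ^ 2) + / d ^ 2).
  set (cS := fun n => 3 / wcoef sigma n + 2 / wcoef sigma (S n)).
  set (cX := fun n => wcoef sigma n * (1 + INR n / sigma + (INR n / sigma) ^ 2) + sigma * wcoef sigma n).
  set (C1 := 3 * rsum N cS + 3 * (cS N * Ch)).
  assert (HCh : 0 <= Ch).
  { assert (0 < / d) by (apply Rinv_0_lt_compat; lra).
    assert (0 < / d ^ 2) by (apply Rinv_0_lt_compat, pow_lt; lra). unfold Ch, Rdiv. nonneg.
    apply Rplus_le_le_0_compat; [|lra]. nonneg. apply Rplus_le_le_0_compat; nonneg. }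
  assert (HcS : forall n, 0 <= cS n).
  { intros n. assert (0 < / wcoef sigma n) by now apply Rinv_0_lt_compat, wcoef_pos.
    assert (0 < / wcoef sigma (S n)) by now apply Rinv_0_lt_compat, wcoef_pos. unfold cS, Rdiv. lra. }
  assert (HcX : forall n, 0 <= cX n).
  { intros n. unfold cX. pose proof (wcoef_pos sigma n Hs). pose proof (pos_INR n).
    assert (0 <= INR n / sigma) by (apply Rdiv_le_0_compat; lra).
    apply Rplus_le_le_0_compat; [|nonneg]. apply Rmult_le_pos; [lra|].
    pose proof (pow2_ge_0 (INR n / sigma)). lra. }
  pose proof (rsum_nonneg N cS HcS) as HrS. pose proof (rsum_nonneg N cX HcX) as HrX.
  assert (HcSN : 0 <= cS N * Ch) by (apply Rmult_le_pos; [apply HcS|exact HCh]).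
  assert (HC1 : 0 <= C1) by (unfold C1; lra).
  exists (rsum N cX * (6 ^ N * C1) + Ch).
  assert (H6 : 0 <= rsum N cX * (6 ^ N * C1)).
  { apply Rmult_le_pos; [exact HrX|apply Rmult_le_pos; [apply pow_le; lra|exact HC1]]. }
  split; [lra|]. intros s U F G HU U1 HX HF HE.
  pose proof HF as HF'. apply (inY_iff sigma Hs) in HF' as [TF CF].
  set (Y0 := YS sigma F).
  assert (HY : 0 <= Y0) by (apply Series_nonneg; [intros; now apply YT_nonneg|exact CF]).
  assert (Hhi : high_eqs N s U F) by (intros n x Hn Ix; now apply (solves_high N lam)).
  pose proof (high_bound sigma d M1 N Hs Hd HM1 HN s U F G HU HX HF Hhi) as HB. fold Ch Y0 in HB.
  assert (HXn : forall n, 0 <= XT sigma U n) by (intros; now apply XT_nonneg).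
  assert (HXT : forall j, XT sigma U (N + j) <= Ch * Y0).
  { intros j. apply Rle_trans with (2 := HB j).
    apply (term_le_sum (fun j => XT sigma U (N + j))); [intros; apply HXn|lia]. }
  assert (SupN : forall x, Icl x -> cnorm2 (U (S N) x) <= cS N * (Ch * Y0)).
  { intros x Ix. apply sup_le_XT; auto.
    - pose proof (HXT 0%nat) as K. now rewrite Nat.add_0_r in K.
    - pose proof (HXT 1%nat) as K. now rewrite Nat.add_1_r in K. }
  set (A := fun n => cnorm2 (U n 1)).
  assert (HA0 : A 0%nat = 0) by (unfold A; rewrite U1; unfold cnorm2, c0; simpl; ring).
  assert (HAn : forall n, 0 <= A n) by (intros; apply cnorm2_nonneg).
  pose proof G as [Gr _].
  pose proof (diagonal_dominance A (fun n => cnorm2 (F n 1)) ((lam - M1) ^ 2) ((INR N * (INR N + 1)) ^ 2) N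
    HAn HA0 HL (pow2_ge_0 _)) as DD.
  assert (HS : rsum N (fun n => A (S n)) <= C1 * Y0).
  { apply Rle_trans with (1 := DD (fun n Hn => row_bound s (U n 1) (U (S n) 1) (U (S (S n)) 1) (F n 1)
      lam (INR n + 1) (kn N n) M1 _ Gr (Rle_lt_0_plus_1 _ (pos_INR n)) Hl (kn_sq_le N n Hn)
      (solves_at_1 N lam s U F n HU TF HE Hn))).
    assert (rsum N (fun n => cnorm2 (F n 1)) <= rsum N cS * Y0).
    { rewrite <- rsum_scal. apply rsum_le. intros n _. apply sup_le_normY; auto using Icl_1. }
    pose proof (SupN 1 Icl_1). unfold A, C1. lra. }
  assert (HAb : forall n, (n <= S N)%nat -> A n <= C1 * Y0).
  { intros n Hn. assert (0 <= C1 * Y0) by now apply Rmult_le_pos. destruct n as [|n]; [lra|].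
    destruct (Nat.eq_dec n N) as [->|Hne].
    - pose proof (SupN 1 Icl_1) as K. fold (A (S N)) in K.
      assert (0 <= rsum N cS * Y0) by now apply Rmult_le_pos.
      assert (0 <= cS N * Ch * Y0) by now apply Rmult_le_pos. unfold C1. lra.
    - apply Rle_trans with (2 := HS). apply (rsum_term N n (fun n => A (S n))); [auto|lia]. }
  (* Descending one derivative costs the factor [6 = 2 + 4]: in [tower_sup_from_1] both the value at
     1 and the supremum of the next derivative are bounded by the previous quantity. *)
  assert (Sup : forall j, (j <= S N)%nat -> forall x, Icl x ->
    cnorm2 (U (S N - j)%nat x) <= 6 ^ j * (C1 * Y0)).
  { assert (HCY : 0 <= C1 * Y0) by now apply Rmult_le_pos.
    induction j as [|j IH]; intros Hj x Ix.
    - rewrite Nat.sub_0_r, pow_O. pose proof (SupN x Ix) as K.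
      assert (0 <= rsum N cS * Y0) by now apply Rmult_le_pos.
      assert (0 <= cS N * Ch * Y0) by now apply Rmult_le_pos. unfold C1. lra.
    - assert (H6j : 0 <= 6 ^ j * (C1 * Y0)) by (apply Rmult_le_pos; [apply pow_le; lra|exact HCY]).
      assert (H61 : 1 * (C1 * Y0) <= 6 ^ j * (C1 * Y0))
        by (apply Rmult_le_compat_r; [exact HCY|apply pow_R1_Rle; lra]).
      pose proof (tower_sup_from_1 U (S N - S j) (6 ^ j * (C1 * Y0)) HU H6j) as K.
      replace (S (S N - S j)) with (S N - j)%nat in K by lia.
      specialize (K (IH ltac:(lia)) x Ix). pose proof (HAb (S N - S j)%nat ltac:(lia)) as K2.
      unfold A in K2. simpl pow. lra. }
  assert (Low : forall n, (n < N)%nat -> XT sigma U n <= cX n * (6 ^ N * C1 * Y0)).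
  { intros n Hn. assert (HCY : 0 <= C1 * Y0) by now apply Rmult_le_pos.
    assert (Sn : forall x, Icl x -> cnorm2 (U (S n) x) <= 6 ^ N * C1 * Y0).
    { intros x Ix. pose proof (Sup (N - n)%nat ltac:(lia) x Ix) as K.
      replace (S N - (N - n))%nat with (S n) in K by lia.
      apply Rle_trans with (1 := K). rewrite Rmult_assoc. apply Rmult_le_compat_r; [exact HCY|].
      apply Rle_pow; [lra|lia]. }
    now apply XT_le_sup. }
  destruct (converges_bounded (XT sigma U) ((rsum N cX * (6 ^ N * C1) + Ch) * Y0) HXn) as [Cv Le].
  { intros M. apply Rle_trans with (1 := sum_split_le _ N M HXn). specialize (HB M).
    pose proof (rsum_le N _ _ Low) as K. rewrite rsum_scal in K. lra. }
  split; [apply (inX_iff sigma Hs); auto|exact Le].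
Qed.

(** * Solving the equation for one large real parameter *)

(** The rate 1/2 is what is left of [exp(- S0 t)], [S0 >= 1], after half of it has absorbed a power
    of [t]. *)
Definition decaying (f : R -> R) (B : R) : Prop :=
  0 <= B /\ (forall t, 0 <= t -> continuous f t) /\
  (forall t, 0 <= t -> Rabs (f t) <= B * exp (- t / 2)).

Definition LI (f : R -> R) : R := real (Lim_seq (fun k => RInt f 0 (INR k))).

Lemma RInt_exp_half (B : R) (k : nat) :
  is_RInt (fun t => B * exp (- t / 2)) 0 (INR k) (2 * B * (1 - exp (- INR k / 2))).
Proof.
  replace (2 * B * (1 - exp (- INR k / 2)))
    with (minus (- 2 * B * exp (- INR k / 2)) (- 2 * B * exp (- 0 / 2))).
  2:{ unfold minus, plus, opp; simpl. replace (- 0 / 2) with 0 by lra. rewrite exp_0. ring. }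
  apply (is_RInt_derive (fun t => - 2 * B * exp (- t / 2)) (fun t => B * exp (- t / 2))).
  - intros t _. auto_derive; [exact I|]. unfold Rdiv; field.
  - intros t _. apply (ex_derive_continuous (V := R_NormedModule)). auto_derive; exact I.
Qed.

Lemma ex_RInt_decaying (f : R -> R) (B a b : R) : decaying f B -> 0 <= a -> 0 <= b -> ex_RInt f a b.
Proof.
  intros [_ [C _]] Ha Hb. apply (ex_RInt_continuous (V := R_CompleteNormedModule)).
  intros z Hz. apply C. unfold Rmin in Hz; destruct Rle_dec; lra.
Qed.

Lemma decaying_partial (f : R -> R) (B : R) (k : nat) : decaying f B ->
  Rabs (RInt f 0 (INR k)) <= 2 * B.
Proof.
  intros H. pose proof (pos_INR k) as Hk. pose proof H as [HB [C K]].
  pose proof (ex_RInt_decaying f B 0 (INR k) H ltac:(lra) Hk) as Ex.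
  pose proof (RInt_exp_half B k) as IE.
  pose proof (exp_pos (- INR k / 2)) as He.
  assert (U : RInt f 0 (INR k) <= 2 * B * (1 - exp (- INR k / 2))).
  { apply (is_RInt_le f (fun t => B * exp (- t / 2)) 0 (INR k)); [exact Hk| |exact IE|].
    - apply (RInt_correct (V := R_CompleteNormedModule)), Ex.
    - intros t Ht. pose proof (K t ltac:(lra)) as Kt. apply Rabs_le_between in Kt. lra. }
  assert (L : - (2 * B * (1 - exp (- INR k / 2))) <= RInt f 0 (INR k)).
  { apply (is_RInt_le (fun t => - (B * exp (- t / 2))) f 0 (INR k)); [exact Hk| | |].
    - apply (is_RInt_opp (V := R_NormedModule)), IE.
    - apply (RInt_correct (V := R_CompleteNormedModule)), Ex.
    - intros t Ht. pose proof (K t ltac:(lra)) as Kt. apply Rabs_le_between in Kt. lra. }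
  apply Rabs_le. assert (0 <= B * exp (- INR k / 2)) by nra. lra.
Qed.

Lemma is_lim_seq_exp_half : is_lim_seq (fun k => exp (- INR k / 2)) 0.
Proof.
  apply (is_lim_comp_seq exp _ m_infty 0); [apply is_lim_exp_m| |].
  - exists 0%nat. intros; discriminate.
  - apply (is_lim_seq_ext (fun k => - / 2 * INR k)); [intros; field|].
    evar_last; [apply is_lim_seq_scal_l, is_lim_seq_INR|].
    simpl. destruct (Rle_dec 0 (- / 2)) as [r|r]; [exfalso; lra|reflexivity].
Qed.

(** Adding the envelope [B exp(-t/2)] makes the integrand nonnegative, so the partial integrals
    increase and are bounded; the integral of the envelope is explicit and is subtracted again. *)
Lemma LI_cv (f : R -> R) (B : R) : decaying f B ->
  is_lim_seq (fun k => RInt f 0 (INR k)) (LI f).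
Proof.
  intros H. pose proof H as [HB [C K]].
  set (g := fun t => f t + B * exp (- t / 2)).
  assert (Ce : forall t, continuous (fun t => B * exp (- t / 2)) t).
  { intros t. apply (ex_derive_continuous (V := R_NormedModule)). auto_derive; exact I. }
  assert (Hg : decaying g (2 * B)).
  { split; [lra|split].
    - intros t Ht. apply (continuous_plus (V := R_NormedModule)); [now apply C|apply Ce].
    - intros t Ht. specialize (K t Ht). apply Rabs_le_between in K.
      pose proof (exp_pos (- t / 2)). unfold g. apply Rabs_le. nra. }
  assert (Hg0 : forall t, 0 <= t -> 0 <= g t).
  { intros t Ht. specialize (K t Ht). apply Rabs_le_between in K. unfold g. lra. }
  assert (X : ex_finite_lim_seq (fun k => RInt g 0 (INR k))).
  { apply (ex_finite_lim_seq_incr _ (2 * (2 * B))).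
    - intros k. pose proof (pos_INR k) as Hk. pose proof (pos_INR (S k)) as Hk'.
      rewrite <- (RInt_Chasles_R g 0 (INR k) (INR (S k))) by (eapply ex_RInt_decaying; eauto; lra).
      assert (0 <= RInt g (INR k) (INR (S k))); [|lra].
      rewrite S_INR. apply RInt_ge_0; [lra| |].
      + eapply ex_RInt_decaying; eauto; lra.
      + intros t Ht. apply Hg0. lra.
    - intros k. pose proof (decaying_partial g _ k Hg) as P. apply Rabs_le_between in P. lra. }
  assert (Y : is_lim_seq (fun k => 2 * B * (1 - exp (- INR k / 2))) (2 * B * (1 - 0))).
  { apply (is_lim_seq_scal_l _ (2 * B) (1 - 0)). apply is_lim_seq_minus'; [apply is_lim_seq_const|].
    exact is_lim_seq_exp_half. }
  destruct X as [l Hl].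
  assert (Z : is_lim_seq (fun k => RInt f 0 (INR k)) (l - 2 * B * (1 - 0))).
  { apply (is_lim_seq_ext (fun k => RInt g 0 (INR k) - 2 * B * (1 - exp (- INR k / 2)))).
    - intros k. pose proof (pos_INR k) as Hk.
      assert (E : RInt g 0 (INR k) = RInt f 0 (INR k) + RInt (fun t => B * exp (- t / 2)) 0 (INR k)).
      { apply (RInt_plus (V := R_CompleteNormedModule)).
        - eapply ex_RInt_decaying; eauto; lra.
        - eexists; apply RInt_exp_half. }
      rewrite E, (is_RInt_unique _ _ _ _ (RInt_exp_half B k)). simpl. ring.
    - now apply is_lim_seq_minus'. }
  unfold LI. rewrite (is_lim_seq_unique _ _ Z). exact Z.
Qed.

Lemma LI_bound (f : R -> R) (B : R) : decaying f B -> Rabs (LI f) <= 2 * B.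
Proof.
  intros H. pose proof (LI_cv f B H) as L.
  pose proof (is_lim_seq_abs _ _ L) as L'. simpl in L'.
  exact (is_lim_seq_le _ (fun _ => 2 * B) _ _ (fun k => decaying_partial f B k H) L' (is_lim_seq_const _)).
Qed.

Lemma decaying_lin (f g : R -> R) (a b B B' : R) : decaying f B -> decaying g B' ->
  decaying (fun t => a * f t + b * g t) (Rabs a * B + Rabs b * B').
Proof.
  intros [HB [C K]] [HB' [C' K']]. split; [|split].
  - pose proof (Rabs_pos a); pose proof (Rabs_pos b). nra.
  - intros t Ht. apply (continuous_plus (V := R_NormedModule)).
    + apply (continuous_scal_r (V := R_NormedModule)), C, Ht.
    + apply (continuous_scal_r (V := R_NormedModule)), C', Ht.
  - intros t Ht. apply Rle_trans with (1 := Rabs_triang _ _). rewrite !Rabs_mult.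
    specialize (K t Ht). specialize (K' t Ht).
    apply Rmult_le_compat_l with (r := Rabs a) in K; [|apply Rabs_pos].
    apply Rmult_le_compat_l with (r := Rabs b) in K'; [|apply Rabs_pos]. lra.
Qed.

Lemma LI_lin (f g : R -> R) (a b B B' : R) : decaying f B -> decaying g B' ->
  LI (fun t => a * f t + b * g t) = a * LI f + b * LI g.
Proof.
  intros H H'. pose proof (LI_cv _ _ (decaying_lin f g a b B B' H H')) as L.
  pose proof (LI_cv f B H) as L1. pose proof (LI_cv g B' H') as L2.
  apply (is_lim_seq_scal_l _ a) in L1. apply (is_lim_seq_scal_l _ b) in L2. simpl in L1, L2.
  pose proof (is_lim_seq_plus' _ _ _ _ L1 L2) as L3.
  apply (is_lim_seq_ext _ (fun k => RInt (fun t => a * f t + b * g t) 0 (INR k))) in L3.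
  - apply is_lim_seq_unique in L. apply is_lim_seq_unique in L3. rewrite L in L3. now injection L3.
  - intros k. pose proof (pos_INR k) as Hk.
    pose proof (ex_RInt_decaying f B 0 (INR k) H ltac:(lra) Hk) as E1.
    pose proof (ex_RInt_decaying g B' 0 (INR k) H' ltac:(lra) Hk) as E2.
    symmetry. transitivity (RInt (fun t => a * f t) 0 (INR k) + RInt (fun t => b * g t) 0 (INR k)).
    + apply (RInt_plus (V := R_CompleteNormedModule)).
      * exact (ex_RInt_scal (V := R_NormedModule) _ _ _ a E1).
      * exact (ex_RInt_scal (V := R_NormedModule) _ _ _ b E2).
    + f_equal; apply (RInt_scal (V := R_CompleteNormedModule)); assumption.
Qed.

Lemma LI_ext (f g : R -> R) : (forall t, 0 <= t -> f t = g t) -> LI f = LI g.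
Proof.
  intros E. unfold LI. f_equal. apply Lim_seq_ext. intros k. pose proof (pos_INR k).
  apply RInt_ext. intros t Ht. apply E. unfold Rmin in Ht; destruct Rle_dec; lra.
Qed.

Lemma LI_ftc (f phi : R -> R) (B B' : R) : decaying f B ->
  (forall t, 0 <= t -> is_derive phi t (f t)) ->
  (forall t, 0 <= t -> Rabs (phi t) <= B' * exp (- t / 2)) -> LI f = - phi 0.
Proof.
  intros H D K. pose proof (LI_cv f B H) as L.
  assert (P : is_lim_seq (fun k => phi (INR k)) 0).
  { apply is_lim_seq_abs_0.
    apply (is_lim_seq_le_le (fun _ => 0) _ (fun k => B' * exp (- INR k / 2))).
    - intros k; split; [apply Rabs_pos|apply K, pos_INR].
    - apply is_lim_seq_const.
    - replace (Finite 0) with (Rbar_mult B' 0) by (simpl; f_equal; ring).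
      apply is_lim_seq_scal_l, is_lim_seq_exp_half. }
  pose proof (is_lim_seq_minus' _ _ _ _ P (is_lim_seq_const (phi 0))) as M.
  apply (is_lim_seq_ext _ (fun k => RInt f 0 (INR k))) in M.
  - apply is_lim_seq_unique in L. apply is_lim_seq_unique in M. rewrite L in M. injection M. lra.
  - intros k. pose proof (pos_INR k). symmetry. apply is_RInt_unique.
    apply (is_RInt_derive phi f).
    + intros t Ht. apply D. unfold Rmin in Ht; destruct Rle_dec; lra.
    + intros t Ht. apply H. unfold Rmin in Ht; destruct Rle_dec; lra.
Qed.

(** * The Laplace integral along the flow of [- x^2 d/dx] *)

Lemma exp_nat_mul (y : R) (n : nat) : exp y ^ n = exp (INR n * y).
Proof.
  induction n as [|n IH]; [simpl; now rewrite Rmult_0_l, exp_0|].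
  rewrite <- tech_pow_Rmult, IH, S_INR, <- exp_plus. f_equal; ring.
Qed.

Lemma pow_le_exp (i : nat) : exists K, 0 <= K /\ forall t, 0 <= t -> t ^ i <= K * exp (t / 2).
Proof.
  exists ((2 * INR (S i)) ^ i). pose proof (lt_0_INR (S i) ltac:(lia)) as Hi.
  split; [apply pow_le; lra|]. intros t Ht.
  (* Dividing by [2(i+1)] rather than [2i] also covers [i = 0]: then
     [y^i <= (exp y)^(i+1) = exp(t/2)]. *)
  set (y := t / (2 * INR (S i))).
  assert (Hy : 0 <= y) by (apply Rdiv_le_0_compat; lra).
  replace (t ^ i) with ((2 * INR (S i)) ^ i * y ^ i)
    by (rewrite <- Rpow_mult_distr; f_equal; unfold y; field; lra).
  apply Rmult_le_compat_l; [apply pow_le; lra|].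
  apply Rle_trans with (exp y ^ i).
  - apply pow_incr. pose proof (exp_ineq1_le y). lra.
  - apply Rle_trans with (exp y ^ S i).
    + apply Rle_pow; [|lia]. pose proof (exp_ineq1_le y). lra.
    + rewrite exp_nat_mul. right. f_equal. unfold y. field. lra.
Qed.

(* [mob t i c h] is, up to the factor [t ^ i], the weight-[c] action on [h] of the flow
   [x |-> x / (1 + x t)] of the vector field [- x^2 d/dx]. *)
Definition mob (t : R) (i c : nat) (h : R -> R) (x : R) : R :=
  t ^ i / (1 + x * t) ^ c * h (x / (1 + x * t)).

Lemma mob_arg (t x : R) : 0 <= t -> Icl x -> 1 <= 1 + x * t /\ Icl (x / (1 + x * t)).
Proof.
  intros Ht [H0 H1]. assert (0 <= x * t) by now apply Rmult_le_pos.
  split; [lra|]. split.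
  - apply Rdiv_le_0_compat; lra.
  - apply div_le_1; lra.
Qed.

Lemma mob_arg_interior (t x : R) : 0 <= t -> 0 < x < 1 -> 0 < x / (1 + x * t) < 1.
Proof.
  intros Ht Hx. assert (0 <= x * t) by (apply Rmult_le_pos; lra). split.
  - apply Rdiv_lt_0_compat; lra.
  - apply Rmult_lt_reg_r with (1 + x * t); [lra|]. unfold Rdiv. rewrite Rmult_assoc, Rinv_l; lra.
Qed.

Lemma mob_cont_x (t : R) (i c : nat) (h : R -> R) : 0 <= t -> (forall y, continuous h y) ->
  contI (mob t i c h).
Proof.
  intros Ht Hh x. pose proof (mob_arg t (clamp x) Ht (clamp_Icl x)) as [H1 _].
  apply (continuous_comp clamp (mob t i c h)); [apply continuous_clamp|].
  unfold mob. apply (continuous_mult (K := R_AbsRing)).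
  - apply (ex_derive_continuous (V := R_NormedModule)). auto_derive. apply pow_nonzero; lra.
  - apply (continuous_comp (fun x => x / (1 + x * t)) h); [|apply Hh].
    apply (ex_derive_continuous (V := R_NormedModule)). auto_derive. lra.
Qed.

(** The chain rule for [x / (1 + x t)] produces [(1 + x t)^(-2)], hence weight [c + 2] on [h'];
    differentiating the prefactor raises both [i] and [c]. The family is thus closed under
    differentiation in [x]. *)
Lemma mob_dI (t : R) (i c : nat) (h h' : R -> R) : 0 <= t ->
  (forall y, continuous h y) -> (forall y, continuous h' y) -> dI h h' ->
  dI (mob t i c h) (fun x => - INR c * mob t (S i) (S c) h x + mob t i (c + 2) h' x).
Proof.
  intros Ht Ch Ch' [_ [_ D]]. split; [|split].
  - now apply mob_cont_x.
  - pose proof (mob_cont_x t (S i) (S c) h Ht Ch). pose proof (mob_cont_x t i (c + 2) h' Ht Ch').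
    contI_tac.
  - intros x Hx. pose proof (mob_arg t x Ht ltac:(unfold Icl; lra)) as [H1 _].
    pose proof (D _ (mob_arg_interior t x Ht Hx)) as Dh.
    assert (D1 : is_derive (fun x => x / (1 + x * t)) x (/ (1 + x * t) ^ 2)).
    { auto_derive; [lra|]. field. lra. }
    pose proof (is_derive_comp h (fun x => x / (1 + x * t)) x _ _ Dh D1) as D2.
    assert (D3 : is_derive (fun x => t ^ i / (1 + x * t) ^ c) x (- INR c * (t ^ S i / (1 + x * t) ^ S c))).
    { destruct c as [|c].
      - simpl. apply (is_derive_ext (fun _ => t ^ i / 1)); [reflexivity|].
        replace (-0 * (t * t ^ i / ((1 + x * t) * 1))) with 0 by ring.
        exact (is_derive_const (V := R_NormedModule) _ x).
      - auto_derive; [apply (pow_nonzero (1 + x * t) (S c)); lra|].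
        replace (match c with 0%nat => 1 | S _ => INR c + 1 end) with (INR (S c)) by reflexivity.
        simpl pow. field; repeat split; try lra; apply pow_nonzero; lra. }
    pose proof (is_derive_mult _ _ x _ _ D3 D2 Rmult_comm) as D4.
    unfold mob. eapply eq_rect; [exact D4|].
    unfold plus, mult, scal; simpl; unfold mult; simpl.
    rewrite pow_add. simpl pow. field; repeat split; try lra; apply pow_nonzero; lra.
Qed.

Lemma mob_bound (t : R) (i c : nat) (h : R -> R) (B : R) : 0 <= t ->
  (forall x, Icl x -> Rabs (h x) <= B) -> forall x, Icl x -> Rabs (mob t i c h x) <= t ^ i * B.
Proof.
  intros Ht HB x Ix. destruct (mob_arg t x Ht Ix) as [H1 H2]. unfold mob.
  rewrite Rabs_mult. pose proof (pow_le t i Ht) as Hp. pose proof (pow_R1_Rle _ c H1) as H3.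
  apply Rmult_le_compat; try apply Rabs_pos; [|now apply HB].
  rewrite (Rabs_pos_eq (t ^ i / (1 + x * t) ^ c))
    by (apply Rmult_le_pos; [exact Hp|left; apply Rinv_0_lt_compat; lra]).
  unfold Rdiv. rewrite <- (Rmult_1_r (t ^ i)) at 2. apply Rmult_le_compat_l; [exact Hp|].
  rewrite <- Rinv_1 at 2. apply Rinv_le_contravar; lra.
Qed.

Lemma mob_cont_t (x : R) (i c : nat) (h : R -> R) (t : R) : 0 <= t -> Icl x ->
  (forall y, continuous h y) -> continuous (fun t => mob t i c h x) t.
Proof.
  intros Ht Ix Hh. pose proof (mob_arg t x Ht Ix) as [H1 _]. unfold mob.
  apply (continuous_mult (K := R_AbsRing)).
  - apply (ex_derive_continuous (V := R_NormedModule)). auto_derive. apply pow_nonzero; lra.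
  - apply (continuous_comp (fun t => x / (1 + x * t)) h); [|apply Hh].
    apply (ex_derive_continuous (V := R_NormedModule)). auto_derive. lra.
Qed.

Section Laplace.
Variable S0 : R.
Hypothesis HS0 : 1 <= S0.

Lemma exp_S0_bound (t : R) : 0 <= t -> exp (- S0 * t) * exp (t / 2) <= exp (- t / 2).
Proof.
  intros Ht. rewrite <- exp_plus.
  destruct (Req_dec (- S0 * t + t / 2) (- t / 2)) as [->|Hne]; [lra|].
  left. apply exp_increasing. nra.
Qed.

Lemma decaying_poly (f : R -> R) (i : nat) (B : R) : 0 <= B ->
  (forall t, 0 <= t -> continuous f t) -> (forall t, 0 <= t -> Rabs (f t) <= t ^ i * B) ->
  forall K, 0 <= K -> (forall t, 0 <= t -> t ^ i <= K * exp (t / 2)) ->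
  decaying (fun t => exp (- S0 * t) * f t) (K * B).
Proof.
  intros HB C H K HK HKt. split; [nra|split].
  - intros t Ht. apply (continuous_mult (K := R_AbsRing)); [|now apply C].
    apply (ex_derive_continuous (V := R_NormedModule)). auto_derive; exact I.
  - intros t Ht. rewrite Rabs_mult, (Rabs_pos_eq (exp _)) by (left; apply exp_pos).
    pose proof (exp_pos (- S0 * t)) as E0. pose proof (exp_S0_bound t Ht) as E1.
    specialize (H t Ht). specialize (HKt t Ht).
    apply Rle_trans with (exp (- S0 * t) * (K * exp (t / 2) * B)).
    + apply Rmult_le_compat_l; [lra|]. apply Rle_trans with (1 := H). apply Rmult_le_compat_r; lra.
    + replace (exp (- S0 * t) * (K * exp (t / 2) * B)) with (K * B * (exp (- S0 * t) * exp (t / 2))) by ring.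
      apply Rmult_le_compat_l; nra.
Qed.

Definition lap (i c : nat) (h : R -> R) (x : R) : R :=
  LI (fun t => exp (- S0 * t) * mob t i c h x).

Lemma decaying_mob (i c : nat) (h : R -> R) : (forall y, continuous h y) -> contI h ->
  exists B, forall x, Icl x -> decaying (fun t => exp (- S0 * t) * mob t i c h x) B.
Proof.
  intros Ch Ci. destruct (contI_bounded h Ci) as [B [HB Hh]].
  destruct (pow_le_exp i) as [K [HK HKt]]. exists (K * B). intros x Ix.
  apply (decaying_poly _ i B); auto.
  - intros t Ht. now apply mob_cont_t.
  - intros t Ht. now apply mob_bound.
Qed.

(** Differentiation under the integral sign: the Taylor remainder of the integrand in [x] is
    [(y - x)^2] times an integrable function of [t], and a quadratic remainder survives
    integration. *)
Lemma lap_remainder (i c : nat) (h0 h1 h2 : R -> R) :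
  (forall y, continuous h0 y) -> (forall y, continuous h1 y) -> (forall y, continuous h2 y) ->
  dI h0 h1 -> dI h1 h2 ->
  exists B, forall x y, Icl x -> Icl y ->
    Rabs (lap i c h0 y - lap i c h0 x - (y - x) * (- INR c * lap (S i) (S c) h0 x + lap i (c + 2) h1 x))
    <= B * (y - x) ^ 2.
Proof.
  intros C0 C1 C2 D0 D1. pose proof D0 as [I0 [I1 _]]. pose proof D1 as [_ [I2 _]].
  destruct (contI_bounded h0 I0) as [B0 [HB0 Hh0]]. destruct (contI_bounded h1 I1) as [B1 [HB1 Hh1]].
  destruct (contI_bounded h2 I2) as [B2 [HB2 Hh2]].
  destruct (pow_le_exp i) as [K0 [HK0 HKt0]]. destruct (pow_le_exp (S i)) as [K1 [HK1 HKt1]].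
  destruct (pow_le_exp (S (S i))) as [K2 [HK2 HKt2]].
  destruct (decaying_mob i c h0 C0 I0) as [d0 Hd0]. destruct (decaying_mob (S i) (S c) h0 C0 I0) as [d1 Hd1].
  destruct (decaying_mob i (c + 2) h1 C1 I1) as [d2 Hd2].
  (* This bounds the second [x]-derivative of the integrand, obtained by applying the rule of
     [mob_dI] twice; [K0], [K1], [K2] trade the powers [t^i], [t^(i+1)], [t^(i+2)] for
     [exp(t/2)]. *)
  set (Bt := INR c * (INR (S c) * (K2 * B0) + K1 * B1) + (INR (c + 2) * (K1 * B1) + K0 * B2)).
  exists (2 * Bt). intros x y Ix Iy.
  set (rem := fun t => exp (- S0 * t) * (mob t i c h0 y - mob t i c h0 x
     - (y - x) * (- INR c * mob t (S i) (S c) h0 x + mob t i (c + 2) h1 x))).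
  assert (Ic : 0 <= INR c) by apply pos_INR. assert (ISc : 0 <= INR (S c)) by apply pos_INR.
  assert (Ic2 : 0 <= INR (c + 2)) by apply pos_INR.
  assert (Pos : 0 <= Bt).
  { unfold Bt. pose proof (Rmult_le_pos _ _ HK2 HB0). pose proof (Rmult_le_pos _ _ HK1 HB1).
    pose proof (Rmult_le_pos _ _ HK0 HB2).
    apply Rplus_le_le_0_compat; [apply Rmult_le_pos; [lra|]|];
      apply Rplus_le_le_0_compat; try lra; apply Rmult_le_pos; lra. }
  assert (E : lap i c h0 y - lap i c h0 x - (y - x) * (- INR c * lap (S i) (S c) h0 x + lap i (c + 2) h1 x) = LI rem).
  { pose proof (LI_lin _ _ 1 (-1) _ _ (Hd0 y Iy) (Hd0 x Ix)) as L1.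
    pose proof (LI_lin _ _ (- INR c) 1 _ _ (Hd1 x Ix) (Hd2 x Ix)) as L2.
    pose proof (LI_lin _ _ 1 (- (y - x)) _ _ (decaying_lin _ _ 1 (-1) _ _ (Hd0 y Iy) (Hd0 x Ix))
      (decaying_lin _ _ (- INR c) 1 _ _ (Hd1 x Ix) (Hd2 x Ix))) as L3.
    cbv beta in L1, L2, L3. rewrite L1, L2 in L3. unfold lap.
    transitivity (1 * (1 * LI (fun t : R => exp (- S0 * t) * mob t i c h0 y) +
      -1 * LI (fun t : R => exp (- S0 * t) * mob t i c h0 x)) + - (y - x) *
      (- INR c * LI (fun t : R => exp (- S0 * t) * mob t (S i) (S c) h0 x) +
       1 * LI (fun t : R => exp (- S0 * t) * mob t i (c + 2) h1 x))); [ring|].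
    rewrite <- L3. apply LI_ext. intros t _. unfold rem. ring. }
  rewrite E. replace (2 * Bt * (y - x) ^ 2) with (2 * (Bt * (y - x) ^ 2)) by ring.
  apply LI_bound. split; [apply Rmult_le_pos; [exact Pos|apply pow2_ge_0]|split].
  - intros t Ht. unfold rem. apply (continuous_mult (K := R_AbsRing)).
    { apply (ex_derive_continuous (V := R_NormedModule)). auto_derive; exact I. }
    apply (continuous_minus (V := R_NormedModule)).
    + apply (continuous_minus (V := R_NormedModule)); now apply mob_cont_t.
    + apply (continuous_scal_r (V := R_NormedModule) (y - x)).
      apply (continuous_plus (V := R_NormedModule)); [|now apply mob_cont_t].
      apply (continuous_scal_r (V := R_NormedModule) (- INR c)). now apply mob_cont_t.
  - intros t Ht. unfold rem. rewrite Rabs_mult, (Rabs_pos_eq (exp _)) by (left; apply exp_pos).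
    pose proof (mob_dI t i c h0 h1 Ht C0 C1 D0) as T0.
    pose proof (dI_plus (dI_scal (- INR c) (mob_dI t (S i) (S c) h0 h1 Ht C0 C1 D0))
      (mob_dI t i (c + 2) h1 h2 Ht C1 C2 D1)) as T1.
    set (e2 := Bt * exp (t / 2)).
    assert (Rm : Rabs (mob t i c h0 y - mob t i c h0 x
      - (y - x) * (- INR c * mob t (S i) (S c) h0 x + mob t i (c + 2) h1 x)) <= e2 * (y - x) ^ 2).
    { apply (taylor_remainder _ _ _ e2 T0 T1); auto. clear - HB0 HB1 HB2 Hh0 Hh1 Hh2 Ht HKt0 HKt1 HKt2 Ic ISc Ic2.
      intros x Ix.
      pose proof (mob_bound t (S (S i)) (S (S c)) h0 B0 Ht Hh0 x Ix) as b1.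
      pose proof (mob_bound t (S i) (S c + 2) h1 B1 Ht Hh1 x Ix) as b2.
      pose proof (mob_bound t (S i) (S (c + 2)) h1 B1 Ht Hh1 x Ix) as b3.
      pose proof (mob_bound t i (c + 2 + 2) h2 B2 Ht Hh2 x Ix) as b4.
      pose proof (Rmult_le_compat_r B0 _ _ HB0 (HKt2 t Ht)) as k2.
      pose proof (Rmult_le_compat_r B1 _ _ HB1 (HKt1 t Ht)) as k1.
      pose proof (Rmult_le_compat_r B2 _ _ HB2 (HKt0 t Ht)) as k0.
      set (m1 := mob t (S (S i)) (S (S c)) h0 x) in *. set (m2 := mob t (S i) (S c + 2) h1 x) in *.
      set (m3 := mob t (S i) (S (c + 2)) h1 x) in *. set (m4 := mob t i (c + 2 + 2) h2 x) in *.
      assert (a1 : Rabs (- INR (S c) * m1 + m2) <= INR (S c) * Rabs m1 + Rabs m2).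
      { apply Rle_trans with (1 := Rabs_triang _ _). rewrite Rabs_mult, Rabs_Ropp, (Rabs_pos_eq _ ISc). lra. }
      assert (a2 : Rabs (- INR (c + 2) * m3 + m4) <= INR (c + 2) * Rabs m3 + Rabs m4).
      { apply Rle_trans with (1 := Rabs_triang _ _). rewrite Rabs_mult, Rabs_Ropp, (Rabs_pos_eq _ Ic2). lra. }
      apply Rle_trans with (1 := Rabs_triang _ _). rewrite Rabs_mult, Rabs_Ropp, (Rabs_pos_eq _ Ic).
      assert (q1 : INR (S c) * Rabs m1 <= INR (S c) * (K2 * exp (t / 2) * B0)) by (apply Rmult_le_compat_l; lra).
      assert (q3 : INR (c + 2) * Rabs m3 <= INR (c + 2) * (K1 * exp (t / 2) * B1)) by (apply Rmult_le_compat_l; lra).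
      assert (q : INR c * Rabs (- INR (S c) * m1 + m2)
        <= INR c * (INR (S c) * (K2 * exp (t / 2) * B0) + K1 * exp (t / 2) * B1))
        by (apply Rmult_le_compat_l; lra).
      unfold e2, Bt. lra. }
    apply Rle_trans with (exp (- S0 * t) * (e2 * (y - x) ^ 2)).
    { apply Rmult_le_compat_l; [left; apply exp_pos|exact Rm]. }
    unfold e2. pose proof (exp_S0_bound t Ht) as ES.
    replace (exp (- S0 * t) * (Bt * exp (t / 2) * (y - x) ^ 2))
      with (Bt * (y - x) ^ 2 * (exp (- S0 * t) * exp (t / 2))) by ring.
    apply Rmult_le_compat_l; [apply Rmult_le_pos; [exact Pos|apply pow2_ge_0]|exact ES].
Qed.

(** The [m]-th derivative in [x] of [lap i c (h j)], generated by the rule of [mob_dI]; [i], [c],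
    [j] stay general because both branches change them. *)
Fixpoint laptower (h : nat -> R -> R) (m i c j : nat) (x : R) : R :=
  match m with
  | O => lap i c (h j) x
  | S m' => - INR c * laptower h m' (S i) (S c) j x + laptower h m' i (c + 2) (S j) x
  end.

Lemma laptower_rtower (h : nat -> R -> R) (i c j : nat) :
  rtower h -> (forall n y, continuous (h n) y) -> rtower (fun m => laptower h m i c j).
Proof.
  intros Hh Ch.
  assert (Q : forall m i c j, exists B, forall x y, Icl x -> Icl y ->
    Rabs (laptower h m i c j y - laptower h m i c j x - (y - x) * laptower h (S m) i c j x)
    <= B * (y - x) ^ 2).
  { induction m as [|m IH]; intros i' c' j'.
    - apply (lap_remainder i' c' (h j') (h (S j')) (h (S (S j')))); auto.
    - destruct (IH (S i') (S c') j') as [B1 H1]. destruct (IH i' (c' + 2)%nat (S j')) as [B2 H2].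
      exists (INR c' * B1 + B2). intros x y Ix Iy. specialize (H1 x y Ix Iy). specialize (H2 x y Ix Iy).
      pose proof (pos_INR c') as Ic.
      change (Rabs ((- INR c' * laptower h m (S i') (S c') j' y + laptower h m i' (c' + 2) (S j') y)
        - (- INR c' * laptower h m (S i') (S c') j' x + laptower h m i' (c' + 2) (S j') x)
        - (y - x) * (- INR c' * laptower h (S m) (S i') (S c') j' x + laptower h (S m) i' (c' + 2) (S j') x))
        <= (INR c' * B1 + B2) * (y - x) ^ 2).
      match type of H1 with Rabs ?a <= _ => match type of H2 with Rabs ?b <= _ =>
        match goal with |- Rabs ?z <= _ => replace z with (- INR c' * a + b) by ring end end end.
      apply Rle_trans with (1 := Rabs_triang _ _). rewrite Rabs_mult, Rabs_Ropp, (Rabs_pos_eq _ Ic).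
      apply Rmult_le_compat_l with (r := INR c') in H1; [|exact Ic]. lra. }
  assert (D : forall m, deriv_on_I (laptower h m i c j) (laptower h (S m) i c j)).
  { intros m. destruct (Q m i c j) as [B HB]. exact (quadratic_remainder_deriv _ _ B HB). }
  intros m. exact (deriv_on_I_dI _ _ _ (D m) (D (S m))).
Qed.

Lemma contI_zero (f : R -> R) : contI f -> (forall x, 0 < x < 1 -> f x = 0) ->
  forall x, Icl x -> f x = 0.
Proof.
  intros C H x Ix. apply cond_eq. intros eps He. rewrite Rminus_0_r.
  destruct (contI_at f x C Ix eps He) as [d [Hd Hy]].
  destruct (Icl_nearby x d Ix Hd) as [y [Iy [_ Dy]]].
  specialize (Hy y ltac:(unfold Icl; lra) Dy). rewrite (H y Iy) in Hy.
  replace (0 - f x) with (- f x) in Hy by ring. rewrite Rabs_Ropp in Hy. exact Hy.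
Qed.

(** Along the flow, [d/dt mob = - x^2 d/dx mob - c x mob] for [i = 0]. The left-hand side is
    therefore the integral of [- d/dt (exp(- S0 t) mob)], which equals the value at [t = 0], namely
    [h 0 x]. *)
Lemma laptower_ode (h : nat -> R -> R) (c : nat) :
  rtower h -> (forall n y, continuous (h n) y) -> forall x, Icl x ->
  x ^ 2 * laptower h 1 0 c 0 x + (INR c * x + S0) * laptower h 0 0 c 0 x = h 0%nat x.
Proof.
  intros Hh Ch.
  pose proof (laptower_rtower h 0 c 0 Hh Ch) as T.
  pose proof (proj1 (T 0%nat)) as C0. pose proof (proj1 (T 1%nat)) as C1. pose proof (proj1 (Hh 0%nat)) as CH.
  cut (forall x, Icl x -> x ^ 2 * laptower h 1 0 c 0 x + (INR c * x + S0) * laptower h 0 0 c 0 x - h 0%nat x = 0).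
  { intros K x Ix. specialize (K x Ix). lra. }
  (* The derivative of [h 0] is two-sided only inside the interval; continuity supplies the
     endpoints. *)
  apply contI_zero; [contI_tac|]. intros x Hx. assert (Ix : Icl x) by (unfold Icl; lra).
  cbn [laptower]. unfold lap.
  destruct (decaying_mob 1 (S c) (h 0%nat) (Ch 0%nat) CH) as [b1 d1].
  destruct (decaying_mob 0 (c + 2) (h 1%nat) (Ch 1%nat) (proj1 (Hh 1%nat))) as [b2 d2].
  destruct (decaying_mob 0 c (h 0%nat) (Ch 0%nat) CH) as [b3 d3].
  specialize (d1 x Ix). specialize (d2 x Ix). specialize (d3 x Ix).
  pose proof (LI_lin _ _ (- INR c) 1 _ _ d1 d2) as L1.
  pose proof (decaying_lin _ _ (- INR c) 1 _ _ d1 d2) as D1.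
  pose proof (LI_lin _ _ (- x ^ 2) (- (INR c * x + S0)) _ _ D1 d3) as L2.
  pose proof (decaying_lin _ _ (- x ^ 2) (- (INR c * x + S0)) _ _ D1 d3) as D2.
  cbv beta in L1, L2, D1, D2. rewrite L1 in L2.
  destruct (contI_bounded (h 0%nat) CH) as [B [HB Hb]].
  pose proof (LI_ftc _ (fun t => exp (- S0 * t) * mob t 0 c (h 0%nat) x) _ b3 D2) as F.
  rewrite F in L2.
  - unfold mob at 1 in L2. rewrite !Rmult_0_r, Rplus_0_r, exp_0, pow1, pow_O in L2.
    replace (x / 1) with x in L2 by field. lra.
  - intros t Ht. pose proof (mob_arg t x Ht Ix) as [H1 _].
    destruct (Hh 0%nat) as [_ [_ Dh]]. specialize (Dh _ (mob_arg_interior t x Ht Hx)).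
    assert (A1 : is_derive (fun t => x / (1 + x * t)) t (- x ^ 2 / (1 + x * t) ^ 2)).
    { auto_derive; [lra|]. field. lra. }
    pose proof (is_derive_comp (h 0%nat) (fun t => x / (1 + x * t)) t _ _ Dh A1) as A2.
    assert (A3 : is_derive (fun t => exp (- S0 * t) / (1 + x * t) ^ c) t
      (- S0 * exp (- S0 * t) / (1 + x * t) ^ c - INR c * x * exp (- S0 * t) / (1 + x * t) ^ S c)).
    { destruct c as [|c'].
      - simpl. apply (is_derive_ext (fun t => exp (- S0 * t))); [intros u; symmetry; apply Rdiv_1_r|].
        auto_derive; [exact I|]. field. lra.
      - auto_derive; [apply (pow_nonzero (1 + x * t) (S c')); lra|].
        replace (match c' with 0%nat => 1 | S _ => INR c' + 1 end) with (INR (S c')) by reflexivity.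
        simpl pow. field; repeat split; try lra; apply pow_nonzero; lra. }
    pose proof (is_derive_mult _ _ t _ _ A3 A2 Rmult_comm) as A4.
    apply (is_derive_ext (fun t => exp (- S0 * t) / (1 + x * t) ^ c * h 0%nat (x / (1 + x * t)))).
    { intros u. unfold mob. simpl pow. unfold Rdiv. rewrite Rmult_1_l. apply Rmult_assoc. }
    eapply eq_rect; [exact A4|]. unfold plus, mult, scal; simpl; unfold mult; simpl. unfold mob.
    rewrite pow_add. simpl pow. field; repeat split; try lra; apply pow_nonzero; lra.
  - intros t Ht. apply d3. exact Ht.
Qed.

End Laplace.

(** * From the derivative of order N + 1 back to u *)

Lemma rtower_clamp (f : nat -> R -> R) : rtower f -> rtower (fun n x => f n (clamp x)).
Proof.
  intros H n. destruct (H n) as [A [B D]]. split; [|split].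
  - apply (contI_ext (f n)); [|exact A]. intros x Ix; now rewrite clamp_id.
  - apply (contI_ext (f (S n))); [|exact B]. intros x Ix; now rewrite clamp_id.
  - intros x Hx. rewrite (clamp_id x) by (unfold Icl; lra).
    apply (is_derive_ext_loc (f n)); [now apply clamp_locally|now apply D].
Qed.

(** Built from the top: one primitive of [w] is normalised at 1, and the induction hypothesis is
    applied to the lengthened tower. *)
Lemma iterated_antiderivative (a : nat -> R) (k : nat) (w : nat -> R -> R) : rtower w ->
  exists u, rtower u /\ (forall m x, u (k + m)%nat x = w m x) /\ (forall n, (n < k)%nat -> u n 1 = a n).
Proof.
  revert w. induction k as [|k IH]; intros w Hw.
  - exists w. split; [exact Hw|split; [reflexivity|intros; lia]].
  - set (G := fun y => RInt (fun z => w 0%nat (clamp z)) 0 y).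
    set (u' := fun n => match n with O => fun x => a k + (G x - G 1) | S n' => w n' end).
    assert (Hu' : rtower u').
    { intros [|n]; [|apply (Hw n)].
      refine (dI_ext _ _ (dI_plus (dI_const (a k - G 1)) (dI_RInt (w 0%nat) (proj1 (Hw 0%nat)))));
        intros x; cbv beta iota delta [u']; [change (a k - G 1 + G x = a k + (G x - G 1))|]; ring. }
    destruct (IH u' Hu') as [u [Hu [E1 E2]]]. exists u. split; [exact Hu|split].
    + intros m x. replace (S k + m)%nat with (k + S m)%nat by lia. rewrite E1. reflexivity.
    + intros n Hn. destruct (Nat.eq_dec n k) as [->|Hne]; [|apply E2; lia].
      replace k with (k + 0)%nat at 1 by lia. rewrite E1. unfold u'. ring.
Qed.

Fixpoint shoot (dd c phi : nat -> R) (t : R) (n : nat) : R * R :=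
  match n with
  | O => (0, t)
  | S n' => let p := shoot dd c phi t n' in
            (snd p, phi n' - dd n' * snd p - c n' * fst p)
  end.

(** The solution is affine in the free value [a 1]: a particular one [P] with [a 1 = 0] plus a
    multiple of the homogeneous one [Q] with [a 1 = 1]. Diagonal dominance keeps [|Q|]
    nondecreasing, so its last entry is at least 1 and any target can be hit. *)
Lemma shooting (dd c phi : nat -> R) (N : nat) (target : R) :
  (forall n, (n < N)%nat -> 1 + Rabs (c n) <= dd n) ->
  exists a : nat -> R, a 0%nat = 0 /\ a (S N) = target /\
    forall n, a (S (S n)) + dd n * a (S n) + c n * a n = phi n.
Proof.
  intros H.
  set (P := shoot dd c phi 0). set (Q := shoot dd c (fun _ => 0) 1).
  assert (HQ : forall n, (n <= N)%nat -> 1 <= Rabs (snd (Q n)) /\ Rabs (fst (Q n)) <= Rabs (snd (Q n))).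
  { induction n as [|n IH]; intros Hn.
    - simpl. rewrite Rabs_R0, Rabs_R1. lra.
    - destruct (IH ltac:(lia)) as [I1 I2]. specialize (H n ltac:(lia)).
      change (Q (S n)) with (snd (Q n), 0 - dd n * snd (Q n) - c n * fst (Q n)). cbn [fst snd].
      set (q := snd (Q n)) in *. set (p := fst (Q n)) in *.
      assert (K : Rabs q <= Rabs (0 - dd n * q - c n * p)); [|lra].
      replace (0 - dd n * q - c n * p) with (- (dd n * q - - (c n * p))) by ring.
      rewrite Rabs_Ropp. apply Rle_trans with (2 := Rabs_triang_inv _ _).
      rewrite Rabs_Ropp, !Rabs_mult. pose proof (Rabs_pos (c n)) as Hc.
      rewrite (Rabs_pos_eq (dd n)) by lra.
      assert (Rabs (c n) * Rabs p <= Rabs (c n) * Rabs q) by (apply Rmult_le_compat_l; lra).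
      assert ((1 + Rabs (c n)) * Rabs q <= dd n * Rabs q) by (apply Rmult_le_compat_r; lra).
      lra. }
  destruct (HQ N (Nat.le_refl N)) as [HN _].
  assert (HN0 : snd (Q N) <> 0) by (intros E; rewrite E, Rabs_R0 in HN; lra).
  set (t := (target - snd (P N)) / snd (Q N)).
  exists (fun n => fst (P n) + t * fst (Q n)). split; [|split].
  - simpl. ring.
  - change (fst (P (S N))) with (snd (P N)). change (fst (Q (S N))) with (snd (Q N)).
    unfold t. field. exact HN0.
  - intros n.
    change (fst (P (S (S n)))) with (phi n - dd n * snd (P n) - c n * fst (P n)).
    change (fst (Q (S (S n)))) with (0 - dd n * snd (Q n) - c n * fst (Q n)).
    change (fst (P (S n))) with (snd (P n)). change (fst (Q (S n))) with (snd (Q n)). ring.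
Qed.

Lemma base_real (S0 lam : R) (N : nat) (f : nat -> R -> R) : 1 <= S0 ->
  INR N * (INR N + 1) <= lam -> rtower f ->
  exists u, rtower u /\ u 0%nat 1 = 0 /\
    forall x, Icl x -> LH N lam u 0 x + S0 * u 1%nat x - f 0%nat x = 0.
Proof.
  intros HS Hl Hf.
  (* The integral formula asks for data continuous on the whole line; clamping changes nothing on
     the interval. *)
  set (g := fun n x => f (N + n)%nat (clamp x)).
  assert (Hg : rtower g).
  { apply (rtower_clamp (fun n => f (N + n)%nat)). intros n.
    replace (N + S n)%nat with (S (N + n)) by lia. apply Hf. }
  assert (Cg : forall n y, continuous (g n) y) by (intros n y; apply (proj1 (Hf (N + n)%nat))).
  (* At level [N] the zero-order term drops out and the coefficient of [u^(N+1)] is [(2N+2) x + S0],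
     whence the weight. *)
  set (w := fun m => laptower S0 g m 0 (2 * N + 2) 0).
  pose proof (laptower_rtower S0 HS g 0 (2 * N + 2) 0 Hg Cg) as Hw. fold w in Hw.
  pose proof (laptower_ode S0 HS g (2 * N + 2) Hg Cg) as ODE.
  (* The rows are the equation differentiated [n] times at [x = 1]. The integral formula has already
     fixed [u^(N+1)(1) = w 0 1], which is the target. *)
  destruct (shooting (fun n => lam + S0 + 2 * (INR n + 1)) (kn N) (fun n => f n 1) N (w 0%nat 1)) as [a [A0 [AN AE]]].
  { intros n Hn. apply lt_INR in Hn. pose proof (pos_INR n).
    assert (Rabs (kn N n) <= INR N * (INR N + 1)); [|lra].
    unfold kn. apply Rabs_le. split; nra. }
  destruct (iterated_antiderivative a (S N) w Hw) as [u [Hu [E1 E2]]].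
  exists u. split; [exact Hu|split; [rewrite E2 by lia; exact A0|]].
  assert (Ea : forall n, (n <= S N)%nat -> u n 1 = a n).
  { intros n Hn. destruct (Nat.eq_dec n (S N)) as [->|Hne]; [|apply E2; lia].
    replace (S N) with (S N + 0)%nat at 1 by lia. rewrite E1. now rewrite AN. }
  apply (rtower_zero_down (fun n x => LH N lam u n x + S0 * u (S n) x - f n x) N).
  - intros n. exact (dI_minus (dI_plus (LH_dI N lam u n Hu) (dI_scal S0 (Hu (S n)))) (Hf n)).
  - intros x Ix. specialize (ODE x Ix). unfold LH. rewrite kn_diag, Nat.sub_diag. cbn [pol].
    replace (S (S N)) with (S N + 1)%nat by lia. rewrite E1.
    replace (S N) with (S N + 0)%nat by lia. rewrite !E1. unfold w.
    unfold g at 3 in ODE. rewrite clamp_id, Nat.add_0_r in ODE by exact Ix. rewrite <- ODE.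
    rewrite plus_INR, mult_INR. change (INR 2) with 2. ring.
  - intros n Hn. unfold LH. destruct (N - n)%nat as [|m] eqn:E; [lia|].
    rewrite pol_1, Nat.add_0_r, !Ea by lia. specialize (AE n). lra.
Qed.

(** For real [s] the real and imaginary parts decouple into two real problems. *)
Lemma base_solvable (S0 lam : R) (N : nat) (F : tower) : 1 <= S0 ->
  INR N * (INR N + 1) <= lam -> is_tower F ->
  exists U, is_tower U /\ U 0%nat 1 = c0 /\ solves N lam (S0, 0) U F.
Proof.
  intros HS Hl HF. apply tower_rtower in HF as [F1 F2].
  destruct (base_real S0 lam N _ HS Hl F1) as [u [Hu [u0 Eu]]].
  destruct (base_real S0 lam N _ HS Hl F2) as [v [Hv [v0 Ev]]].
  exists (fun n x => (u n x, v n x)). split; [apply tower_rtower; split; assumption|split].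
  - rewrite u0, v0. reflexivity.
  - apply solves_iff. intros x Ix. specialize (Eu x Ix). specialize (Ev x Ix).
    unfold res1, res2, Re, Im; cbn [fst snd].
    change (fun n x => u n x) with u. change (fun n x => v n x) with v. split; lra.
Qed.

(** * Method of continuity *)

Lemma inY_tcmul (sigma : R) (c : cplx) (V : tower) : 0 < sigma -> inY sigma V ->
  inY sigma (tcmul c V) /\
  YS sigma (tcmul c V) <= cnorm2 c * YS sigma V.
Proof.
  intros Hs HV. apply (inY_iff sigma Hs) in HV as [TV CV].
  pose proof (tcmul_tower c V TV) as TW.
  destruct (converges_scal (YT sigma V) (cnorm2 c) CV) as [A E].
  assert (K : forall n, 0 <= YT sigma (tcmul c V) n <= cnorm2 c * YT sigma V n).
  { intros n. split; [now apply YT_nonneg|].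
    replace (cnorm2 c * YT sigma V n) with (cnorm2 c * YT sigma V n + 0 * YT sigma V n) by ring.
    apply YT_mono; auto. intros x _. unfold tcmul. rewrite cnorm2_cmul. lra. }
  destruct (Series_le _ _ K A) as [B L]. rewrite E in L.
  split; [apply (inY_iff sigma Hs); split; assumption|exact L].
Qed.

Lemma solves_ext (N : nat) (lam : R) (s : cplx) (U F G : tower) :
  (forall x, Icl x -> F 0%nat x = G 0%nat x) -> solves N lam s U F -> solves N lam s U G.
Proof. intros E H x Ix. rewrite <- (E x Ix). now apply H. Qed.

(** The sequence is squeezed between [a k - 2 K 2^(-k)], which increases, and [a k + 2 K 2^(-k)],
    which decreases. *)
Lemma geometric_limit (a : nat -> R) (K : R) : (forall k, Rabs (a (S k) - a k) <= K * (/ 2) ^ k) ->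
  is_lim_seq a (real (Lim_seq a)) /\ forall k, Rabs (a k - real (Lim_seq a)) <= 2 * K * (/ 2) ^ k.
Proof.
  intros H.
  assert (HK : 0 <= K) by (specialize (H 0%nat); simpl in H; pose proof (Rabs_pos (a 1%nat - a 0%nat)); lra).
  set (b := fun k => a k - 2 * K * (/ 2) ^ k). set (c := fun k => a k + 2 * K * (/ 2) ^ k).
  assert (Hp : forall k, 0 <= K * (/ 2) ^ k) by (intros k; apply Rmult_le_pos; [exact HK|apply pow_le; lra]).
  assert (Hb : forall k, b k <= b (S k)).
  { intros k. specialize (H k). apply Rabs_le_between in H. unfold b. simpl. lra. }
  assert (Hc : forall k, c (S k) <= c k).
  { intros k. specialize (H k). apply Rabs_le_between in H. unfold c. simpl. lra. }
  assert (Hbm : forall j k, (j <= k)%nat -> b j <= b k).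
  { intros j k Hjk. induction Hjk as [|k _ IH]; [lra|specialize (Hb k); lra]. }
  assert (Hcm : forall j k, (j <= k)%nat -> c k <= c j).
  { intros j k Hjk. induction Hjk as [|k _ IH]; [lra|specialize (Hc k); lra]. }
  assert (Hbc : forall j k, b j <= c k).
  { intros j k. pose proof (Hbm j (Nat.max j k) ltac:(lia)). pose proof (Hcm k (Nat.max j k) ltac:(lia)).
    pose proof (Hp (Nat.max j k)). unfold b, c in *. lra. }
  destruct (ex_finite_lim_seq_incr b (c 0%nat) Hb (fun k => Hbc k 0%nat)) as [l Hl].
  assert (L : is_lim_seq a l).
  { apply (is_lim_seq_ext (fun k => b k + 2 * K * (/ 2) ^ k)); [intros; unfold b; ring|].
    replace (Finite l) with (Finite (l + 2 * K * 0)) by (f_equal; ring).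
    apply is_lim_seq_plus'; [exact Hl|]. apply (is_lim_seq_scal_l _ (2 * K) 0).
    apply is_lim_seq_geom. rewrite Rabs_pos_eq; lra. }
  rewrite (is_lim_seq_unique _ _ L). simpl. split; [exact L|].
  intros k. apply Rabs_le.
  assert (b k <= l) by (apply (is_lim_seq_incr_compare b l Hl Hb)).
  assert (l <= c k) by (exact (is_lim_seq_le b (fun _ => c k) l (c k) (fun j => Hbc j k) Hl (is_lim_seq_const _))).
  unfold b, c in *. lra.
Qed.

Lemma LH_limit (N : nat) (lam : R) (u : nat -> nat -> R -> R) (v : nat -> R -> R) (x : R) :
  (forall n y, Icl y -> is_lim_seq (fun k => u k n y) (v n y)) -> Icl x ->
  is_lim_seq (fun k => LH N lam (u k) 0 x) (LH N lam v 0 x).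
Proof.
  intros H Ix. unfold LH.
  assert (P : forall m, is_lim_seq (fun k => pol m (fun i => u k (S (0 + i)) 1) x)
    (pol m (fun i => v (S (0 + i)) 1) x)).
  { induction m as [|m IH]; cbn [pol]; [apply is_lim_seq_const|].
    apply is_lim_seq_plus'; [exact IH|].
    apply (is_lim_seq_scal_l _ ((x - 1) ^ m / INR (fact m)) (v (S (0 + m)) 1)). apply H, Icl_1. }
  apply is_lim_seq_plus'; [apply is_lim_seq_plus'; [apply is_lim_seq_plus'|]|].
  - apply (is_lim_seq_scal_l _ (x ^ 2) (v 2%nat x)), H, Ix.
  - apply (is_lim_seq_scal_l _ (2 * (INR 0 + 1) * x) (v 1%nat x)), H, Ix.
  - apply (is_lim_seq_scal_l _ (kn N 0) (v 0%nat x)), H, Ix.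
  - apply (is_lim_seq_scal_l _ lam (pol (N - 0) (fun i => v (S (0 + i)) 1) x)), P.
Qed.

Lemma abs_fst_le (z : cplx) (B e : R) : 0 <= e -> cnorm2 z <= B ^ 2 * e ^ 2 -> 0 <= B ->
  Rabs (fst z) <= B * e /\ Rabs (snd z) <= B * e.
Proof.
  intros He H HB. unfold cnorm2 in H. pose proof (pow2_ge_0 (fst z)); pose proof (pow2_ge_0 (snd z)).
  rewrite <- Rpow_mult_distr in H.
  split; rewrite <- (Rabs_pos_eq (B * e)) by nra; apply Rsqr_le_abs_0; unfold Rsqr; nra.
Qed.

Definition solvable (sigma lam : R) (N : nat) (s : cplx) : Prop :=
  forall F, inY sigma F -> exists U, inX sigma U /\ solves N lam s U F.

(** The bounds [D] on derivatives two orders higher make the Taylor remainders quadratic uniformly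
    in [k]; this survives pointwise limits, so the limits of the derivatives are the derivatives of
    the limit. *)
Lemma tower_limit (u : nat -> tower) (D K : nat -> R) :
  (forall k, is_tower (u k)) ->
  (forall n k x, Icl x -> cnorm2 (u k n x) <= D n ^ 2) -> (forall n, 0 <= D n) ->
  (forall n, 0 <= K n) ->
  (forall n k x, Icl x -> cnorm2 (csub (u (S k) n x) (u k n x)) <= K n ^ 2 * ((/ 2) ^ k) ^ 2) ->
  exists U : tower, is_tower U /\
    (forall n x, Icl x -> is_lim_seq (fun k => fst (u k n x)) (fst (U n x)) /\
                          is_lim_seq (fun k => snd (u k n x)) (snd (U n x))) /\
    (forall n k x, Icl x -> cnorm2 (csub (U n x) (u k n x)) <= 8 * K n ^ 2 * (/ 2) ^ k).
Proof.
  intros HT HD HD0 HK0 HK.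
  set (U := fun n x => (real (Lim_seq (fun k => fst (u k n x))), real (Lim_seq (fun k => snd (u k n x))))).
  assert (H2 : forall k, 0 <= (/ 2) ^ k) by (intros; apply pow_le; lra).
  assert (L : forall n x, Icl x ->
    (is_lim_seq (fun k => fst (u k n x)) (fst (U n x)) /\
      forall k, Rabs (fst (u k n x) - fst (U n x)) <= 2 * K n * (/ 2) ^ k) /\
    (is_lim_seq (fun k => snd (u k n x)) (snd (U n x)) /\
      forall k, Rabs (snd (u k n x) - snd (U n x)) <= 2 * K n * (/ 2) ^ k)).
  { intros n x Ix. split; apply geometric_limit; intros k.
    - exact (proj1 (abs_fst_le _ _ _ (H2 k) (HK n k x Ix) (HK0 n))).
    - exact (proj2 (abs_fst_le _ _ _ (H2 k) (HK n k x Ix) (HK0 n))). }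
  exists U. split; [|split].
  - assert (Q : forall (p : cplx -> R), (forall n x, Icl x -> is_lim_seq (fun k => p (u k n x)) (p (U n x))) ->
      (forall n k x, Icl x -> Rabs (p (u k n x)) <= D n) ->
      (forall k n, dI (fun x => p (u k n x)) (fun x => p (u k (S n) x))) ->
      forall n, deriv_on_I (fun x => p (U n x)) (fun x => p (U (S n) x))).
    { intros p Lp Bp Dp n. apply (quadratic_remainder_deriv _ _ (D (S (S n)))). intros x y Ix Iy.
      assert (R : is_lim_seq (fun k => Rabs (p (u k n y) - p (u k n x) - (y - x) * p (u k (S n) x)))
        (Rabs (p (U n y) - p (U n x) - (y - x) * p (U (S n) x)))).
      { apply (is_lim_seq_abs _ (p (U n y) - p (U n x) - (y - x) * p (U (S n) x))).
        apply is_lim_seq_minus'; [apply is_lim_seq_minus'; apply Lp; assumption|].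
        apply (is_lim_seq_scal_l _ (y - x) (p (U (S n) x))), Lp, Ix. }
      refine (is_lim_seq_le _ (fun _ => D (S (S n)) * (y - x) ^ 2) _ (Finite _) _ R (is_lim_seq_const _)).
      intros k. apply (taylor_remainder _ _ _ (D (S (S n))) (Dp k n) (Dp k (S n))); auto. }
    assert (HD' : forall n k x, Icl x -> Rabs (fst (u k n x)) <= D n /\ Rabs (snd (u k n x)) <= D n).
    { intros n k x Ix. rewrite <- (Rmult_1_r (D n)). apply abs_fst_le; [lra| |auto].
      rewrite pow1, Rmult_1_r. auto. }
    intros n; split.
    + apply (Q fst); [intros m x Ix; exact (proj1 (proj1 (L m x Ix)))|intros; now apply HD'|].
      intros; now apply tower_dI.
    + apply (Q snd); [intros m x Ix; exact (proj1 (proj2 (L m x Ix)))|intros; now apply HD'|].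
      intros; now apply tower_dI.
  - intros n x Ix. destruct (L n x Ix) as [[L1 _] [L2 _]]. split; assumption.
  - intros n k x Ix. destruct (L n x Ix) as [[_ L1] [_ L2]]. specialize (L1 k). specialize (L2 k).
    unfold csub, cadd, copp, cnorm2; cbn [fst snd].
    set (e := (/ 2) ^ k) in *.
    assert (He : 0 <= e <= 1).
    { split; [apply H2|]. unfold e. rewrite <- (pow1 k). apply pow_incr; lra. }
    assert (Sq : forall a b, Rabs (a - b) <= 2 * K n * e -> (b + - a) ^ 2 <= 4 * K n ^ 2 * e).
    { intros a b Hab. rewrite <- (pow2_abs (b + - a)).
      replace (Rabs (b + - a)) with (Rabs (a - b)) by (rewrite <- Rabs_Ropp; f_equal; ring).
      apply Rle_trans with ((2 * K n * e) ^ 2); [apply pow_incr; split; [apply Rabs_pos|exact Hab]|].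
      assert (e * e <= e) by nra. pose proof (pow2_ge_0 (K n)) as HK2.
      replace ((2 * K n * e) ^ 2) with (4 * K n ^ 2 * (e * e)) by ring.
      apply Rmult_le_compat_l; lra. }
    pose proof (Sq _ _ L1); pose proof (Sq _ _ L2). lra.
Qed.

Section Continuity.
Variables (sigma lam C : R) (N : nat) (s0 : cplx).
Hypothesis Hs : 0 < sigma.
Hypothesis HC : 0 <= C.
Hypothesis Bound0 : forall U F, inX sigma U -> inY sigma F -> solves N lam s0 U F ->
  XS sigma U <= C * YS sigma F.

Lemma XS_nonneg (U : tower) : inX sigma U -> 0 <= XS sigma U.
Proof.
  intros H. apply (inX_iff sigma Hs) in H as [T [_ Cv]].
  apply Series_nonneg; [intros; now apply XT_nonneg|exact Cv].
Qed.

Lemma YS_nonneg (F : tower) : inY sigma F -> 0 <= YS sigma F.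
Proof.
  intros H. apply (inY_iff sigma Hs) in H as [T Cv].
  apply Series_nonneg; [intros; now apply YT_nonneg|exact Cv].
Qed.

(** The X norm sees only [u']; at order 0 the condition [u(1) = 0] is used, and 4 is the factor from
    [tower_sup_from_1]. *)
Definition supc (n : nat) : R :=
  match n with
  | O => 4 * (3 / wcoef sigma 0 + 2 / wcoef sigma 1)
  | S m => 3 / wcoef sigma m + 2 / wcoef sigma (S m)
  end.

Lemma supc_pos (n : nat) : 0 < supc n.
Proof.
  assert (H : forall m, 0 < 3 / wcoef sigma m + 2 / wcoef sigma (S m)).
  { intros m. assert (0 < / wcoef sigma m) by now apply Rinv_0_lt_compat, wcoef_pos.
    assert (0 < / wcoef sigma (S m)) by now apply Rinv_0_lt_compat, wcoef_pos. unfold Rdiv. lra. }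
  destruct n as [|m]; simpl; [specialize (H 0%nat); lra|apply H].
Qed.

Lemma sup_all (U : tower) (n : nat) (x : R) : inX sigma U -> Icl x ->
  cnorm2 (U n x) <= supc n * XS sigma U.
Proof.
  intros HX Ix. destruct n as [|m]; [|now apply sup_le_normX].
  pose proof (fun y Iy => sup_le_normX sigma Hs U 0 y HX Iy) as K.
  pose proof HX as [TU [U1 _]].
  assert (P : 0 <= (3 / wcoef sigma 0 + 2 / wcoef sigma 1) * XS sigma U).
  { apply Rle_trans with (2 := K 0 Icl_0). apply cnorm2_nonneg. }
  pose proof (tower_sup_from_1 U 0 _ TU P K x Ix) as B. rewrite U1 in B.
  unfold cnorm2 at 2, c0 in B; cbn [fst snd] in B. unfold supc. lra.
Qed.

(** A Neumann series: the equation at [s] is [u = R(s0)(F - (s - s0) u')]. The hypothesis makes this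
    map contract the squared X norm by 1/4, hence the norm by 1/2. *)
Lemma solvable_step (s : cplx) : 4 * C * cnorm2 (csub s s0) <= 1 ->
  solvable sigma lam N s0 -> solvable sigma lam N s.
Proof.
  intros Hsm Hsol F HF. set (c := csub s s0) in *.
  pose proof (cnorm2_nonneg c) as Hc0.
  set (R0 := fun G => epsilon (inhabits (fun _ _ => c0 : cplx))
    (fun U : tower => inX sigma U /\ solves N lam s0 U G)).
  assert (HR0 : forall G, inY sigma G -> inX sigma (R0 G) /\ solves N lam s0 (R0 G) G).
  { intros G HG. unfold R0. apply epsilon_spec. now apply Hsol. }
  set (G := fun U => tsub F (tcmul c (tshift U))).
  set (u := fix u (k : nat) : tower := match k with O => R0 F | S k' => R0 (G (u k')) end).
  assert (HG : forall U, inX sigma U -> inY sigma (G U) /\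
    YS sigma (G U) <= 2 * YS sigma F + 2 * cnorm2 c * XS sigma U).
  { intros U HU. destruct (inY_tshift sigma Hs U HU) as [Y1 Y2].
    destruct (inY_tsub_tcmul sigma Hs c F _ HF Y1) as [Z1 Z2]. split; [exact Z1|].
    apply Rle_trans with (1 := Z2). apply Rplus_le_compat_l. apply Rmult_le_compat_l; lra. }
  assert (Hu : forall k, inX sigma (u k)).
  { induction k as [|k IH]; simpl; apply HR0; [exact HF|now apply HG]. }
  assert (Su : forall k, solves N lam s0 (u (S k)) (G (u k))) by (intros k; simpl; apply HR0, HG, Hu).
  set (YF := YS sigma F). assert (HYF : 0 <= YF) by now apply YS_nonneg.
  (* A bound reproduced by the iteration: [2 C YF] from [F], plus at most half the bound of the
     previous iterate. *)
  set (Bd := 4 * C * YF). assert (HBd : 0 <= Bd) by (unfold Bd; apply Rmult_le_pos; lra).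
  assert (Bu : forall k, XS sigma (u k) <= Bd).
  { induction k as [|k IH].
    - pose proof (Bound0 _ _ (Hu 0%nat) HF (proj2 (HR0 F HF))) as K. fold YF in K.
      assert (0 <= C * YF) by now apply Rmult_le_pos. unfold Bd. lra.
    - destruct (HG _ (Hu k)) as [g1 g2]. pose proof (Bound0 _ _ (Hu (S k)) g1 (Su k)) as K.
      apply Rmult_le_compat_l with (r := C) in g2; [|exact HC]. fold YF in g2.
      pose proof (XS_nonneg _ (Hu k)) as P.
      assert (4 * C * cnorm2 c * XS sigma (u k) <= 1 * XS sigma (u k))
        by (apply Rmult_le_compat_r; assumption).
      unfold Bd in *. lra. }
  set (dd := fun k => tsub (u (S k)) (u k)).
  assert (Hdd : forall k, inX sigma (dd k)) by (intros k; apply (inX_tsub sigma Hs); apply Hu).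
  set (E0 := XS sigma (dd 0%nat)).
  assert (HE0 : 0 <= E0) by now apply XS_nonneg.
  assert (Bdd : forall k, XS sigma (dd k) <= E0 * ((/ 2) ^ k) ^ 2).
  { induction k as [|k IH]; [simpl; unfold E0; lra|].
    destruct (inY_tshift sigma Hs _ (Hdd k)) as [Y1 Y2].
    destruct (inY_tcmul sigma (copp c) _ Hs Y1) as [Z1 Z2].
    assert (So : solves N lam s0 (dd (S k)) (tcmul (copp c) (tshift (dd k)))).
    { apply (solves_ext N lam s0 _ (tsub (G (u (S k))) (G (u k)))).
      - intros x _. unfold G, dd, tsub, tcmul, tshift, csub, cadd, copp, cmul; cbn [fst snd]. f_equal; ring.
      - apply solves_tsub; apply Su. }
    pose proof (Bound0 _ _ (Hdd (S k)) Z1 So) as K.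
    assert (Ec : cnorm2 (copp c) = cnorm2 c) by (unfold cnorm2, copp; cbn [fst snd]; ring).
    rewrite Ec in Z2. pose proof (XS_nonneg _ (Hdd k)) as P.
    assert (Z3 : YS sigma (tcmul (copp c) (tshift (dd k))) <= cnorm2 c * XS sigma (dd k)).
    { apply Rle_trans with (1 := Z2). now apply Rmult_le_compat_l. }
    apply Rmult_le_compat_l with (r := C) in Z3; [|exact HC].
    assert (4 * C * cnorm2 c * XS sigma (dd k) <= 1 * XS sigma (dd k))
      by (apply Rmult_le_compat_r; assumption).
    replace (E0 * ((/ 2) ^ S k) ^ 2) with (/ 4 * (E0 * ((/ 2) ^ k) ^ 2)) by (simpl; field).
    lra. }
  set (K := fun n => sqrt (supc n * E0)). set (D := fun n => sqrt (supc n * Bd)).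
  assert (HK2 : forall n, K n ^ 2 = supc n * E0).
  { intros n. unfold K. apply pow2_sqrt. apply Rmult_le_pos; [left; apply supc_pos|exact HE0]. }
  destruct (tower_limit u D K) as [U [TU [LU RU]]].
  { intros k; apply (Hu k). }
  { intros n k x Ix. unfold D. rewrite pow2_sqrt by (apply Rmult_le_pos; [left; apply supc_pos|exact HBd]).
    apply Rle_trans with (1 := sup_all _ n x (Hu k) Ix).
    apply Rmult_le_compat_l; [left; apply supc_pos|apply Bu]. }
  { intros; apply sqrt_pos. }
  { intros; apply sqrt_pos. }
  { intros n k x Ix. rewrite HK2, Rmult_assoc.
    apply Rle_trans with (1 := sup_all _ n x (Hdd k) Ix).
    apply Rmult_le_compat_l; [left; apply supc_pos|apply Bdd]. }
  exists U. split.
  - apply (inX_iff sigma Hs). split; [exact TU|split].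
    + destruct (LU 0%nat 1 Icl_1) as [l1 l2].
      assert (V0 : forall k, u k 0%nat 1 = c0) by (intros k; apply (Hu k)).
      apply (is_lim_seq_ext _ (fun _ => 0)) in l1; [|intros k; rewrite V0; reflexivity].
      apply (is_lim_seq_ext _ (fun _ => 0)) in l2; [|intros k; rewrite V0; reflexivity].
      apply is_lim_seq_unique in l1, l2. rewrite Lim_seq_const in l1, l2.
      injection l1 as l1. injection l2 as l2.
      rewrite (surjective_pairing (U 0%nat 1)), <- l1, <- l2. reflexivity.
    (* For each partial sum up to [M] an iterate [u k] is chosen, depending on [M], whose pointwise
       distance to [U] contributes at most 1; the iterate itself contributes at most [Bd], uniformly
       in [k]. *)
    + apply (converges_bounded _ (2 * (Bd + 1))); [intros; now apply XT_nonneg|].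
      intros M.
      set (Dn := fun n => (wcoef sigma n * (1 + INR n / sigma + (INR n / sigma) ^ 2) + sigma * wcoef sigma n)
        * (8 * K (S n) ^ 2)).
      set (SD := sum_f_R0 Dn M).
      destruct (pow_lt_1_zero (/ 2) ltac:(rewrite Rabs_pos_eq; lra) (/ (Rabs SD + 1))) as [k Hk].
      { apply Rinv_0_lt_compat. pose proof (Rabs_pos SD). lra. }
      specialize (Hk k (Nat.le_refl k)). rewrite Rabs_pos_eq in Hk by (apply pow_le; lra).
      pose proof (Hu k) as HX. apply (inX_iff sigma Hs) in HX as [Tk [_ Ck]].
      pose proof (tsub_tower _ _ TU Tk) as Td.
      assert (S1 : sum_f_R0 (XT sigma (tsub U (u k))) M <= SD * (/ 2) ^ k).
      { unfold SD. rewrite Rmult_comm, scal_sum. apply sum_Rle. intros n _.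
        unfold Dn. rewrite !Rmult_assoc. rewrite <- (Rmult_assoc 8).
        apply XT_le_sup; auto. intros x Ix. exact (RU (S n) k x Ix). }
      assert (S2 : SD * (/ 2) ^ k <= 1).
      { pose proof (Rabs_pos SD) as P. pose proof (Rle_abs SD). pose proof (pow_le (/ 2) k ltac:(lra)) as P2.
        apply Rle_trans with ((Rabs SD + 1) * (/ 2) ^ k); [apply Rmult_le_compat_r; lra|].
        apply Rle_trans with ((Rabs SD + 1) * / (Rabs SD + 1)); [apply Rmult_le_compat_l; lra|].
        rewrite Rinv_r; lra. }
      assert (S3 : sum_f_R0 (XT sigma (u k)) M <= Bd).
      { apply Rle_trans with (2 := Bu k). apply sum_le_Series; [intros; now apply XT_nonneg|exact Ck]. }
      apply Rle_trans with (2 * (sum_f_R0 (XT sigma (u k)) M + sum_f_R0 (XT sigma (tsub U (u k))) M)); [|lra].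
      rewrite <- sum_plus, scal_sum. apply sum_Rle. intros n _. rewrite Rmult_comm.
      apply XT_mono; auto. intros x _. unfold tsub, csub, cadd, copp, cnorm2; cbn [fst snd].
      pose proof (pow2_ge_0 (fst (U (S n) x) - 2 * fst (u k (S n) x))).
      pose proof (pow2_ge_0 (snd (U (S n) x) - 2 * snd (u k (S n) x))). lra.
  - apply (solves_shift N lam s s0). apply solves_iff. intros x Ix.
    destruct (LU 1%nat x Ix) as [l1 l2].
    assert (Lim : forall (p : cplx -> R) (a b a' b' : R),
      (forall n y, Icl y -> is_lim_seq (fun k => p (u k n y)) (p (U n y))) ->
      is_lim_seq (fun k => LH N lam (fun n y => p (u (S k) n y)) 0 x
          + (a * fst (u (S k) 1%nat x) + b * snd (u (S k) 1%nat x))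
          - (p (F 0%nat x) - (a' * fst (u k 1%nat x) + b' * snd (u k 1%nat x))))
        (LH N lam (fun n y => p (U n y)) 0 x + (a * fst (U 1%nat x) + b * snd (U 1%nat x))
          - (p (F 0%nat x) - (a' * fst (U 1%nat x) + b' * snd (U 1%nat x))))).
    { intros p a b a' b' Hp.
      assert (Lc : forall a b, is_lim_seq (fun k => a * fst (u k 1%nat x) + b * snd (u k 1%nat x))
        (a * fst (U 1%nat x) + b * snd (U 1%nat x))).
      { intros a0 b0. apply is_lim_seq_plus'.
        - apply (is_lim_seq_scal_l _ a0 (fst (U 1%nat x))), l1.
        - apply (is_lim_seq_scal_l _ b0 (snd (U 1%nat x))), l2. }
      apply is_lim_seq_minus'; [apply is_lim_seq_plus'|].
      - apply (is_lim_seq_incr_1 (fun k => LH N lam (fun n y => p (u k n y)) 0 x)).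
        now apply (LH_limit N lam (fun k n y => p (u k n y))).
      - apply (is_lim_seq_incr_1 (fun k => a * fst (u k 1%nat x) + b * snd (u k 1%nat x))), Lc.
      - apply is_lim_seq_minus'; [apply is_lim_seq_const|apply Lc]. }
    pose proof (Lim fst (Re s0) (- Im s0) (fst c) (- snd c) (fun n y Iy => proj1 (LU n y Iy))) as R1.
    pose proof (Lim snd (Im s0) (Re s0) (snd c) (fst c) (fun n y Iy => proj2 (LU n y Iy))) as R2.
    assert (Z : forall k, res1 N lam s0 (u (S k)) (G (u k)) 0 x = 0 /\ res2 N lam s0 (u (S k)) (G (u k)) 0 x = 0).
    { intros k. apply solves_iff; [apply Su|exact Ix]. }
    unfold res1, res2, G, tsub, tcmul, tshift, csub, cadd, copp, cmul in *; cbn [fst snd] in *.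
    apply (is_lim_seq_ext _ (fun _ => 0)) in R1; [|intros k; destruct (Z k); lra].
    apply (is_lim_seq_ext _ (fun _ => 0)) in R2; [|intros k; destruct (Z k); lra].
    apply is_lim_seq_unique in R1, R2. rewrite Lim_seq_const in R1, R2.
    injection R1 as R1. injection R2 as R2. subst c. cbn [fst snd] in *. split; lra.
Qed.

End Continuity.

(** * The spectral region *)

Lemma cnorm_sq (z : cplx) : cnorm z ^ 2 = cnorm2 z.
Proof. apply pow2_sqrt, cnorm2_nonneg. Qed.

Lemma cnorm_nonneg (z : cplx) : 0 <= cnorm z.
Proof. apply sqrt_pos. Qed.

(** Both alternatives of the region imply the same discriminant condition, which says that
    [sigma xi^2 + Re s xi + |Im s|] has no real zero. *)
Lemma Omega_Im_bound (sigma : R) (s : cplx) : 0 < sigma -> Omega sigma s -> Re s <= 0 ->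
  sigma < Rabs (Im s) /\ Re s ^ 2 < 4 * sigma * Rabs (Im s).
Proof.
  intros Hs [H1 H23] Hr. unfold Omega2, Omega3 in H23.
  assert (Hb : sigma < Rabs (Im s)) by (destruct H1 as [H1|H1]; lra).
  split; [exact Hb|].
  pose proof (cnorm_sq s) as E. unfold cnorm2 in E. fold (Re s) in E. fold (Im s) in E.
  rewrite <- (pow2_abs (Im s)) in E. pose proof (cnorm_nonneg s) as Hn.
  set (r := cnorm s) in *. set (be := Rabs (Im s)) in *.
  set (a := - Re s). replace (Re s) with (- a) in * by (unfold a; ring).
  assert (Ha : 0 <= a) by lra.
  assert (Hra : a < r) by nra.
  assert (Hrb : be <= r) by nra.
  assert (Hr0 : 0 < r) by lra.
  destruct H23 as [[A B]|[_ B]].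
  (* Second region: [r - a <= |Im s|] because [(r - a)(r + a) = (Im s)^2], and multiplying by
     [a <= r] yields even [a^2 <= 2 sigma |Im s|]. *)
  - assert (K : a * r < 2 * sigma * (r - a)).
    { replace (- - a * r / (2 * (r + - a))) with (a * r / (2 * (r - a))) in B by (field; lra).
      apply Rmult_lt_reg_r with (/ (2 * (r - a))); [apply Rinv_0_lt_compat; lra|].
      replace (2 * sigma * (r - a) * / (2 * (r - a))) with sigma by (field; lra). exact B. }
    assert (r - a <= be) by nra.
    assert (K2 : a ^ 2 <= 2 * sigma * be).
    { apply Rmult_le_reg_r with r; [exact Hr0|].
      apply Rle_trans with (a * (2 * sigma * (r - a))); [nra|].
      apply Rle_trans with (r * (2 * sigma * be)); [|lra].
      apply Rmult_le_compat; [lra| |lra|]; nra. }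
    nra.
  (* Third region: with [q = a/r] its defining expression is [sigma r (1 - q^2) - sigma^2 - sigma^2
     (1-q)^2 - a^2/4], and [r (1 - q^2) <= |Im s|] since [(Im s)^2 = r^2 (1 - q^2)]. *)
  - set (q := a / r). assert (Eq : a = q * r) by (unfold q; field; lra).
    replace (- a / r) with (- q) in B by (unfold q; field; lra).
    assert (Hq : r * (1 - q ^ 2) <= be).
    { apply Rmult_le_reg_r with r; [exact Hr0|].
      replace (r * (1 - q ^ 2) * r) with (be ^ 2) by (rewrite Eq in E; nra).
      nra. }
    assert (sigma * (r * (1 - q ^ 2)) <= sigma * be) by (apply Rmult_le_compat_l; lra).
    assert (0 <= sigma ^ 2 * (1 - q) ^ 2) by (apply Rmult_le_pos; apply pow2_ge_0).
    assert (0 <= sigma ^ 2) by apply pow2_ge_0.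
    assert (EB : sigma * (r - sigma + - a) - (sigma * (1 + - q) + / 2 * - a) ^ 2
      = sigma * (r * (1 - q ^ 2)) - sigma ^ 2 - sigma ^ 2 * (1 - q) ^ 2 - a ^ 2 / 4).
    { rewrite Eq. field. }
    lra.
Qed.

Lemma Omega_margin (sigma : R) (s : cplx) : 0 < sigma -> Omega sigma s ->
  exists d, 0 < d /\ ((d < Re s /\ sigma + d < cnorm s) \/ condA sigma d s).
Proof.
  intros Hs HO. destruct (Rle_dec (Re s) 0) as [Hr|Hr].
  - destruct (Omega_Im_bound sigma s Hs HO Hr) as [Hb Ha].
    unfold condA. set (be := Rabs (Im s)) in *. set (r := Re s) in *.
    (* Chosen so that the discriminant stays nonpositive after subtracting [d (1 + xi^2)]: the
       product [4 (sigma - d)(be - d)] loses at most [4 d (sigma + be)]. *)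
    set (d1 := (4 * sigma * be - r ^ 2) / (4 * (sigma + be))).
    assert (Hd1 : 0 < d1) by (unfold d1; apply Rdiv_lt_0_compat; lra).
    assert (Ed1 : d1 * (4 * (sigma + be)) = 4 * sigma * be - r ^ 2) by (unfold d1; field; lra).
    exists (Rmin d1 (be - sigma)).
    pose proof (Rmin_l d1 (be - sigma)) as M1. pose proof (Rmin_r d1 (be - sigma)) as M2.
    assert (M0 : 0 < Rmin d1 (be - sigma)) by (apply Rmin_glb_lt; lra).
    set (d := Rmin d1 (be - sigma)) in *.
    split; [exact M0|right]. split; [lra|]. intros xi Hxi.
    assert (Hds : d < sigma).
    { apply Rle_lt_trans with (1 := M1). pose proof (pow2_ge_0 r). nra. }
    assert (Disc : r ^ 2 <= 4 * (sigma - d) * (be - d)).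
    { assert (d * (4 * (sigma + be)) <= d1 * (4 * (sigma + be))) by (apply Rmult_le_compat_r; lra).
      pose proof (pow2_ge_0 d). lra. }
    assert (0 <= (sigma - d) * xi ^ 2 + r * xi + (be - d)); [|lra].
    apply Rmult_le_reg_l with (4 * (sigma - d)); [lra|].
    replace (4 * (sigma - d) * ((sigma - d) * xi ^ 2 + r * xi + (be - d)))
      with ((2 * (sigma - d) * xi + r) ^ 2 + (4 * (sigma - d) * (be - d) - r ^ 2)) by ring.
    pose proof (pow2_ge_0 (2 * (sigma - d) * xi + r)). lra.
  - destruct HO as [[H1|[H1 H2]] _]; [lra|].
    exists (Rmin (Re s) (cnorm s - sigma) / 2).
    pose proof (Rmin_l (Re s) (cnorm s - sigma)). pose proof (Rmin_r (Re s) (cnorm s - sigma)).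
    assert (0 < Rmin (Re s) (cnorm s - sigma)) by (apply Rmin_glb_lt; lra).
    split; [lra|left; lra].
Qed.

Lemma condA_mono (sigma d d' : R) (s : cplx) : d <= d' -> condA sigma d' s -> condA sigma d s.
Proof.
  intros H [A B]. split; [lra|]. intros xi Hxi. apply Rle_trans with (2 := B xi Hxi).
  apply Rmult_le_compat_r; [pose proof (pow2_ge_0 xi); lra|exact H].
Qed.

Lemma Re_Im_close (z w : cplx) (r : R) : cnorm (csub w z) < r ->
  Rabs (Re w - Re z) < r /\ Rabs (Im w - Im z) < r.
Proof.
  intros H. assert (K : forall x, x ^ 2 <= cnorm2 (csub w z) -> Rabs x < r).
  { intros x Hx. apply Rle_lt_trans with (2 := H). rewrite <- (Rabs_pos_eq _ (cnorm_nonneg _)).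
    apply Rsqr_le_abs_0. unfold Rsqr. pose proof (cnorm_sq (csub w z)). nra. }
  split; apply K; unfold cnorm2, csub, cadd, copp, Re, Im; cbn [fst snd].
  - pose proof (pow2_ge_0 (snd w + - snd z)). unfold Rminus. lra.
  - pose proof (pow2_ge_0 (fst w + - fst z)). unfold Rminus. lra.
Qed.

Lemma cnorm_close (z w : cplx) : cnorm z <= cnorm w + cnorm (csub w z).
Proof.
  pose proof (Cmod_triangle w (copp (csub w z))) as H.
  replace (Cmod (Cplus w (copp (csub w z)))) with (cnorm z) in H.
  2:{ unfold cnorm, Cmod. f_equal. unfold cnorm2, Cplus, csub, cadd, copp; cbn [fst snd]. ring. }
  replace (Cmod (copp (csub w z))) with (cnorm (csub w z)) in H.
  2:{ unfold cnorm, Cmod. f_equal. unfold cnorm2, csub, cadd, copp; cbn [fst snd]. ring. }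
  exact H.
Qed.

(* The index [k] gives the margin [/ (k + 1)], so that one [nat]-indexed cover of the closure
   yields all the uniform constants at once. *)
Definition margin_cover (sigma : R) (k : nat) (s : cplx) : Prop :=
  Rabs (Re s) < INR k + 1 /\ Rabs (Im s) < INR k + 1 /\
  ((/ (INR k + 1) < Re s /\ sigma + / (INR k + 1) < cnorm s) \/
   exists d, / (INR k + 1) < d /\ condA sigma d s).

Lemma margin_cover_open (sigma : R) (k : nat) : openC (margin_cover sigma k).
Proof.
  intros z [H1 [H2 H3]]. set (dk := / (INR k + 1)) in *.
  assert (exists r, r > 0 /\ forall w, cnorm (csub w z) < r ->
    ((dk < Re w /\ sigma + dk < cnorm w) \/ exists d, dk < d /\ condA sigma d w)) as [r [Hr K]].
  { destruct H3 as [[A B]|[d [Hd [A B]]]].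
    - exists (Rmin (Re z - dk) (cnorm z - sigma - dk)).
      pose proof (Rmin_l (Re z - dk) (cnorm z - sigma - dk)). pose proof (Rmin_r (Re z - dk) (cnorm z - sigma - dk)).
      split; [apply Rmin_glb_lt; lra|]. intros w Hw. left.
      destruct (Re_Im_close z w _ Hw) as [K1 _]. apply Rabs_def2 in K1.
      pose proof (cnorm_close z w). split; lra.
    (* Moving [s] by less than [r] lowers the form by at most [r (xi + 1) <= 2 r (1 + xi^2)], so
       with [r = (d - dk)/4] half of the excess margin remains. *)
    - exists ((d - dk) / 4). split; [lra|]. intros w Hw. right. exists ((d + dk) / 2). split; [lra|].
      destruct (Re_Im_close z w _ Hw) as [K1 K2]. apply Rabs_def2 in K1.
      set (r := (d - dk) / 4) in *.
      assert (K3 : Rabs (Im z) - r < Rabs (Im w)).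
      { pose proof (Rabs_triang_inv (Im z) (Im w)) as T.
        rewrite (Rabs_minus_sym (Im z) (Im w)) in T. lra. }
      split; [unfold r in *; lra|]. intros xi Hxi. specialize (B xi Hxi).
      assert (Re z * xi - r * xi <= Re w * xi) by nra.
      assert (r * (xi + 1) <= r * (2 * (1 + xi ^ 2))).
      { apply Rmult_le_compat_l; [unfold r; lra|]. pose proof (pow2_ge_0 (xi - 1)). nra. }
      replace ((d + dk) / 2) with (d - 2 * r) by (unfold r; field). lra. }
  exists (Rmin r (Rmin (INR k + 1 - Rabs (Re z)) (INR k + 1 - Rabs (Im z)))).
  pose proof (Rmin_l r (Rmin (INR k + 1 - Rabs (Re z)) (INR k + 1 - Rabs (Im z)))).
  pose proof (Rmin_r r (Rmin (INR k + 1 - Rabs (Re z)) (INR k + 1 - Rabs (Im z)))).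
  pose proof (Rmin_l (INR k + 1 - Rabs (Re z)) (INR k + 1 - Rabs (Im z))).
  pose proof (Rmin_r (INR k + 1 - Rabs (Re z)) (INR k + 1 - Rabs (Im z))).
  split; [repeat apply Rmin_glb_lt; lra|]. intros w Hw.
  destruct (Re_Im_close z w _ Hw) as [K1 K2].
  assert (T : forall x y, Rabs x <= Rabs y + Rabs (x - y)).
  { intros x y. replace x with (y + (x - y)) at 1 by ring. apply Rabs_triang. }
  pose proof (T (Re w) (Re z)). pose proof (T (Im w) (Im z)).
  split; [lra|split; [lra|]]. apply K. lra.
Qed.

Lemma margin_cover_mono (sigma : R) (k l : nat) (s : cplx) : (k <= l)%nat ->
  margin_cover sigma k s -> margin_cover sigma l s.
Proof.
  intros Hkl [H1 [H2 H3]]. apply le_INR in Hkl. pose proof (pos_INR k).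
  assert (/ (INR l + 1) <= / (INR k + 1)) by (apply Rinv_le_contravar; lra).
  split; [lra|split; [lra|]]. destruct H3 as [H3|[d [H3 H4]]]; [left; lra|].
  right; exists d; split; [lra|exact H4].
Qed.

Lemma margin_cover_Omega (sigma : R) (s : cplx) : 0 < sigma -> Omega sigma s ->
  exists k, margin_cover sigma k s.
Proof.
  intros Hs HO. destruct (Omega_margin sigma s Hs HO) as [d [Hd H]].
  destruct (INR_unbounded (/ d + Rabs (Re s) + Rabs (Im s))) as [k Hk].
  pose proof (Rabs_pos (Re s)). pose proof (Rabs_pos (Im s)).
  assert (0 < / d) by now apply Rinv_0_lt_compat.
  assert (/ (INR k + 1) < d).
  { rewrite <- (Rinv_inv d). apply Rinv_lt_contravar; [apply Rmult_lt_0_compat; lra|lra]. }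
  exists k. split; [lra|split; [lra|]]. destruct H as [H|H]; [left; lra|right; exists d; auto].
Qed.

Lemma uniform_margin (sigma : R) (Ups : cplx -> Prop) : 0 < sigma ->
  compactC (closureC Ups) -> (forall z, closureC Ups z -> Omega sigma z) ->
  exists d M0, 0 < d <= sigma /\ 0 <= M0 /\ forall s, Ups s ->
    Rabs (Re s) <= M0 /\ Rabs (Im s) <= M0 /\
    ((d <= Re s /\ (sigma + d) ^ 2 <= cnorm2 s) \/ condA sigma d s).
Proof.
  intros Hs HK HO.
  destruct (HK nat (margin_cover sigma) (margin_cover_open sigma)) as [l Hl].
  { intros z Hz. apply margin_cover_Omega; auto. }
  set (k := list_max l).
  exists (Rmin sigma (/ (INR k + 1))), (INR k + 1). pose proof (pos_INR k) as Hk.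
  assert (0 < / (INR k + 1)) by (apply Rinv_0_lt_compat; lra).
  pose proof (Rmin_l sigma (/ (INR k + 1))) as M1. pose proof (Rmin_r sigma (/ (INR k + 1))) as M2.
  assert (M3 : 0 < Rmin sigma (/ (INR k + 1))) by (apply Rmin_glb_lt; lra).
  split; [lra|split; [lra|]]. intros s Us.
  destruct (Hl s) as [i [Hi Ci]].
  { intros r Hr. exists s. split; [exact Us|]. unfold cnorm.
    replace (cnorm2 (csub s s)) with 0 by (unfold cnorm2, csub, cadd, copp; cbn [fst snd]; ring).
    rewrite sqrt_0. exact Hr. }
  assert (Hik : (i <= k)%nat).
  { pose proof (proj1 (list_max_le l k) (Nat.le_refl k)) as F. rewrite Forall_forall in F. auto. }
  destruct (margin_cover_mono sigma i k s Hik Ci) as [C1 [C2 C3]].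
  split; [lra|split; [lra|]]. destruct C3 as [[A B]|[d [A B]]].
  - left. split; [lra|]. rewrite <- cnorm_sq. apply pow_incr. lra.
  - right. apply (condA_mono sigma _ d); [lra|exact B].
Qed.

(** Increasing [Re s] only helps: the form in [condA] grows for [xi >= 0], and the lower bound on
    [|s|] comes from a positive real part or from [|Im s|] alone. *)
Lemma good_right (sigma d M0 M1 x : R) (s : cplx) : 0 < sigma -> 0 < d -> 0 <= M0 <= M1 ->
  Rabs (Re s) <= M0 -> Rabs (Im s) <= M0 ->
  ((d <= Re s /\ (sigma + d) ^ 2 <= cnorm2 s) \/ condA sigma d s) ->
  Re s <= x <= M1 -> good sigma d M1 (x, Im s).
Proof.
  intros Hs Hd HM Hr Hi H Hx. apply Rabs_le_between in Hr.
  split; [unfold Re at 1; cbn [fst]; apply Rabs_le; lra|].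
  split; [unfold Im at 1; cbn [snd]; lra|].
  destruct H as [[A B]|[A B]].
  - split; [|left; unfold Re; cbn [fst]; lra]. apply Rle_trans with (1 := B).
    unfold cnorm2; cbn [fst snd]. fold (Re s) (Im s).
    assert (Re s ^ 2 <= x ^ 2) by (apply pow_incr; lra). lra.
  - split.
    + unfold cnorm2; cbn [fst snd]. rewrite <- (pow2_abs (Im s)).
      assert ((sigma + d) ^ 2 <= Rabs (Im s) ^ 2) by (apply pow_incr; lra).
      pose proof (pow2_ge_0 x). lra.
    + right. split; [exact A|]. intros xi Hxi. specialize (B xi Hxi).
      change (Im (x, Im s)) with (Im s). change (Re (x, Im s)) with x.
      assert (Re s * xi <= x * xi) by (apply Rmult_le_compat_r; lra). lra.
Qed.

Lemma segment_solvable (sigma lam C : R) (N : nat) (a b : cplx) : 0 < sigma -> 0 <= C ->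
  (forall r, 0 <= r <= 1 ->
    forall U F, inX sigma U -> inY sigma F ->
      solves N lam ((1 - r) * Re a + r * Re b, (1 - r) * Im a + r * Im b) U F ->
      XS sigma U <= C * YS sigma F) ->
  solvable sigma lam N a -> solvable sigma lam N b.
Proof.
  intros Hs HC HB Ha.
  pose proof (cnorm2_nonneg (csub b a)) as Hn. set (L := cnorm2 (csub b a)) in *.
  (* One constant [C] holds on the whole segment, so [K] equal steps suffice as soon as
     [4 C L <= K^2]. *)
  destruct (INR_unbounded (4 * C * L + 1)) as [K HK].
  assert (HCL : 0 <= 4 * C * L) by (apply Rmult_le_pos; lra).
  assert (HK0 : 0 < INR K) by lra.
  set (pt := fun r : R => ((1 - r) * Re a + r * Re b, (1 - r) * Im a + r * Im b)) in *.
  assert (P : forall j, (j <= K)%nat -> solvable sigma lam N (pt (INR j / INR K))).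
  { induction j as [|j IH]; intros Hj.
    - replace (pt (INR 0 / INR K)) with a; [exact Ha|].
      rewrite (surjective_pairing a) at 1. unfold pt, Re, Im. simpl INR. f_equal; field; lra.
    - assert (Hr : 0 <= INR j / INR K <= 1).
      { apply le_INR in Hj. rewrite S_INR in Hj. pose proof (pos_INR j). split.
        - apply Rdiv_le_0_compat; lra.
        - apply div_le_1; lra. }
      apply (solvable_step sigma lam C N (pt (INR j / INR K)) Hs HC (HB _ Hr)); [|apply IH; lia].
      replace (cnorm2 (csub (pt (INR (S j) / INR K)) (pt (INR j / INR K)))) with (L / INR K ^ 2).
      2:{ unfold L, pt, cnorm2, csub, cadd, copp, Re, Im; cbn [fst snd]. rewrite S_INR. field. lra. }
      replace (4 * C * (L / INR K ^ 2)) with (4 * C * L / INR K ^ 2) by (unfold Rdiv; ring).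
      apply Rmult_le_reg_r with (INR K ^ 2); [apply pow_lt, HK0|].
      replace (4 * C * L / INR K ^ 2 * INR K ^ 2) with (4 * C * L) by (field; lra). nra. }
  specialize (P K (Nat.le_refl K)). replace (pt (INR K / INR K)) with b in P; [exact P|].
  rewrite (surjective_pairing b) at 1. unfold pt, Re, Im. f_equal; field; lra.
Qed.

(** The path runs from the real point [M1] vertically to [M1 + i Im s] and then horizontally to [s];
    every point of it is [good] with the same [d] and [M1], so [apriori] provides one constant for
    all. *)
Lemma uniform_solvability (sigma : R) (Ups : cplx -> Prop) : 0 < sigma ->
  compactC (closureC Ups) -> (forall z, closureC Ups z -> Omega sigma z) ->
  exists (N : nat) (lam C : R), 0 <= C /\ forall s, Ups s ->
    solvable sigma lam N s /\
    forall U F, inX sigma U -> inY sigma F -> solves N lam s U F ->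
      XS sigma U <= C * YS sigma F.
Proof.
  intros Hs HK HO.
  destruct (uniform_margin sigma Ups Hs HK HO) as [d [M0 [Hd [HM0 HU]]]].
  (* Large enough for the Laplace integral, which needs [M1 >= 1], and for [M1 >= sigma + d]; it
     also bounds the real and imaginary parts along the path. *)
  set (M1 := M0 + 2 * sigma + 1).
  destruct (INR_unbounded ((2 * sigma + M1) / d)) as [N HN].
  assert (HN' : 2 * sigma + M1 <= d * (INR N + 1)).
  { apply Rmult_lt_compat_l with (r := d) in HN; [|lra].
    replace (d * ((2 * sigma + M1) / d)) with (2 * sigma + M1) in HN by (field; lra). lra. }
  set (c := INR N * (INR N + 1)).
  assert (Hc : 0 <= c) by (unfold c; pose proof (pos_INR N); nra).
  (* Then [(lam - M1)^2 = 4 (1 + c)^2], which exceeds the [4 + 3 c^2] required for diagonal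
     dominance. *)
  set (lam := M1 + 2 + 2 * c).
  assert (HM1 : 0 <= M1) by (unfold M1; lra).
  destruct (apriori sigma d M1 lam N Hs Hd HM1 HN') as [C [HC AP]].
  { unfold lam; lra. }
  { fold c. unfold lam. nra. }
  exists N, lam, C. split; [exact HC|].
  assert (Est : forall s, good sigma d M1 s -> forall U F, inX sigma U -> inY sigma F ->
    solves N lam s U F -> XS sigma U <= C * YS sigma F).
  { intros s G U F HX HF HE. pose proof HX as [TU [U1 _]]. apply (AP s U F); auto. }
  intros s Us. destruct (HU s Us) as [Hr [Hi Hg]].
  assert (Gx : forall x, Re s <= x <= M1 -> good sigma d M1 (x, Im s)).
  { intros x Hx. apply (good_right sigma d M0 M1 x s); auto; try lra. unfold M1; lra. }
  pose proof Hr as Hr'. apply Rabs_le_between in Hr'.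
  assert (HsM : Re s <= M1) by (unfold M1; lra).
  split.
  2:{ apply Est. pose proof (Gx (Re s) ltac:(lra)) as G.
      replace (Re s, Im s) with s in G by (unfold Re, Im; apply surjective_pairing). exact G. }
  assert (B0 : solvable sigma lam N (M1, 0)).
  { intros F HF. pose proof HF as [TF _].
    destruct (base_solvable M1 lam N F) as [U [TU [U1 SU]]]; [unfold M1; lra|fold c; unfold lam; lra|exact TF|].
    exists U. split; [|exact SU]. apply (AP (M1, 0) U F); auto.
    - repeat split.
      + unfold Re; cbn [fst]. rewrite Rabs_pos_eq; lra.
      + unfold Im; cbn [snd]. rewrite Rabs_R0; lra.
      + unfold cnorm2; cbn [fst snd].
        assert ((sigma + d) ^ 2 <= M1 ^ 2) by (apply pow_incr; unfold M1; lra). lra.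
      + left. unfold Re; cbn [fst]. unfold M1; lra.
    - right. unfold Re; cbn [fst]. unfold M1; lra. }
  assert (B1 : solvable sigma lam N (M1, Im s)).
  { apply (segment_solvable sigma lam C N (M1, 0) (M1, Im s) Hs HC); [|exact B0].
    intros r Hr1. apply Est. unfold Re, Im; cbn [fst snd]. fold (Im s).
    replace ((1 - r) * M1 + r * M1) with M1 by ring. replace ((1 - r) * 0 + r * Im s) with (r * Im s) by ring.
    split; [unfold Re; cbn [fst]; rewrite Rabs_pos_eq; lra|].
    split; [unfold Im at 1; cbn [snd]; rewrite Rabs_mult, (Rabs_pos_eq r) by lra;
            pose proof (Rabs_pos (Im s)); unfold M1; nra|].
    split; [|left; unfold Re; cbn [fst]; unfold M1; lra].
    unfold cnorm2; cbn [fst snd]. pose proof (pow2_ge_0 (r * Im s)).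
    assert ((sigma + d) ^ 2 <= M1 ^ 2) by (apply pow_incr; unfold M1; lra). lra. }
  apply (segment_solvable sigma lam C N (M1, Im s) s Hs HC); [|exact B1].
  intros r Hr1. apply Est. change (Re (M1, Im s)) with M1. change (Im (M1, Im s)) with (Im s).
  replace ((1 - r) * Im s + r * Im s) with (Im s) by ring. apply Gx. split; nra.
Qed.

(** * The resolvent *)

Lemma solves_change (N : nat) (lam : R) (s s0 : cplx) (U F : tower) :
  solves N lam s0 U F -> solves N lam s U (tsub F (tcmul (csub s0 s) (tshift U))).
Proof.
  rewrite !solves_iff. intros H x Ix. destruct (H x Ix) as [H1 H2].
  unfold res1, res2, tsub, tcmul, tshift, csub, cadd, copp, cmul, Re, Im in *; cbn [fst snd] in *.
  split; lra.
Qed.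

Lemma cnorm2_pos (c : cplx) : 0 < cnorm c -> 0 < cnorm2 c.
Proof. intros H. rewrite <- cnorm_sq. apply pow_lt, H. Qed.

Theorem mainTheorem12 (sigma : R) (Ups : cplx -> Prop) :
  sigma > 0 ->
  openC Ups ->
  compactC (closureC Ups) ->
  (forall z, closureC Ups z -> Omega sigma z) ->
  exists (N : nat) (lam : R) (Rop : cplx -> tower -> tower),
    (* existence: R(s) f in X^sigma solves the equation *)
    (forall s F, Ups s -> inY sigma F ->
       inX sigma (Rop s F) /\ solves N lam s (Rop s F) F) /\
    (* uniqueness in X^sigma *)
    (forall s F V, Ups s -> inY sigma F -> inX sigma V -> solves N lam s V F ->
       forall x, Icl x -> V 0%nat x = Rop s F 0%nat x) /\
    (* each R(s) is a bounded operator Y^sigma -> X^sigma *)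
    (forall s, Ups s -> exists Cst, forall F, inY sigma F ->
       normX sigma (Rop s F) <= Cst * normY sigma F) /\
    (* s |-> R(s) is holomorphic in operator norm *)
    (forall s0, Ups s0 -> exists Rd : tower -> tower,
       (exists Cst, forall F, inY sigma F ->
          inX sigma (Rd F) /\ normX sigma (Rd F) <= Cst * normY sigma F) /\
       forall eps, eps > 0 -> exists del, del > 0 /\
         forall s, Ups s -> 0 < cnorm (csub s s0) < del ->
           forall F, inY sigma F ->
             normX sigma (tsub (tcmul (cinv (csub s s0)) (tsub (Rop s F) (Rop s0 F))) (Rd F))
               <= eps * normY sigma F).
Proof.
  intros Hs' _ HK HO. assert (Hs : 0 < sigma) by lra.
  destruct (uniform_solvability sigma Ups Hs HK HO) as [N [lam [C [HC HU]]]].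
  set (Rop := fun s F => epsilon (inhabits (fun _ _ => c0 : cplx))
    (fun U : tower => inX sigma U /\ solves N lam s U F)).
  assert (HR : forall s F, Ups s -> inY sigma F -> inX sigma (Rop s F) /\ solves N lam s (Rop s F) F).
  { intros s F Us HF. unfold Rop. apply epsilon_spec. now apply (HU s Us). }
  assert (Est : forall s U F, Ups s -> inX sigma U -> inY sigma F -> solves N lam s U F ->
    XS sigma U <= C * YS sigma F) by (intros s U F Us; now apply (HU s Us)).
  exists N, lam, Rop. split; [exact HR|split; [|split]].
  (* The difference solves the equation with zero data, so its X norm vanishes, and the supremum
     bound at order 0 forces equality pointwise. *)
  - intros s F V Us HF HV SV x Ix. destruct (HR s F Us HF) as [HW SW].
    pose proof (inX_tsub sigma Hs _ _ HV HW) as HD.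
    destruct (inY_tcmul sigma c0 F Hs HF) as [HZ NZ].
    assert (SD : solves N lam s (tsub V (Rop s F)) (tcmul c0 F)).
    { apply (solves_ext N lam s _ (tsub F F)); [|now apply solves_tsub].
      intros y _. unfold tsub, tcmul, csub, cadd, copp, cmul, c0; cbn [fst snd]. f_equal; ring. }
    pose proof (Est s _ _ Us HD HZ SD) as B. pose proof (sup_all sigma Hs _ 0 x HD Ix) as SB.
    pose proof (supc_pos sigma Hs 0) as SP. pose proof (XS_nonneg sigma Hs _ HD) as XP.
    replace (cnorm2 c0) with 0 in NZ by (unfold cnorm2, c0; cbn [fst snd]; ring).
    assert (E0 : XS sigma (tsub V (Rop s F)) = 0) by nra.
    rewrite E0, Rmult_0_r in SB. unfold tsub, cnorm2, csub, cadd, copp in SB; cbn [fst snd] in SB.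
    rewrite (surjective_pairing (V 0%nat x)), (surjective_pairing (Rop s F 0%nat x)).
    pose proof (pow2_ge_0 (fst (V 0%nat x) + - fst (Rop s F 0%nat x))).
    pose proof (pow2_ge_0 (snd (V 0%nat x) + - snd (Rop s F 0%nat x))).
    f_equal; apply Rminus_diag_uniq, Rsqr_0_uniq; unfold Rsqr; lra.
  - intros s Us. exists (sqrt C). intros F HF. destruct (HR s F Us HF) as [HX SX].
    rewrite (normX_eq sigma Hs _ HX), (normY_eq sigma Hs _ HF), <- sqrt_mult_alt by exact HC.
    apply sqrt_le_1_alt. exact (Est s _ _ Us HX HF SX).
  - intros s0 Us0.
    (* The derivative of the resolvent is [- R(s0) d/dx R(s0)]. *)
    set (Rd := fun F => Rop s0 (tcmul (-1, 0) (tshift (Rop s0 F)))).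
    assert (HRd : forall F, inY sigma F -> inX sigma (Rd F) /\
      solves N lam s0 (Rd F) (tcmul (-1, 0) (tshift (Rop s0 F))) /\
      XS sigma (Rd F) <= C ^ 2 * YS sigma F).
    { intros F HF. destruct (HR s0 F Us0 HF) as [HX SX].
      destruct (inY_tshift sigma Hs _ HX) as [Y1 Y2].
      destruct (inY_tcmul sigma (-1, 0) _ Hs Y1) as [Z1 Z2].
      destruct (HR s0 _ Us0 Z1) as [HX' SX'].
      split; [exact HX'|split; [exact SX'|]].
      replace (cnorm2 (-1, 0)) with 1 in Z2 by (unfold cnorm2; cbn [fst snd]; ring).
      pose proof (Est s0 _ _ Us0 HX HF SX) as B1. pose proof (Est s0 _ _ Us0 HX' Z1 SX') as B2.
      fold (Rd F) in B2. apply Rle_trans with (1 := B2).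
      replace (C ^ 2 * YS sigma F) with (C * (C * YS sigma F)) by ring.
      apply Rmult_le_compat_l; [exact HC|lra]. }
    exists Rd. split.
    + exists C. intros F HF. destruct (HRd F HF) as [HX [_ B]]. split; [exact HX|].
      rewrite (normX_eq sigma Hs _ HX), (normY_eq sigma Hs _ HF).
      rewrite <- (sqrt_pow2 C HC) at 1. rewrite <- sqrt_mult_alt by apply pow2_ge_0.
      now apply sqrt_le_1_alt.
    + intros eps Heps.
      set (K := sqrt (C ^ 3)). assert (HC3 : 0 <= C ^ 3) by now apply pow_le.
      assert (HKp : 0 <= K) by apply sqrt_pos.
      exists (eps / (K + 1)). split; [apply Rdiv_lt_0_compat; lra|].
      intros s Us [Hc0 Hc] F HF. set (c := csub s s0) in *.
      destruct (HR s F Us HF) as [HX SX]. destruct (HR s0 F Us0 HF) as [HX0 SX0].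
      destruct (HRd F HF) as [HXd [SXd Bd]].
      set (z := tsub (tcmul (cinv c) (tsub (Rop s F) (Rop s0 F))) (Rd F)).
      assert (Hz : inX sigma z).
      { apply (inX_tsub sigma Hs); [apply (inX_tcmul sigma Hs), (inX_tsub sigma Hs)|]; assumption. }
      destruct (inY_tshift sigma Hs _ HXd) as [Y1 Y2].
      destruct (inY_tcmul sigma (copp c) _ Hs Y1) as [Z1 Z2].
      pose proof (cnorm2_pos c Hc0) as Hcp.
      (* By the resolvent identity the error of the difference quotient solves the equation at [s]
         with data [- c (Rd F)']. Three uses of the a priori bound give the squared norm [C^3 |c|^2]
         times that of [F], so the error is linear in [|c|]. *)
      assert (Sz : solves N lam s z (tcmul (copp c) (tshift (Rd F)))).
      { pose proof (solves_tsub _ _ _ _ _ _ _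
          (solves_tcmul _ _ _ (cinv c) _ _ (solves_tsub _ _ _ _ _ _ _ SX (solves_change N lam s s0 _ _ SX0)))
          (solves_change N lam s s0 _ _ SXd)) as S1.
        refine (solves_ext N lam s z _ _ _ S1). intros x _.
        replace (csub s0 s) with (copp c)
          by (unfold c, copp, csub, cadd, copp; cbn [fst snd]; f_equal; ring).
        unfold tsub, tcmul, tshift, csub, cadd, copp, cmul, cinv; cbn [fst snd].
        unfold cnorm2 in *. f_equal; field; lra. }
      pose proof (Est s _ _ Us Hz Z1 Sz) as B.
      replace (cnorm2 (copp c)) with (cnorm2 c) in Z2 by (unfold cnorm2, copp; cbn [fst snd]; ring).
      set (YF := YS sigma F) in *.
      assert (HYF : 0 <= YF) by now apply (YS_nonneg sigma Hs).
      assert (B' : XS sigma z <= C ^ 3 * cnorm c ^ 2 * YF).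
      { apply Rle_trans with (1 := B). rewrite cnorm_sq.
        replace (C ^ 3 * cnorm2 c * YF) with (C * (cnorm2 c * (C ^ 2 * YF))) by ring.
        apply Rmult_le_compat_l; [exact HC|]. apply Rle_trans with (1 := Z2).
        apply Rmult_le_compat_l; lra. }
      fold z. rewrite (normX_eq sigma Hs _ Hz), (normY_eq sigma Hs _ HF). fold YF.
      apply Rle_trans with (sqrt (C ^ 3 * cnorm c ^ 2 * YF)); [now apply sqrt_le_1_alt|].
      rewrite sqrt_mult_alt by (apply Rmult_le_pos; [exact HC3|apply pow2_ge_0]).
      rewrite sqrt_mult_alt by exact HC3. rewrite sqrt_pow2 by apply cnorm_nonneg. fold K.
      apply Rmult_le_compat_r; [apply sqrt_pos|].
      apply Rle_trans with (K * (eps / (K + 1))); [apply Rmult_le_compat_l; lra|].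
      apply Rmult_le_reg_r with (K + 1); [lra|].
      replace (K * (eps / (K + 1)) * (K + 1)) with (K * eps) by (field; lra). nra.
Qed.
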